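(* If $\theta\in(0,\pi/2)$ is such that $\delta_\theta(\Gamma)>0$, and $\mu$ is a $\Gamma$-invariant $(b,\theta)$-density (for some $b=(b_1,b_2)\in\mathbb R^2$), then a radial limit point is not a point mass for $\mu$, i.e. $\mu_o(\{\tilde\eta\})=0$ for every $\tilde\eta\in L_\Gamma^{rad}$.
   Context: Setting. A Hadamard space is a complete geodesic CAT(0) metric space. $(X_1,d_1)$, $(X_2,d_2)$ are locally compact Hadamard spaces, and $X=X_1\times X_2$ carries the metric $d=\sqrt{d_1^2+d_2^2}$. $\partial X$, $\partial X_i$ are the geometric boundaries (classes of asymptotic geodesic rays, cone topology). An isometry $h$ of a Hadamard space is axial if there are $l>0$ and a geodesic line $\sigma$ with $h(\sigma(t))=\sigma(t+l)$ for all $t\in\mathbb R$; such $\sigma$ is an axis. It is rank one if it has an axis which does not bound a flat half-plane. Two rank one isometries are independent if their fixed point sets in the geometric boundary are disjoint. $\Gamma\subset \mathrm{Is}(X_1)\times \mathrm{Is}(X_2)$ is a discrete group containing elements $g=(g_1,g_2)$ and $h=(h_1,h_2)$ such that for $i=1,2$, $g_i$ and $h_i$ are independent rank one isometries of $X_i$. $o=(o_1,o_2)\in X$ is a fixed base point. Limit set and slope. $L_\Gamma=\overline{\Gamma\cdot x}\cap\partial X$ (independent of $x\in X$). Every geodesic ray in $X$ has the form $\sigma(t)=(\sigma_1(t\cos\theta),\sigma_2(t\sin\theta))$ with geodesic rays $\sigma_i$ in $X_i$ and $\theta\in[0,\pi/2]$ its slope (a factor being constant if its speed is $0$), which depends only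 on the boundary point. $\partial X_\theta$ is the set of points of $\partial X$ of slope $\theta$; for $\theta\in(0,\pi/2)$ it is identified with $\partial X_1\times\partial X_2$ and its points are written $(\eta_1,\eta_2,\theta)$; $\partial X_0\cong\partial X_1$ and $\partial X_{\pi/2}\cong\partial X_2$. Radial limit set. A point $\tilde\xi\in\partial X$ is a radial limit point if there is a sequence $\gamma_n=(\gamma_{n,1},\gamma_{n,2})\in\Gamma$ such that $\gamma_no\to\tilde\xi$ and: if $\tilde\xi=(\xi_1,\xi_2,\theta)$ with $\theta\in(0,\pi/2)$, then for both $i\in\{1,2\}$ the sequence $\gamma_{n,i}o_i$ stays at bounded distance of one (hence any) geodesic ray in the class of $\xi_i$; if $\tilde\xi=\xi_i\in\partial X_i$ ($i=1$ for slope $0$, $i=2$ for slope $\pi/2$), then $\gamma_{n,i}o_i$ stays at bounded distance of one (hence any) geodesic ray in the class of $\xi_i$. $L_\Gamma^{rad}$ is the set of radial limit points. Exponent of growth. $\delta_\theta(\Gamma)=\liminf_{\varepsilon\to0}\limsup_{n\to\infty}\frac1n\log N_\theta^\varepsilon(n)$, where $N_\theta^\varepsilon(n)=\#\{\gamma=(\gamma_1,\gamma_2)\in\Gamma: n-1<d(o,\gamma o)\le n,\ |\arctan\frac{d_2(o_2,\gamma_2o_2)}{d_1(o_1,\gamma_1o_1)}-\theta|<\varepsilon\}$ (with $\arctan(a/0)=\pi/2$ for $a>0$). $(b,\theta)$-density. For $\eta_i\in\partial X_i$, $\mathcal B_{\eta_i}(x_i,y_i)=\lim_{t\to\infty}(d_i(x_i,\sigma(t))-d_i(y_i,\sigma(t)))$,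 $\sigma$ any ray in the class of $\eta_i$. $\mathcal M^+(\partial X)$ is the cone of positive finite Borel measures on $\partial X$ (weak topology). For $\theta\in(0,\pi/2)$ and $b=(b_1,b_2)\in\mathbb R^2$, a $\Gamma$-invariant $(b,\theta)$-density is a continuous map $\mu:X\to\mathcal M^+(\partial X)$, $x\mapsto\mu_x$, such that for all $x=(x_1,x_2)\in X$: (i) $\emptyset\ne\mathrm{supp}(\mu_x)\subseteq L_\Gamma\cap\partial X_\theta$; (ii) $\gamma_*\mu_x=\mu_{\gamma x}$ for all $\gamma\in\Gamma$, where $\gamma_*\mu_x(E)=\mu_x(\gamma^{-1}E)$; (iii) $\frac{d\mu_x}{d\mu_o}(\tilde\eta)=e^{b_1\mathcal B_{\eta_1}(o_1,x_1)+b_2\mathcal B_{\eta_2}(o_2,x_2)}$ for all $\tilde\eta=(\eta_1,\eta_2,\theta)\in\mathrm{supp}(\mu_o)$. *)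

(* Defs.v *)
From HB Require Import structures.
From mathcomp Require Import all_boot all_order all_algebra.
From mathcomp Require Import generic_quotient.
From mathcomp Require Import all_classical all_reals all_analysis.
From mathcomp Require Import ring lra.

Set Implicit Arguments.
Unset Strict Implicit.
Unset Printing Implicit Defensive.

Import Order.TTheory GRing.Theory Num.Theory.
Import numFieldNormedType.Exports.

Local Open Scope classical_set_scope.
Local Open Scope ring_scope.
Local Open Scope quotient_scope.

(* [hprod T1 T2] carries the metric sqrt (d1^2 + d2^2); the plain product
   [T1 * T2] already carries the sup pseudometric, hence the alias. *)
Definition hprod (T1 T2 : Type) : Type := (T1 * T2)%type.

Section hprod_metric.
Context {R : realType} (T1 T2 : metricType R).

HB.instance Definition _ := Choice.copy (hprod T1 T2) (T1 * T2)%type.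

Definition hdist (x y : hprod T1 T2) : R :=
  Num.sqrt (mdist x.1 y.1 ^+ 2 + mdist x.2 y.2 ^+ 2).

Fact hdistxx x : hdist x x = 0.
Proof. by rewrite /hdist !mdistxx expr0n addr0 sqrtr0. Qed.

Fact hdist_positivity x y : hdist x y = 0 -> x = y.
Proof.
move=> /eqP; rewrite sqrtr_eq0 => xy.
have a0 := sqr_ge0 (mdist x.1 y.1); have b0 := sqr_ge0 (mdist x.2 y.2).
have /eqP : mdist x.1 y.1 ^+ 2 = 0 by lra.
have /eqP : mdist x.2 y.2 ^+ 2 = 0 by lra.
rewrite !sqrf_eq0 => /eqP /mdist_positivity e2 /eqP /mdist_positivity e1.
by case: x y e1 e2 {xy a0 b0} => [x1 x2] [y1 y2] /= -> ->.
Qed.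

Fact hdist_sym x y : hdist x y = hdist y x.
Proof. by rewrite /hdist !(metric_sym x.1) !(metric_sym x.2). Qed.

Fact minkowski2 (a b c d : R) :
  Num.sqrt ((a + c) ^+ 2 + (b + d) ^+ 2) <=
  Num.sqrt (a ^+ 2 + b ^+ 2) + Num.sqrt (c ^+ 2 + d ^+ 2).
Proof.
set p := Num.sqrt (a ^+ 2 + _); set q := Num.sqrt (c ^+ 2 + _).
have p0 : 0 <= p by exact: sqrtr_ge0.
have q0 : 0 <= q by exact: sqrtr_ge0.
have pE : p ^+ 2 = a ^+ 2 + b ^+ 2 by rewrite sqr_sqrtr// addr_ge0 ?sqr_ge0.
have qE : q ^+ 2 = c ^+ 2 + d ^+ 2 by rewrite sqr_sqrtr// addr_ge0 ?sqr_ge0.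
have cs : a * c + b * d <= p * q.
  have [neg|pos] := leP (a * c + b * d) 0.
    by rewrite (le_trans neg)// mulr_ge0.
  rewrite -(ler_pXn2r (ltn0Sn 1)) ?nnegrE ?(ltW pos) ?mulr_ge0//.
  rewrite exprMn pE qE.
  have := sqr_ge0 (a * d - b * c); nra.
rewrite -[leRHS]ger0_norm ?addr_ge0// -sqrtr_sqr ler_sqrt ?sqr_ge0//.
rewrite (sqrrD p q) pE qE; nra.
Qed.

Fact hdist_triangle y x z : hdist x z <= hdist x y + hdist y z.
Proof.
apply: le_trans (minkowski2 _ _ _ _); rewrite ler_sqrt ?addr_ge0 ?sqr_ge0//.
have tri (T : metricType R) (u v w : T) :
    mdist u w ^+ 2 <= (mdist u v + mdist v w) ^+ 2.
  by rewrite ler_pXn2r ?nnegrE ?addr_ge0 ?mdist_ge0// metric_triangle.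
by apply: lerD; exact: tri.
Qed.

HB.instance Definition _ := @isMetric.Build R (hprod T1 T2)
  hdist hdistxx hdist_positivity hdist_sym hdist_triangle.

End hprod_metric.

Section hadamard_spaces.
Context {R : realType}.

(* the Euclidean plane, with its Euclidean metric *)
Definition plane : Type := hprod R^o R^o.
HB.instance Definition _ := Metric.on plane.

Definition geodesic_segment (T : metricType R) (c : R -> T) (x y : T) :=
  [/\ c 0 = x, c (mdist x y) = y &
      forall s t, 0 <= s <= mdist x y -> 0 <= t <= mdist x y ->
        mdist (c s) (c t) = `|s - t|].

Definition geodesic_line (T : metricType R) (c : R -> T) :=
  forall s t, mdist (c s) (c t) = `|s - t|.

Definition geodesic_space (T : metricType R) :=
  forall x y : T, exists c, geodesic_segment c x y.

(* Comparison of geodesic triangles with their comparison triangles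
   (xb, yb, zb) in the plane; any two sides of a triangle share a vertex,
   called x here, and the comparison is trivial on a single side. *)
Definition cat0 (T : metricType R) :=
  forall (x y z : T) (cy cz : R -> T) (xb yb zb : plane) (cyb czb : R -> plane),
    geodesic_segment cy x y -> geodesic_segment cz x z ->
    mdist xb yb = mdist x y -> mdist xb zb = mdist x z ->
    mdist yb zb = mdist y z ->
    geodesic_segment cyb xb yb -> geodesic_segment czb xb zb ->
    forall s t, 0 <= s <= mdist x y -> 0 <= t <= mdist x z ->
      mdist (cy s) (cz t) <= mdist (cyb s) (czb t).

Definition complete_space (T : metricType R) :=
  forall F : set_system T, ProperFilter F -> cauchy F -> exists x : T, F --> x.

Definition hadamard (T : metricType R) :=
  [/\ complete_space T, geodesic_space T & cat0 T].

End hadamard_spaces.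

Section boundary.
Context {R : realType} (T : metricType R).

(* Only the values at nonnegative times matter. *)
Record ray := Ray {
  ray_fun :> R -> T ;
  ray_geodesic : forall s t, 0 <= s -> 0 <= t ->
    mdist (ray_fun s) (ray_fun t) = `|s - t| }.

HB.instance Definition _ := gen_eqMixin ray.
HB.instance Definition _ := gen_choiceMixin ray.

Definition asymptotic (c c' : ray) : bool :=
  `[< exists C, forall t, 0 <= t -> mdist (c t) (c' t) <= C >].

Fact asymptotic_refl : reflexive asymptotic.
Proof. by move=> c; apply/asboolP; exists 0 => t _; rewrite mdistxx. Qed.

Fact asymptotic_sym : symmetric asymptotic.
Proof.
move=> c c'; apply/asboolP/asboolP => -[C H]; exists C => t t0;
  by rewrite metric_sym H.
Qed.

Fact asymptotic_trans : transitive asymptotic.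
Proof.
move=> c2 c1 c3 /asboolP[C H] /asboolP[C' H']; apply/asboolP; exists (C + C').
by move=> t t0; rewrite (le_trans (metric_triangle _ (c2 t) _))// lerD ?H ?H'.
Qed.

Definition asymptotic_equiv :=
  EquivRel asymptotic asymptotic_refl asymptotic_sym asymptotic_trans.

Definition boundary : Type := {eq_quot asymptotic_equiv}.

HB.instance Definition _ := Quotient.on boundary.
HB.instance Definition _ := Choice.on boundary.

Definition endpoint (c : ray) : boundary := \pi_boundary c.

(* the union of the space and its geometric boundary *)
Definition bordification : Type := (T + boundary)%type.
HB.instance Definition _ := Choice.on bordification.

(* Points z outside the closed r-ball around c 0 for which the geodesic from
   c 0 to z passes at time r at distance < e from c r. *)
Definition cone_nbhd (c : ray) (r e : R) : set bordification := fun z =>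
  match z with
  | inl y => r < mdist (c 0) y /\
      exists g, geodesic_segment g (c 0) y /\ mdist (g r) (c r) < e
  | inr xi => exists g : ray,
      [/\ endpoint g = xi, g 0 = c 0 & mdist (g r) (c r) < e]
  end.

(* The cone topology: it is generated by the open sets of T and the sets
   [cone_nbhd c r e] (for rays c with a fixed origin these already generate it
   in a Hadamard space, whatever the origin). *)
Definition cone_subbase : set (set bordification) :=
  [set inl @` U | U in [set U : set T | open U]] `|`
  [set V | exists c r e, [/\ 0 < r, 0 < e & V = cone_nbhd c r e]].

HB.instance Definition _ :=
  @isSubBaseTopological.Build bordification (set bordification)
    cone_subbase id.

HB.instance Definition _ := Topological.copy boundary
  (initial_topology (inr : boundary -> bordification)).

Definition busemann (eta : boundary) (x y : T) : R :=
  lim ((mdist x ((repr eta : ray) t) - mdist y ((repr eta : ray) t))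
         @[t --> +oo]).

(* A measurable type must be pointed, so the Borel space of the boundary takes
   a boundary point as parameter; it has no other use, and a product with a
   factor having a rank one isometry does have a boundary point (see
   [boundary_inhabited] below). *)
Definition pboundary (xi0 : boundary) : Type := boundary.
HB.instance Definition _ xi0 := Topological.on (pboundary xi0).
HB.instance Definition _ xi0 := isPointed.Build (pboundary xi0) xi0.

Definition borel_boundary (xi0 : boundary) :=
  g_sigma_algebraType (@open (pboundary xi0)).

End boundary.

Arguments endpoint {R T}.
Arguments busemann {R T}.

Section isometries.
Context {R : realType} (T : metricType R).

Record selfisometry := Isometry {
  isometry_fun :> T -> T ;
  isometry_dist : forall x y,
    mdist (isometry_fun x) (isometry_fun y) = mdist x y ;
  isometry_surj : forall y, exists x, isometry_fun x = y }.

HB.instance Definition _ := gen_eqMixin selfisometry.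
HB.instance Definition _ := gen_choiceMixin selfisometry.

Lemma isometry_eq (g h : selfisometry) : g =1 h -> g = h.
Proof.
case: g h => [g dg sg] [h dh sh] /= /funext gh; case: _ / gh in dh sh *.
by rewrite (Prop_irrelevance dg dh) (Prop_irrelevance sg sh).
Qed.

Fact isometry_one_surj (y : T) : exists x, id x = y. Proof. by exists y. Qed.

Definition isometry_one : selfisometry :=
  Isometry (fun=> fun=> erefl) isometry_one_surj.

Fact isometry_mul_dist (g h : selfisometry) x y :
  mdist ((g \o h) x) ((g \o h) y) = mdist x y.
Proof. by rewrite /= !isometry_dist. Qed.

Fact isometry_mul_surj (g h : selfisometry) y : exists x, (g \o h) x = y.
Proof.
have [x <-] := isometry_surj g y.
by have [z <-] := isometry_surj h x; exists z.
Qed.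

Definition isometry_mul (g h : selfisometry) : selfisometry :=
  Isometry (isometry_mul_dist g h) (isometry_mul_surj g h).

Definition isometry_inv_fun (g : selfisometry) (y : T) : T :=
  sval (cid (isometry_surj g y)).

Fact isometry_inv_funK g : cancel (isometry_inv_fun g) g.
Proof. by move=> y; rewrite /isometry_inv_fun; case: cid. Qed.

Fact isometry_inj (g : selfisometry) : injective g.
Proof.
move=> x y gxy; apply: mdist_positivity.
by rewrite -(isometry_dist g) gxy mdistxx.
Qed.

Fact isometry_inv_dist (g : selfisometry) x y :
  mdist (isometry_inv_fun g x) (isometry_inv_fun g y) = mdist x y.
Proof. by rewrite -(isometry_dist g) !isometry_inv_funK. Qed.

Fact isometry_inv_surj (g : selfisometry) y :
  exists x, isometry_inv_fun g x = y.
Proof.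
by exists (g y); apply: (@isometry_inj g); rewrite isometry_inv_funK.
Qed.

Definition isometry_inv (g : selfisometry) : selfisometry :=
  Isometry (isometry_inv_dist g) (isometry_inv_surj g).

Fact isometry_mulA : associative isometry_mul.
Proof. by move=> f g h; apply: isometry_eq. Qed.
Fact isometry_mul1 : left_id isometry_one isometry_mul.
Proof. by move=> g; apply: isometry_eq. Qed.
Fact isometry_mulr1 : right_id isometry_one isometry_mul.
Proof. by move=> g; apply: isometry_eq. Qed.
Fact isometry_mulV : left_inverse isometry_one isometry_inv isometry_mul.
Proof.
move=> g; apply: isometry_eq => x; apply: (@isometry_inj g).
by rewrite /= isometry_inv_funK.
Qed.
Fact isometry_mulrV : right_inverse isometry_one isometry_inv isometry_mul.
Proof. by move=> g; apply: isometry_eq => x; rewrite /= isometry_inv_funK. Qed.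

HB.instance Definition _ :=
  isGroup.Build selfisometry isometry_mulA isometry_mul1 isometry_mulr1
    isometry_mulV isometry_mulrV.

(* the compact-open topology, for which discreteness is meant *)
HB.instance Definition _ := Topological.copy selfisometry
  (initial_topology (isometry_fun : selfisometry -> {compact-open, T -> T})).

Fact ray_act_geodesic (g : selfisometry) (c : ray T) s t : 0 <= s -> 0 <= t ->
  mdist ((g \o c) s) ((g \o c) t) = `|s - t|.
Proof. by move=> s0 t0; rewrite /= isometry_dist ray_geodesic. Qed.

Definition ray_act (g : selfisometry) (c : ray T) : ray T :=
  Ray (ray_act_geodesic g c).

Definition boundary_act (g : selfisometry) (xi : boundary T) : boundary T :=
  endpoint (ray_act g (repr xi)).

Definition axis (h : selfisometry) (c : R -> T) :=
  geodesic_line c /\ exists2 l, 0 < l & forall t, h (c t) = c (t + l).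

Definition bounds_flat_half_plane (c : R -> T) :=
  exists2 F : plane -> T,
    (forall p q : plane, 0 <= p.2 -> 0 <= q.2 ->
      mdist (F p) (F q) = mdist p q) &
    forall t, F (t, 0) = c t.

Definition rank_one (h : selfisometry) :=
  exists2 c, axis h c & ~ bounds_flat_half_plane c.

Definition independent (g h : selfisometry) :=
  [set xi | boundary_act g xi = xi] `&` [set xi | boundary_act h xi = xi]
  = set0.

End isometries.

Section product.
Context {R : realType} (T1 T2 : metricType R).
Local Notation X := (hprod T1 T2).
Local Notation G := (selfisometry T1 * selfisometry T2)%type.

Definition prod_fun (g : G) (x : X) : X := (g.1 x.1, g.2 x.2).

Fact prod_dist (g : G) (x y : X) :
  mdist (prod_fun g x) (prod_fun g y) = mdist x y.
Proof. by rewrite /mdist /= /hdist /= !isometry_dist. Qed.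

Fact prod_surj (g : G) (y : X) : exists x, prod_fun g x = y.
Proof.
case: y => y1 y2; have [x1 <-] := isometry_surj g.1 y1.
by have [x2 <-] := isometry_surj g.2 y2; exists (x1, x2).
Qed.

Definition prod_isometry (g : G) : selfisometry X :=
  Isometry (prod_dist g) (prod_surj g).

Lemma boundary_inhabited (h : selfisometry T1) (x2 : T2) :
  rank_one h -> inhabited (boundary X).
Proof.
move=> [c [lc _] _].
have geo s t : 0 <= s -> 0 <= t -> mdist ((c s, x2) : X) (c t, x2) = `|s - t|.
  move=> _ _; rewrite /mdist /= /hdist /= lc mdistxx expr0n addr0.
  by rewrite sqrtr_sqr normr_id.
by constructor; exact: endpoint (Ray geo).
Qed.

(* xi has slope theta and factors eta1, eta2 *)
Definition bd_coord (xi : boundary X) (eta1 : boundary T1) (eta2 : boundary T2)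
    (theta : R) :=
  exists (c : ray X) (c1 : ray T1) (c2 : ray T2),
    [/\ endpoint c = xi, endpoint c1 = eta1, endpoint c2 = eta2 &
        forall t, 0 <= t -> c t = (c1 (t * cos theta), c2 (t * sin theta))].

(* xi has slope 0 (resp. pi / 2): its second (resp. first) factor is constant *)
Definition bd_coord0 (xi : boundary X) (eta1 : boundary T1) :=
  exists (c : ray X) (c1 : ray T1) (x2 : T2),
    [/\ endpoint c = xi, endpoint c1 = eta1 &
        forall t, 0 <= t -> c t = (c1 t, x2)].

Definition bd_coord_pihalf (xi : boundary X) (eta2 : boundary T2) :=
  exists (c : ray X) (x1 : T1) (c2 : ray T2),
    [/\ endpoint c = xi, endpoint c2 = eta2 &
        forall t, 0 <= t -> c t = (x1, c2 t)].

(* to be used for theta in ]0, pi / 2[ only *)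
Definition boundary_slope (theta : R) : set (boundary X) :=
  [set xi | exists eta1 eta2, bd_coord xi eta1 eta2 theta].

Definition group_orbit (Gamma : set G) (x : X) : set X :=
  [set prod_isometry g x | g in Gamma].

Definition limit_set (Gamma : set G) (o : X) : set (boundary X) :=
  [set xi | closure ((inl : X -> bordification X) @` group_orbit Gamma o)
              (inr xi : bordification X)].

Definition bounded_dist_ray (T : metricType R)
    (u : nat -> T) (eta : boundary T) :=
  exists c : ray T, endpoint c = eta /\
    exists C, forall n, exists2 t, 0 <= t & mdist (u n) (c t) <= C.

Definition radial_limit_set (Gamma : set G) (o : X) : set (boundary X) :=
  [set xi | exists g : nat -> G,
    [/\ forall n, Gamma (g n),
        (inl (prod_isometry (g n) o) : bordification X) @[n --> \oo]
          --> (inr xi : bordification X) &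
        [\/ exists (theta : R) eta1 eta2,
              [/\ 0 < theta < pi / 2, bd_coord xi eta1 eta2 theta,
                  bounded_dist_ray (fun n => (g n).1 o.1) eta1 &
                  bounded_dist_ray (fun n => (g n).2 o.2) eta2],
            exists eta1, bd_coord0 xi eta1 /\
              bounded_dist_ray (fun n => (g n).1 o.1) eta1 |
            exists eta2, bd_coord_pihalf xi eta2 /\
              bounded_dist_ray (fun n => (g n).2 o.2) eta2]]].

(* arctan (d2 / d1), with arctan (a / 0) = pi / 2 *)
Definition displacement_slope (o : X) (g : G) : R :=
  let d1 := mdist o.1 (g.1 o.1) in let d2 := mdist o.2 (g.2 o.2) in
  if d1 == 0 then pi / 2 else atan (d2 / d1).

Definition orbit_count (Gamma : set G) (o : X) (theta e : R) (n : nat)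
    : \bar R :=
  counting [set g | [/\ Gamma g,
    n%:R - 1 < mdist o (prod_isometry g o) <= n%:R &
    `|displacement_slope o g - theta| < e]].

(* [lne 0] is -oo *)
Definition growth_exponent (Gamma : set G) (o : X) (theta : R) : \bar R :=
  limf_einf (fun e : R =>
    limn_esup (fun n => ((n%:R^-1)%:E * lne (orbit_count Gamma o theta e n))%E))
    0^'+.

Definition discrete_group (Gamma : set G) :=
  group_closed (mem Gamma) /\ Gamma `<=` isolated Gamma.

Definition msupport (xi0 : boundary X)
    (m : {finite_measure set (borel_boundary xi0) -> \bar R}) :
    set (boundary X) :=
  [set xi | forall U : set (boundary X), open U -> U xi -> (0 < m U)%E].

(* f is a version of the Radon-Nikodym derivative dm'/dm *)
Definition RN_version (xi0 : boundary X)
    (m' m : {finite_measure set (borel_boundary xi0) -> \bar R})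
    (f : borel_boundary xi0 -> R) :=
  [/\ measurable_fun setT f, forall xi, 0 <= f xi &
      forall E : set (borel_boundary xi0), measurable E ->
        m' E = (\int[m]_(xi in E) (f xi)%:E)%E].

Definition weakly_continuous (xi0 : boundary X)
    (mu : X -> {finite_measure set (borel_boundary xi0) -> \bar R}) :=
  forall f : borel_boundary xi0 -> R,
    continuous (f : boundary X -> R) ->
    continuous (fun x => \int[mu x]_xi f xi : R).

Definition invariant_density (Gamma : set G) (o : X) (b : R * R) (theta : R)
    (xi0 : boundary X)
    (mu : X -> {finite_measure set (borel_boundary xi0) -> \bar R}) :=
  weakly_continuous mu /\
  forall x : X,
    [/\ msupport (mu x) !=set0 /\
          msupport (mu x) `<=` limit_set Gamma o `&` boundary_slope theta,
        forall g, Gamma g ->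
        forall E : set (borel_boundary xi0), measurable E ->
          mu x (boundary_act (prod_isometry g) @^-1` E) =
          mu (prod_isometry g x) E &
        exists2 f, RN_version (mu x) (mu o) f &
          forall eta eta1 eta2,
            msupport (mu o) eta -> bd_coord eta eta1 eta2 theta ->
            f eta = expR (b.1 * busemann eta1 o.1 x.1 +
                          b.2 * busemann eta2 o.2 x.2)].

End product.

(* Main.v *)
(* Let eta be a radial limit point of positive mass and (d1, d2) the factorwise
   displacements of o. Invariance and the density formula give
   mu_o(gamma^-1 eta) = exp (b1 B1(o, gamma o) + b2 B2(o, gamma o)) mu_o(eta), and
   along a radial sequence gamma_n the exponent is b1 d1 + b2 d2 up to a bounded
   error, while d1 : d2 tends to cos theta : sin theta. As the masses are bounded,
   it is enough to see that beta = b1 cos theta + b2 sin theta is positive.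

   The atom itself shows beta >= delta_theta, and replaces the shadow lemma. A
   power of h moves eta to an atom zeta whose two factors are not end points of
   the axes of g1, g2. These axes are contracting, so for each gamma one of
   three fixed powers g^k makes the geodesics from gamma^-1 o_i to g^k zeta_i pass
   near o_i in both factors. Then gamma g^k zeta is an atom of mass at least
   c exp (- b1 d1 - b2 d2). If two gamma give the same atom, their orbit points lie
   near the same segments in both factors, so the multiplicity is polynomial in
   d(o, gamma o), and summing over an annulus bounds delta_theta by beta.

   An axis s bounding no flat half-plane is contracting: for some D no line is
   parallel to s at distance D, since flat strips of all widths would converge to
   a half-plane. By compactness and periodicity, perpendiculars to s diverge
   beyond height D, linearly in the height with a rate k. A geodesic at height
   >= r >> D whose projection has length L thus has length at least of order
   k r L, and by convexity it stays close to the perpendicular at its start until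
   its height is comparable to L; this bounds L. *)

Require Import Defs.
From HB Require Import structures.
From mathcomp Require Import all_boot all_order all_algebra.
From mathcomp Require Import generic_quotient.
From mathcomp Require Import all_classical all_reals all_analysis.
From mathcomp Require Import ring lra.

Set Implicit Arguments.
Unset Strict Implicit.
Unset Printing Implicit Defensive.

Import Order.TTheory GRing.Theory Num.Theory.
Import numFieldNormedType.Exports.

Local Open Scope classical_set_scope.
Local Open Scope ring_scope.

(** * CAT(0) inequalities *)

(** The product of an axis of [g.1] and an axis of [g.2] is a flat plane, so contraction is
    available only factor by factor. This is the obstacle that shapes the proof: one power of g must
    serve both factors at once, and orbit points must be located in both factors before discreteness
    of Gamma can be applied.

    The code shows only beta > 0, by contradiction. If beta <= 0, half of the exponential growth
    rate pays for the masses of the atoms, whose exponents vary with the slope near theta, and the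
    other half absorbs the polynomial multiplicity.

    Neither angles nor comparison triangles occur after the CN inequality has been derived.
    Reshetnyak's inequality replaces them, and points of geodesics are given by distances alone. *)

Lemma hdist_plane (R : realType) (p q : @plane R) :
  mdist p q = Num.sqrt ((q.1 - p.1) ^+ 2 + (q.2 - p.2) ^+ 2).
Proof. by rewrite /mdist /= /hdist /mdist /= !real_normK ?num_real. Qed.

Lemma hdist_sqr (R : realType) (T1 T2 : metricType R) (x y : hprod T1 T2) :
  mdist x y ^+ 2 = mdist x.1 y.1 ^+ 2 + mdist x.2 y.2 ^+ 2.
Proof. by rewrite {1}/mdist /= /hdist sqr_sqrtr// addr_ge0// sqr_ge0. Qed.

Section between.
Context {R : realType} {T : metricType R}.
Implicit Types x y z m : T.

(** Two distances describe a point of a geodesic, so no parametrised curve has to be carried along;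
    under the CN inequality they determine it ([btw_uniq]). *)
Definition btw (l : R) x m y :=
  mdist x m = l * mdist x y /\ mdist m y = (1 - l) * mdist x y.

Lemma btw_sym l x m y : btw l x m y -> btw (1 - l) y m x.
Proof.
by move=> [h1 h2]; split; rewrite metric_sym (metric_sym y x)// subKr.
Qed.

Lemma concat_segment (c1 c2 : R -> T) x m y :
  mdist x m + mdist m y = mdist x y ->
  geodesic_segment c1 x m -> geodesic_segment c2 m y ->
  geodesic_segment
    (fun s => if s <= mdist x m then c1 s else c2 (s - mdist x m)) x y.
Proof.
move=> e [c10 c11 c1d] [c20 c21 c2d].
have a0 := mdist_ge0 x m; have b0 := mdist_ge0 m y.
have mix s t : 0 <= s <= mdist x m -> mdist x m < t <= mdist x y ->
    mdist (c1 s) (c2 (t - mdist x m)) = t - s.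
  move=> hs ht.
  have e1 : mdist (c1 s) m = mdist x m - s.
    by rewrite -[in LHS]c11 c1d ?ler0_norm; lra.
  have e2 : mdist m (c2 (t - mdist x m)) = t - mdist x m.
    by rewrite -{1}c20 c2d ?ler0_norm; lra.
  have e3 : mdist x (c1 s) = s.
    by rewrite -[in LHS]c10 c1d ?ler0_norm; lra.
  have e4 : mdist (c2 (t - mdist x m)) y = mdist x y - t.
    by rewrite -[in LHS]c21 c2d ?ler0_norm; lra.
  have := metric_triangle (c1 s) m (c2 (t - mdist x m)).
  have := metric_triangle x (c1 s) y.
  have := metric_triangle (c1 s) (c2 (t - mdist x m)) y.
  by rewrite e1 e2 e3 e4; lra.
split; first by rewrite a0.
  case: ifPn => h; last by rewrite -e addrAC subrr add0r.
  have e1 : mdist m y = 0 by lra.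
  by rewrite -e e1 addr0 c11 (mdist_positivity _ _ e1).
move=> s t hs ht; case: ifPn => s1; case: ifPn => t1.
- by apply: c1d; lra.
- by rewrite mix ?ler0_norm; lra.
- by rewrite metric_sym mix ?ger0_norm; lra.
- rewrite c2d; [|lra..]; congr (`|_|); lra.
Qed.

(** Stewart's formula of the plane as an inequality: the Bruhat-Tits form of CAT(0), from which the
    later comparison arguments are derived. *)
Definition cn_ineq := forall l x m y z, 0 <= l <= 1 -> btw l x m y ->
  mdist m z ^+ 2 <=
  (1 - l) * mdist x z ^+ 2 + l * mdist y z ^+ 2 - l * (1 - l) * mdist x y ^+ 2.

Lemma cat0_cn : geodesic_space T -> cat0 T -> cn_ineq.
Proof.
move=> G C l x m y z l01 [h1 h2].
have := mdist_ge0 x y; rewrite le_eqVlt => /orP[/eqP a0|a_gt0].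
  rewrite -a0 mulr0 in h1; rewrite -a0 -(mdist_positivity _ _ h1).
  by rewrite (mdist_positivity _ _ (esym a0)); lra.
set a := mdist x y in h1 h2 a_gt0 *.
have [c1 s1] := G x m; have [c2 s2] := G m y; have [cz sz] := G x z.
have e : mdist x m + mdist m y = mdist x y by rewrite h1 h2; rewrite /a; ring.
have sy := concat_segment e s1 s2.
set cy := (fun s => _) in sy.
have ecy : cy (mdist x m) = m by rewrite /cy lexx; case: s1.
have b0 := mdist_ge0 x z; have c0 := mdist_ge0 y z.
have tr1 := metric_triangle x z y; have tr2 := metric_triangle x y z.
have tr3 := metric_triangle y x z.
rewrite (metric_sym z y) -/a in tr1; rewrite -/a in tr2.
rewrite (metric_sym y x) -/a in tr3.
set b := mdist x z in b0 tr1 tr2 tr3 *; set c := mdist y z in c0 tr1 tr2 tr3 *.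
(* The comparison triangle is (0, 0), (a, 0), (u, v). The law of cosines gives u, and |u| <= b by
   the triangle inequalities, so v exists. *)
pose u := (a ^+ 2 + b ^+ 2 - c ^+ 2) / (2 * a).
have uE : 2 * a * u = a ^+ 2 + b ^+ 2 - c ^+ 2.
  by rewrite /u mulrC divfK// mulf_neq0// ?pnatr_eq0// gt_eqF.
have u1 : u <= b.
  rewrite -(ler_pM2l (_ : 0 < 2 * a)); last lra.
  by rewrite uE; nra.
have u2 : - b <= u.
  rewrite -(ler_pM2l (_ : 0 < 2 * a)); last lra.
  by rewrite uE; nra.
have ub : u ^+ 2 <= b ^+ 2 by nra.
pose v := Num.sqrt (b ^+ 2 - u ^+ 2).
have vE : v ^+ 2 = b ^+ 2 - u ^+ 2 by rewrite sqr_sqrtr// subr_ge0.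
pose xb : @plane R := (0, 0); pose yb : @plane R := (a, 0).
pose zb : @plane R := (u, v).
have dxy : mdist xb yb = a.
  by rewrite hdist_plane /= !subr0 expr0n addr0 sqrtr_sqr gtr0_norm.
have dxz : mdist xb zb = b.
  by rewrite hdist_plane /= !subr0 vE addrC subrK sqrtr_sqr ger0_norm.
have dyz : mdist yb zb = c.
  rewrite hdist_plane /= !subr0 vE -[RHS]ger0_norm// -sqrtr_sqr; congr Num.sqrt.
  by lra.
pose cyb : R -> @plane R := fun s => (s, 0).
pose czb : R -> @plane R := fun t => (t / b * u, t / b * v).
have syb : geodesic_segment cyb xb yb.
  split; [by []|by rewrite dxy|move=> s t _ _].
  by rewrite hdist_plane /= subrr expr0n addr0 sqrtr_sqr distrC.
have szb : geodesic_segment czb xb zb.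
  split; first by rewrite /czb !mul0r.
    rewrite dxz /czb; have [b00|b_n0] := eqVneq b 0.
      have uu : u = 0 by lra.
      have vv : v = 0.
        by apply/eqP; rewrite -sqrf_eq0 vE b00 uu expr0n subrr.
      by rewrite /zb uu vv !mulr0.
    by rewrite divff// !mul1r.
  move=> s t hs ht; rewrite hdist_plane /=; rewrite dxz in hs ht.
  have [b00|b_n0] := eqVneq b 0.
    have -> : s = 0 by lra.
    have -> : t = 0 by lra.
    by rewrite b00 !mul0r !subrr expr0n addr0 sqrtr0 normr0.
  have -> : (t / b * u - s / b * u) ^+ 2 + (t / b * v - s / b * v) ^+ 2 =
    ((t - s) / b) ^+ 2 * (u ^+ 2 + v ^+ 2) by ring.
  rewrite vE (addrC (u ^+ 2)) subrK -exprMn divfK//.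
  by rewrite sqrtr_sqr distrC.
(* Comparing the point m of one side with the opposite vertex z is enough. *)
have := C x y z cy cz xb yb zb cyb czb sy sz dxy dxz dyz syb szb (l * a) b.
rewrite lexx b0 -/a => /(_ _ isT).
have -> : 0 <= l * a <= a.
  by case/andP: l01 => l0 l1; rewrite mulr_ge0 ?ler_piMl// ltW.
move=> /(_ isT); rewrite -h1 ecy; case: sz => _ -> _.
have -> : czb b = zb by rewrite -dxz; case: szb.
rewrite hdist_plane /= subr0 h1 => le1.
have := mdist_ge0 m z => m0.
have {le1} : mdist m z ^+ 2 <= (u - l * a) ^+ 2 + v ^+ 2.
  rewrite -[leRHS]sqr_sqrtr ?addr_ge0 ?sqr_ge0//.
  by rewrite ler_pXn2r// nnegrE ?sqrtr_ge0.
have := congr1 ( *%R l) uE.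
by move=> luE /le_trans; apply; rewrite vE; lra.
Qed.

Lemma geodesic_btw : geodesic_space T -> forall l x y, 0 <= l <= 1 ->
  exists m, btw l x m y.
Proof.
move=> G l x y l01; have [c [c0 c1 cd]] := G x y.
have d0 := mdist_ge0 x y.
have h : 0 <= l * mdist x y <= mdist x y.
  by case/andP: l01 => l0 l1; rewrite mulr_ge0 ?ler_piMl.
exists (c (l * mdist x y)); split.
  by rewrite -{1}c0 cd ?lexx// distrC subr0 ger0_norm; lra.
by rewrite -{2}c1 cd ?lexx ?d0// ler0_norm; lra.
Qed.

End between.

Section cat0_inequalities.
Context {R : realType} {T : metricType R}.
Hypotheses (geo : geodesic_space T) (cn : @cn_ineq R T).
Implicit Types x y z m p q : T.

Lemma btw_uniq l x y m m' : 0 <= l <= 1 ->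
  btw l x m y -> btw l x m' y -> m = m'.
Proof.
move=> l01 h [h1' h2']; apply: mdist_positivity.
have := cn m' l01 h; rewrite h1' (metric_sym y) h2'.
have := mdist_ge0 m m'; set d := mdist m m'; set a := mdist x y => d0 le1.
apply/eqP; rewrite -sqrf_eq0 eq_le sqr_ge0 andbT.
by apply: (le_trans le1); lra.
Qed.

Lemma btw_convex1 l x y z m m' : 0 <= l <= 1 ->
  btw l x m y -> btw l x m' z -> mdist m m' <= l * mdist y z.
Proof.
move=> l01 h h'; case/andP: (l01) => l0 l1.
have := cn m l01 h'; have := cn z l01 h.
case: h h' => [h1 h2] [h1' h2']; rewrite h1 (metric_sym m' m) (metric_sym z m).
move: (mdist_ge0 m m') (mdist_ge0 y z).
set D := mdist m m'; set a := mdist x y; set b := mdist x z.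
set c := mdist y z; set e := mdist m z => D0 c0 i1 i2.
rewrite -(@ler_pXn2r _ 2) ?nnegrE ?mulr_ge0//.
have i3 := ler_wpM2l l0 i1.
apply: (le_trans i2); rewrite exprMn; lra.
Qed.

Lemma btw_convex l x y x' y' m m' : 0 <= l <= 1 ->
  btw l x m y -> btw l x' m' y' ->
  mdist m m' <= (1 - l) * mdist x x' + l * mdist y y'.
Proof.
move=> l01 h h'; have [n hn] := geodesic_btw geo x y' l01.
have l01' : 0 <= 1 - l <= 1 by lra.
have := btw_convex1 l01 h hn.
have := btw_convex1 l01' (btw_sym hn) (btw_sym h').
have := metric_triangle m n m'; lra.
Qed.

(** The CN inequality at the midpoint of the diagonal x1 x3, applied to both other vertices, and (p
    + q)^2 <= 2 p^2 + 2 q^2. *)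
Lemma quadrilateral x1 x2 x3 x4 :
  mdist x1 x3 ^+ 2 + mdist x2 x4 ^+ 2 <=
  mdist x1 x4 ^+ 2 + mdist x2 x3 ^+ 2 + mdist x1 x2 ^+ 2 + mdist x3 x4 ^+ 2.
Proof.
have h01 : 0 <= (2^-1 : R) <= 1 by lra.
have [m h] := geodesic_btw geo x1 x3 h01.
have := cn x2 h01 h; have := cn x4 h01 h.
have := metric_triangle x2 m x4; rewrite (metric_sym x2 m).
rewrite (metric_sym x3 x2) => t i1 i2.
have p0 := mdist_ge0 m x2; have q0 := mdist_ge0 m x4.
have : mdist x2 x4 ^+ 2 <= (mdist m x2 + mdist m x4) ^+ 2.
  by rewrite ler_pXn2r ?nnegrE ?mdist_ge0// addr_ge0.
have := sqr_ge0 (mdist m x2 - mdist m x4); lra.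
Qed.

Let Q x1 x2 x3 x4 := mdist x1 x3 ^+ 2 + mdist x2 x4 ^+ 2
  - mdist x1 x4 ^+ 2 - mdist x2 x3 ^+ 2.

(** [Q] is additive when the side x1 x2 is subdivided; each of n equal parts contributes at most
    (d12 / n)^2 + d34^2. *)
Lemma quadrilateral_subdiv1 n x1 x2 x3 x4 : (0 < n)%N ->
  Q x1 x2 x3 x4 <= n%:R^-1 * mdist x1 x2 ^+ 2 + n%:R * mdist x3 x4 ^+ 2.
Proof.
move=> n0; elim: n n0 x1 => // n IH _ x1.
have [->|n0] := posnP n.
  by rewrite /Q invr1 !mul1r; have := quadrilateral x1 x2 x3 x4; lra.
pose l : R := n.+1%:R^-1.
have N0 : n.+1%:R != 0 :> R by rewrite pnatr_eq0.
have n0' : n%:R != 0 :> R by rewrite pnatr_eq0 -lt0n.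
have l01 : 0 <= l <= 1.
  by rewrite invr_ge0 ler0n/= invf_le1 ?ltr0n// ler1n.
have [m h] := geodesic_btw geo x1 x2 l01.
have := IH n0 m; have := quadrilateral x1 m x3 x4.
have hl : n%:R * l + l = 1.
  by rewrite -[X in _ + X]mul1r -mulrDl natr1 mulfV.
case: h => -> ->; have -> : 1 - l = n%:R * l by lra.
rewrite !exprMn /Q.
have -> : n%:R^-1 * (n%:R ^+ 2 * l ^+ 2 * mdist x1 x2 ^+ 2) =
  n%:R * (l ^+ 2 * mdist x1 x2 ^+ 2) by field.
have e1 : l ^+ 2 * mdist x1 x2 ^+ 2 + n%:R * (l ^+ 2 * mdist x1 x2 ^+ 2) =
  l * mdist x1 x2 ^+ 2.
  by rewrite -[X in X + _]mul1r -mulrDl mulrA addrC natr1 expr2 mulrA mulfV// mul1r.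
have nn : n.+1%:R = n%:R + 1 :> R by rewrite natr1.
rewrite -/l nn; lra.
Qed.

Lemma quadrilateral_subdiv k n x1 x2 x3 x4 : (0 < k)%N -> (0 < n)%N ->
  Q x1 x2 x3 x4 <=
    k%:R / n%:R * mdist x1 x2 ^+ 2 + n%:R / k%:R * mdist x3 x4 ^+ 2.
Proof.
move=> k0 n0; elim: k k0 x3 => // k IH _ x3.
have [->|k0] := posnP k.
  by rewrite mul1r divr1; exact: quadrilateral_subdiv1.
pose l : R := k.+1%:R^-1.
have N0 : k.+1%:R != 0 :> R by rewrite pnatr_eq0.
have k0' : k%:R != 0 :> R by rewrite pnatr_eq0 -lt0n.
have l01 : 0 <= l <= 1.
  by rewrite invr_ge0 ler0n/= invf_le1 ?ltr0n// ler1n.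
have [m h] := geodesic_btw geo x3 x4 l01.
have := IH k0 m; have := @quadrilateral_subdiv1 n x1 x2 x3 m n0.
have hl : k%:R * l + l = 1.
  by rewrite -[X in _ + X]mul1r -mulrDl natr1 mulfV.
case: h => -> ->; have -> : 1 - l = k%:R * l by lra.
rewrite !exprMn /Q.
have -> : n%:R / k%:R * (k%:R ^+ 2 * l ^+ 2 * mdist x3 x4 ^+ 2) =
  k%:R * (n%:R * (l ^+ 2 * mdist x3 x4 ^+ 2)) by field.
have e1 : n%:R * (l ^+ 2 * mdist x3 x4 ^+ 2) +
   k%:R * (n%:R * (l ^+ 2 * mdist x3 x4 ^+ 2)) =
  n%:R * l * mdist x3 x4 ^+ 2.
  transitivity (n%:R * l * mdist x3 x4 ^+ 2 * (k%:R * l + l)); first by ring.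
  by rewrite hl mulr1.
have nn : k.+1%:R = k%:R + 1 :> R by rewrite natr1.
rewrite -[n%:R / k.+1%:R]/(n%:R * l) {1}nn; lra.
Qed.

(* Reshetnyak's inequality. The bound with the arithmetic mean
   [t * d12 ^ 2 + d34 ^ 2 / t] for rational [t] comes from subdividing two
   opposite sides, as the left-hand side is additive in either of them. *)
Lemma reshetnyak x1 x2 x3 x4 :
  mdist x1 x3 ^+ 2 + mdist x2 x4 ^+ 2 <=
  mdist x1 x4 ^+ 2 + mdist x2 x3 ^+ 2 + 2 * mdist x1 x2 * mdist x3 x4.
Proof.
have [->|n12] := eqVneq x1 x2; first by rewrite mdistxx; lra.
have [->|n34] := eqVneq x3 x4; first by rewrite mdistxx; lra.
have a0 : 0 < mdist x1 x2 by rewrite mdist_gt0.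
have b0 : 0 < mdist x3 x4 by rewrite mdist_gt0.
suff : Q x1 x2 x3 x4 <= 2 * mdist x1 x2 * mdist x3 x4 by rewrite /Q; lra.
have key := @quadrilateral_subdiv _ _ x1 x2 x3 x4.
move: (Q _ _ _ _) a0 b0 key => q.
set a := mdist _ _; set b := mdist _ _ => a0 b0 key.
apply/ler_addgt0Pr => e e0.
(* The bound is best when k / n = b / a. Here k and n are N * b and N * a rounded up, and the
   rounding costs at most (a + b) / N < e. *)
pose N := (Num.truncn ((a + b) / e)).+1.
have Ne : (a + b) / e < N%:R by rewrite truncnS_gt.
have N0 : 0 < N%:R :> R by rewrite ltr0n.
have Na : 0 < N%:R * a by rewrite mulr_gt0.
have Nb : 0 < N%:R * b by rewrite mulr_gt0.
pose k := (Num.truncn (N%:R * b)).+1; pose n := (Num.truncn (N%:R * a)).+1.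
have k1 : N%:R * b < k%:R by rewrite truncnS_gt.
have k2 : k%:R <= N%:R * b + 1.
  by rewrite -natr1 lerD2r truncn_le// ltW.
have n1 : N%:R * a < n%:R by rewrite truncnS_gt.
have n2 : n%:R <= N%:R * a + 1.
  by rewrite -natr1 lerD2r truncn_le// ltW.
have := key k n isT isT.
have k0 : 0 < k%:R :> R by rewrite ltr0n.
have n0 : 0 < n%:R :> R by rewrite ltr0n.
have Ne' : (a + b) / N%:R < e.
  by rewrite ltr_pdivrMr// mulrC -ltr_pdivrMr.
have i1 : k%:R / n%:R * a ^+ 2 <= a * b + a / N%:R.
  have -> : a * b + a / N%:R = (N%:R * b + 1) / (N%:R * a) * a ^+ 2.
    by field; rewrite !gt_eqF.
  rewrite ler_pM2r ?exprn_gt0//; apply: ler_pM => //.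
  by rewrite lef_pV2 ?posrE// ltW.
have i2 : n%:R / k%:R * b ^+ 2 <= a * b + b / N%:R.
  have -> : a * b + b / N%:R = (N%:R * a + 1) / (N%:R * b) * b ^+ 2.
    by field; rewrite !gt_eqF.
  rewrite ler_pM2r ?exprn_gt0//; apply: ler_pM => //.
  by rewrite lef_pV2 ?posrE// ltW.
move: Ne'; rewrite mulrDl; lra.
Qed.

(** The angle at a nearest point p is at least right: the CN inequality at the fraction l of p q,
    divided by l, gives this as l tends to 0. *)
Lemma obtuse y p q :
  (forall l m, 0 <= l <= 1 -> btw l p m q -> mdist y p <= mdist y m) ->
  mdist y p ^+ 2 + mdist p q ^+ 2 <= mdist y q ^+ 2.
Proof.
move=> h; apply/ler_addgt0Pr => e e0.
pose l : R := Num.min 1 (e / (1 + mdist p q ^+ 2)).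
have D0 : 0 < 1 + mdist p q ^+ 2 by rewrite ltr_wpDr// sqr_ge0.
have l0 : 0 < l by rewrite lt_min ltr01 divr_gt0.
have l1 : l <= 1 by rewrite ge_min lexx.
have le1 : l * (1 + mdist p q ^+ 2) <= e.
  by rewrite -ler_pdivlMr// ge_min lexx orbT.
have l01 : 0 <= l <= 1 by rewrite ltW.
have [m hm] := geodesic_btw geo p q l01.
have := cn y l01 hm; have := h _ _ l01 hm.
rewrite (metric_sym y m) (metric_sym p y) (metric_sym q y).
move: le1; have := mdist_ge0 y p; have := sqr_ge0 (mdist p q).
set A := mdist y p; set B := mdist y q; set c := mdist p q; set M := mdist m y.
move=> c0 A0 le1 AM i1.
have i2 : A ^+ 2 <= M ^+ 2.
  by rewrite ler_pXn2r ?nnegrE ?mdist_ge0.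
rewrite -(ler_pM2l l0) -subr_ge0.
have e3 : l * (l * (1 + c ^+ 2)) <= l * e by rewrite ler_wpM2l// ltW.
have := sqr_ge0 l; lra.
Qed.

(** Right angles at p and q: add both hypotheses to Reshetnyak's inequality and cancel d(p, q). *)
Lemma obtuse_lip y z p q :
  mdist y p ^+ 2 + mdist p q ^+ 2 <= mdist y q ^+ 2 ->
  mdist z q ^+ 2 + mdist p q ^+ 2 <= mdist z p ^+ 2 ->
  mdist p q <= mdist y z.
Proof.
move=> h1 h2; have [->|pq] := eqVneq p q; first by rewrite mdistxx mdist_ge0.
have r := reshetnyak y z q p.
have pq0 : 0 < mdist p q by rewrite mdist_gt0.
rewrite -(ler_pM2r pq0); rewrite (metric_sym q p) in r; lra.
Qed.

End cat0_inequalities.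

(** * Proper spaces *)

Lemma fmap_ultra (T U : Type) (f : T -> U) (F : set_system T) :
  UltraFilter F -> UltraFilter (f @ F).
Proof.
move=> UF; split; first exact: fmap_proper_filter.
move=> G PG sFG; rewrite eqEsubset; split => // A GA.
have [//|FnA] := in_ultra_setVsetC (f @^-1` A) UF.
have FG := @filter_filter _ _ PG.
have := @filterI _ G FG _ _ GA (sFG (~` A) FnA).
by rewrite setICr => /filter_not_empty.
Qed.

Section hopf_rinow.
Context {R : realType} {T : metricType R}.
Hypotheses (cT : complete_space T) (geo : geodesic_space T)
  (lcT : locally_compact [set: T]).
Implicit Types x y z o : T.

Definition cball o r := [set y : T | mdist o y <= r].

Lemma nbhs_mdist x (e : R) : 0 < e -> nbhs x [set y | mdist x y < e].
Proof.
move=> e0; have := @nbhsx_ballx _ _ x e e0; by rewrite ballEmdist.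
Qed.

Lemma cvg_mdist_lt (F : set_system T) : Filter F -> forall p, F --> p ->
  forall e, 0 < e -> \forall y \near F, mdist p y < e.
Proof. by move=> FF p Fp e e0; apply: Fp; exact: nbhs_mdist. Qed.

Lemma closed_cball o r : closed (cball o r).
Proof.
move=> p cl; rewrite /cball/= leNgt; apply/negP => rp.
have e0 : 0 < mdist o p - r by rewrite subr_gt0.
have [y []] := cl _ (nbhs_mdist p e0); rewrite /cball /= => oy py.
have := metric_triangle o y p; rewrite (metric_sym y p); lra.
Qed.

(** An ultrafilter on a ball slightly larger than a compact one is pushed radially into the compact
    ball, where it converges; the push moves points by less than e. *)
Lemma ultra_cvg_cball (F : set_system T) o r s (e : R) : UltraFilter F ->
  F (cball o s) -> compact (cball o r) -> 0 <= r -> s < r + e -> 0 < e ->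
  exists p, mdist o p <= r /\ F [set y | mdist p y < e].
Proof.
move=> UF Fs; have PF : ProperFilter F by exact: ultra_proper.
rewrite compact_ultra => cp r0 sre e0.
have [s0|s0] := ltP s 0.
  suff : F set0 by move/filter_not_empty.
  apply: (@filterS _ F _ _ _ _ Fs) => y; rewrite /cball/= => oy.
  by have := mdist_ge0 o y; lra.
have rho y : exists z, mdist o y <= s ->
    mdist o z <= r /\ mdist z y <= Num.max 0 (s - r).
  have [oy|oy] := leP (mdist o y) s; last by exists o.
  have [|oyr] := leP (mdist o y) r.
    by exists y => _; rewrite mdistxx le_max lexx.
  have oy0 : 0 < mdist o y by lra.
  have l01 : 0 <= r / mdist o y <= 1.
    by rewrite divr_ge0 ?mdist_ge0//= ler_pdivrMr// mul1r ltW.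
  have [z [h1 h2]] := geodesic_btw geo o y l01.
  exists z => _; rewrite h1 h2 mulrBl mul1r divfK ?gt_eqF// lexx; split => //.
  by rewrite le_max; apply/orP; right; lra.
have [f hf] := choice rho.
have UG := fmap_ultra f UF.
have [|p [op Gp]] := cp (f @ F) UG.
  by apply: (@filterS _ F _ _ _ _ Fs) => y /hf [].
have e1 : 0 < e - Num.max 0 (s - r) by rewrite subr_gt0 gt_max e0; lra.
exists p; split => //.
have h3 : F [set y | mdist p (f y) < e - Num.max 0 (s - r)].
  exact: (@cvg_mdist_lt (f @ F) _ _ Gp _ e1).
apply: (@filterS _ F _ _ _ _ (filterI Fs h3)) => y [] /= /hf [_ h1] h2.
by have := metric_triangle p (f y) y; lra.
Qed.

Lemma cvg_ultra_cball (F : set_system T) o r p :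
  ProperFilter F -> F (cball o r) -> F --> p -> mdist o p <= r.
Proof.
move=> PF Fr Fp; apply/ler_addgt0Pr => e e0.
have [y [] /= h1 h2] := filter_ex (filterI Fr (@cvg_mdist_lt F _ _ Fp _ e0)).
rewrite /cball/= in h1.
by have := metric_triangle o y p; rewrite (metric_sym y p); lra.
Qed.

Lemma compact_cball_sub o r s : r <= s -> compact (cball o s) ->
  compact (cball o r).
Proof.
move=> rs cs; apply: (subclosed_compact _ cs); first exact: closed_cball.
by move=> y /= h; apply: le_trans rs.
Qed.

(** By [ultra_cvg_cball] an ultrafilter on the ball contains arbitrarily small balls, so it is
    Cauchy and completeness applies. *)
Lemma compact_cball_sup o r : 0 <= r ->
  (forall s, 0 <= s < r -> compact (cball o s)) -> compact (cball o r).
Proof.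
move=> r0 h.
have [r00|r_gt0] : r = 0 \/ 0 < r.
  by move: r0; rewrite le_eqVlt => /orP[/eqP|]; [left|right].
  suff -> : cball o r = [set o] by exact: compact_set1.
  rewrite r00; apply/seteqP; split => [y /= h0|y ->]; last first.
    by rewrite /cball /= mdistxx.
  apply/esym/mdist_positivity/eqP; rewrite eq_le mdist_ge0 andbT.
  exact: h0.
rewrite compact_ultra => F UF Fr.
have PF : ProperFilter F by exact: ultra_proper.
have [|p Fp] := cT PF; last first.
  by exists p; split => //; exact: cvg_ultra_cball Fr Fp.
apply/cauchy_ballP => e e0.
pose s := Num.max 0 (r - e / 4).
have s0 : 0 <= s by rewrite le_max lexx.
have sr : s < r by rewrite gt_max r_gt0/= ltrBlDr ltrDl divr_gt0.
have [||||p [_ Fp]] := @ultra_cvg_cball F o s r (e / 2) UF Fr.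
- by apply: h; rewrite s0.
- by [].
- have : r - e / 4 <= s by rewrite le_max lexx orbT.
  lra.
- lra.
exists (ball p (e / 2), ball p (e / 2)); first by rewrite ballEmdist.
move=> [y z] [] /=; rewrite !ballEmdist /= => h1 h2.
have := metric_triangle y p z; rewrite (metric_sym y p); lra.
Qed.

(** Compactness makes the size of compact neighbourhoods uniform over the ball, so an ultrafilter on
    a slightly larger ball is caught in one of them. *)
Lemma compact_cball_succ o r : 0 <= r -> compact (cball o r) ->
  exists2 e, 0 < e & compact (cball o (r + e)).
Proof.
move=> r0 cr; have := cr; rewrite compact_near_coveringP => cov.
have H x : cball o r x -> \forall x' \near x & e \near (0 : R)^'+,
    exists2 C, compact C & [set y | mdist x' y < e] `<=` C.
  move=> _.
  have [C + [cC _]] := lcT (I : [set: T] x).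
  rewrite /within/= => nC.
  have : nbhs x C by apply: filterS nC => y /(_ I).
  move=> /nbhs_ballP [d /= d0 bC].
  exists ([set y | mdist x y < d / 2], [set e : R | e < d / 2]).
    split => /=; first by apply: nbhs_mdist; lra.
    by apply: nbhs_right_lt; lra.
  move=> [x' e] [/= h1 h2]; exists C => // y /= h3.
  apply: bC; rewrite ballEmdist /=.
  by have := metric_triangle x x' y; lra.
have [e [/= e0 he]] : exists e, 0 < e /\
    cball o r `<=` (fun x => exists2 C, compact C & [set y | mdist x y < e] `<=` C).
  have FF : Filter (0 : R)^'+ by typeclasses eauto.
  have nz := cov _ _ _ FF H.
  have [e [/= e0 he]] := filter_ex (filterI (@nbhs_right_gt R 0) nz).
  by exists e.
exists (e / 2); first lra.
rewrite compact_ultra => F UF Fr; have PF : ProperFilter F by exact: ultra_proper.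
have [||||p [op Fp]] := @ultra_cvg_cball F o r (r + e / 2) e UF Fr; rewrite //.
  lra.
have [C cC sC] := he p op.
move: cC; rewrite compact_ultra => /(_ F UF (filterS sC Fp)) [q [_ Fq]].
by exists q; split => //; exact: cvg_ultra_cball Fr Fq.
Qed.

(** The radii of compact balls form an interval without a last element: it contains its supremum by
    completeness and goes beyond it by local compactness. *)
Theorem hopf_rinow o r : compact (cball o r).
Proof.
pose S := [set s : R | 0 <= s /\ compact (cball o s)].
have [r0|r0] := leP 0 r; last first.
  by apply: (@compact_cball_sub o r 0 (ltW r0)); apply: compact_cball_sup => // s; lra.
apply: contrapT => nr.
have S0 : S 0 by split => //; apply: compact_cball_sup => // s; lra.
have ubr : ubound S r.
  move=> s [s0 cs]; rewrite leNgt; apply/negP => rs; apply: nr.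
  exact: compact_cball_sub (ltW rs) cs.
have hs : has_sup S by split; [exists 0|exists r].
have s0 : 0 <= sup S by apply: ub_le_sup => //; exists r.
have cs : compact (cball o (sup S)).
  apply: compact_cball_sup => // s /andP[s0' ss].
  have ss0 : 0 < sup S - s by rewrite subr_gt0.
  have [t [t0 ct] st] := sup_adherent ss0 hs.
  by apply: compact_cball_sub ct; lra.
have [e e0 ce] := compact_cball_succ s0 cs.
have : sup S + e <= sup S.
  by apply: ub_le_sup; [exists r|split => //; lra].
by lra.
Qed.

End hopf_rinow.

(** * Projection to a line *)

Section lipschitz_on_segment.
Context {R : realType}.
Implicit Types (f : R -> R) (a b k t u v : R).

Definition lip_on f a b :=
  forall t u, a <= t <= b -> a <= u <= b -> `|f t - f u| <= `|t - u|.

(** Composing with this retraction extends a Lipschitz function on [a, b] to a continuous function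
    on the whole line. *)
Let clamp a b t := Num.max a (Num.min b t).

Let clamp_in a b t : a <= b -> a <= clamp a b t <= b.
Proof.
by move=> ab; rewrite /clamp le_max lexx/= ge_max ab ge_min lexx.
Qed.

Let clampE a b t : a <= t <= b -> clamp a b t = t.
Proof. by case/andP=> h1 h2; rewrite /clamp min_r// max_r. Qed.

Let clamp_lip a b t u : `|clamp a b t - clamp a b u| <= `|t - u|.
Proof.
have mx x y : `|Num.max a x - Num.max a y| <= `|x - y|.
  rewrite ler_norml; have := ler_norm (x - y); have := ler_norm (y - x).
  rewrite (distrC y x); have := normr_ge0 (x - y).
  by case: (leP a x) => h1; case: (leP a y) => h2; lra.
apply: le_trans (mx _ _) _.
rewrite ler_norml; have := ler_norm (t - u); have := ler_norm (u - t).
rewrite (distrC u t); have := normr_ge0 (t - u).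
by case: (leP b t) => h1; case: (leP b u) => h2; lra.
Qed.

Lemma lip_on_within f a b : a <= b -> lip_on f a b ->
  {within `[a, b], continuous f}.
Proof.
move=> ab lf.
have h : {within `[a, b], continuous (f \o clamp a b)}.
  apply: continuous_subspaceT => x; apply/cvgrPdist_le => e e0.
  apply/nbhs_ballP; exists e => // y /= /ltW xy.
  apply: le_trans (lf _ _ (clamp_in _ ab) (clamp_in _ ab)) _.
  exact: le_trans (clamp_lip a b x y) xy.
apply: subspace_eq_continuous h => x; rewrite inE/= in_itv/= => hx.
by rewrite /from_subspace /= clampE.
Qed.

Lemma lip_on_IVT f a b v : a <= b -> lip_on f a b ->
  Num.min (f a) (f b) <= v <= Num.max (f a) (f b) ->
  exists2 t, a <= t <= b & f t = v.
Proof.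
move=> ab lf /(IVT ab (lip_on_within ab lf)) [t].
by rewrite in_itv/= => h <-; exists t.
Qed.

Lemma lip_on_EVT_min f a b : a <= b -> lip_on f a b ->
  exists2 t, a <= t <= b & forall u, a <= u <= b -> f t <= f u.
Proof.
move=> ab lf; have [t] := EVT_min ab (lip_on_within ab lf).
rewrite in_itv/= => h hmin; exists t => // u hu; by apply: hmin; rewrite in_itv.
Qed.

End lipschitz_on_segment.

Section line_projection.
Context {R : realType} {T : metricType R}.
Variables (s : R -> T) (hs : geodesic_line s).
Implicit Types (x y z m : T) (t u : R).

Lemma mdist_line_lip y t u : `|mdist y (s t) - mdist y (s u)| <= `|t - u|.
Proof.
rewrite -hs; have := metric_triangle y (s t) (s u).
have := metric_triangle y (s u) (s t); rewrite (metric_sym (s u)).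
by rewrite ler_norml; lra.
Qed.

Lemma line_projection_ex y : exists t, forall u, mdist y (s t) <= mdist y (s u).
Proof.
(* If |u| >= M, then s u is farther from y than s 0, so the minimum over [-M, M] is global. *)
pose M := 2 * mdist y (s 0) + 1; have y0 := mdist_ge0 y (s 0).
have M0 : - M <= M by rewrite /M; lra.
have [t ht hmin] := @lip_on_EVT_min R (fun t => mdist y (s t)) _ _ M0
  (fun t u _ _ => mdist_line_lip y t u).
exists t => u; have [hu|hu] := boolP (- M <= u <= M); first exact: hmin.
have h0 : mdist y (s t) <= mdist y (s 0) by apply: hmin; rewrite /M; lra.
apply: le_trans h0 _.
have := metric_triangle (s 0) y (s u); rewrite hs (metric_sym _ y) sub0r normrN.
have : M <= `|u|.
  move: hu; rewrite negb_and -!ltNge => /orP[]; have := ler_norm u.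
    by have := ler_norm (- u); rewrite normrN; lra.
  by lra.
by rewrite /M; lra.
Qed.

(** [pr] and [ht] serve as Fermi coordinates along the line: parameter of the foot, and height. *)
Definition pr y := sval (cid (line_projection_ex y)).
Definition ht y := mdist y (s (pr y)).

Lemma ht_le y u : ht y <= mdist y (s u).
Proof. by rewrite /ht /pr; case: cid. Qed.

Lemma ht_ge0 y : 0 <= ht y. Proof. exact: mdist_ge0. Qed.

Lemma ht_lip y z : `|ht y - ht z| <= mdist y z.
Proof.
have h1 := ht_le y (pr z); have h2 := ht_le z (pr y).
have := metric_triangle y z (s (pr z)); have := metric_triangle z y (s (pr y)).
rewrite (metric_sym z y) -/(ht y) -/(ht z) ler_norml; lra.
Qed.

Lemma mdist_le_ht_pr y z : mdist y z <= ht y + `|pr y - pr z| + ht z.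
Proof.
have := metric_triangle y (s (pr y)) z.
have := metric_triangle (s (pr y)) (s (pr z)) z.
rewrite hs (metric_sym (s (pr z)) z) -/(ht y) -/(ht z); lra.
Qed.

Hypotheses (geo : geodesic_space T) (cn : @cn_ineq R T).

Lemma btw_line l t u m : 0 <= l <= 1 -> btw l (s t) m (s u) ->
  m = s ((1 - l) * t + l * u).
Proof.
move=> l01 h; apply: (btw_uniq cn l01 h); case/andP: l01 => l0 l1.
split; rewrite !hs.
  have -> : t - ((1 - l) * t + l * u) = l * (t - u) by ring.
  by rewrite normrM ger0_norm.
have -> : (1 - l) * t + l * u - u = (1 - l) * (t - u) by ring.
by rewrite normrM (ger0_norm (_ : 0 <= 1 - l))// subr_ge0.
Qed.

Lemma ht_pythagoras y t : ht y ^+ 2 + (pr y - t) ^+ 2 <= mdist y (s t) ^+ 2.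
Proof.
have := @obtuse _ _ geo cn y (s (pr y)) (s t).
rewrite hs real_normK ?num_real//; apply=> l m l01 /(btw_line l01) ->.
exact: ht_le.
Qed.

Lemma pr_unique y t : mdist y (s t) <= ht y -> pr y = t.
Proof.
move=> h; have p := ht_pythagoras y t; have h0 := ht_ge0 y.
have : mdist y (s t) ^+ 2 <= ht y ^+ 2.
  by rewrite ler_pXn2r ?nnegrE ?mdist_ge0.
have := sqr_ge0 (pr y - t) => q h2.
apply/eqP; rewrite -subr_eq0 -sqrf_eq0 eq_le q andbT; lra.
Qed.

Lemma pr_min y t : (forall u, mdist y (s t) <= mdist y (s u)) -> pr y = t.
Proof. by move=> h; exact/pr_unique/h. Qed.

Lemma ht_min y t : (forall u, mdist y (s t) <= mdist y (s u)) ->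
  ht y = mdist y (s t).
Proof. by move=> h; rewrite /ht (pr_min h). Qed.

Lemma pr_lip y z : `|pr y - pr z| <= mdist y z.
Proof.
rewrite -hs; apply: (obtuse_lip geo cn).
  by rewrite hs real_normK ?num_real//; exact: ht_pythagoras.
rewrite hs real_normK ?num_real// -(sqrrN (_ - _)) opprB.
exact: ht_pythagoras.
Qed.

Lemma ht_convex l x y m : 0 <= l <= 1 -> btw l x m y ->
  ht m <= (1 - l) * ht x + l * ht y.
Proof.
move=> l01 h.
have [n hn] := geodesic_btw geo (s (pr x)) (s (pr y)) l01.
apply: le_trans (btw_convex geo cn l01 h hn).
by rewrite (btw_line l01 hn); exact: ht_le.
Qed.

Lemma pr_perp l y m : 0 <= l <= 1 -> btw l (s (pr y)) m y ->
  pr m = pr y /\ ht m = l * ht y.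
Proof.
move=> l01 [h1 h2].
have h u : mdist m (s (pr y)) <= mdist m (s u).
  have := metric_triangle y m (s u); have := ht_le y u.
  move: h1 h2; rewrite (metric_sym (s (pr y))) (metric_sym (s (pr y)) y).
  rewrite (metric_sym m y) -/(ht y); lra.
split; first exact: pr_min.
by rewrite (ht_min h) metric_sym h1 (metric_sym (s (pr y))).
Qed.

(** y' and z' are the projections of y and z to the set of points of height at most r. It is convex
    by [ht_convex], so [obtuse_lip] applies. *)
Lemma truncate_lip r y z y' z' : 0 <= r ->
  r <= ht y -> r <= ht z ->
  (exists2 l, 0 <= l <= 1 & btw l (s (pr y)) y' y) -> ht y' = r ->
  (exists2 l, 0 <= l <= 1 & btw l (s (pr z)) z' z) -> ht z' = r ->
  mdist y' z' <= mdist y z.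
Proof.
move=> r0 ry rz [l l01 hy] ey [k k01 hz] ez.
have below j m : 0 <= j <= 1 -> btw j y' m z' -> ht m <= r.
  by move=> j01 hm; have := ht_convex j01 hm; rewrite ey ez; lra.
have dist w w' j : 0 <= j <= 1 -> btw j (s (pr w)) w' w -> ht w' = r ->
    mdist w w' = ht w - r.
  move=> j01 hw e; have [_] := pr_perp j01 hw; case: hw => _.
  rewrite (metric_sym w') (metric_sym _ w) -/(ht w) e; lra.
have far w m : ht m <= r -> ht w - r <= mdist w m.
  by move=> h; have := ht_lip w m; have := ler_norm (ht w - ht m); lra.
apply: (obtuse_lip geo cn).
  apply: (obtuse geo cn) => j m j01 hm.
  by rewrite (dist _ _ _ l01 hy ey); apply: far (below _ _ j01 hm).
rewrite (metric_sym y'); apply: (obtuse geo cn) => j m j01 /btw_sym hm.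
rewrite (dist _ _ _ k01 hz ez); apply: far; apply: (below (1 - j)) hm.
by lra.
Qed.

End line_projection.

(** * Parallel lines *)

Section ultralimits.
Context {R : realType} {T : metricType R}.
Variables (U : set_system nat) (UU : UltraFilter U).
Hypothesis proper : forall (o : T) r, compact (cball o r).

Let PU : ProperFilter U. Proof. exact: ultra_proper. Qed.

(* Limits along a fixed ultrafilter: in a proper space every bounded sequence has
   one, so that no subsequences need to be extracted. *)
Definition ulim (u : nat -> T) p :=
  forall e, 0 < e -> U [set n | mdist p (u n) < e].

Lemma ulim_ex u o r : U [set n | mdist o (u n) <= r] -> exists p, ulim u p.
Proof.
move=> h; have := @proper o r; rewrite compact_ultra.
move=> /(_ (u @ U) (fmap_ultra u UU) h) [p [_ up]]; exists p => e e0.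
exact: (@cvg_mdist_lt _ _ (u @ U) _ _ up _ e0).
Qed.

Lemma ulim_lip u p (f : T -> R) A : (forall x y, `|f x - f y| <= mdist x y) ->
  ulim u p -> (forall e, 0 < e -> U [set n | `|f (u n) - A| <= e]) -> f p = A.
Proof.
move=> lf up h; apply/eqP; rewrite -subr_eq0 -normr_le0.
apply/ler_addgt0Pr => e e0; rewrite add0r.
have e20 : 0 < e / 2 by lra.
have [n [/= h1 h2]] := filter_ex (filterI (up _ e20) (h _ e20)).
by have := ler_distD (f (u n)) (f p) A; have := lf p (u n); lra.
Qed.

Lemma ulim_mdist u v p q A : ulim u p -> ulim v q ->
  U [set n | mdist (u n) (v n) = A] -> mdist p q = A.
Proof.
move=> up vq h; apply/eqP; rewrite -subr_eq0 -normr_le0.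
apply/ler_addgt0Pr => e e0; rewrite add0r.
have e20 : 0 < e / 2 by lra.
have [n [/= [/= h1 h2] h3]] :=
  filter_ex (filterI (filterI (up _ e20) (vq _ e20)) h).
have := metric_triangle p (u n) q; have := metric_triangle (u n) (v n) q.
have := metric_triangle (u n) p (v n); have := metric_triangle p q (v n).
rewrite (metric_sym (u n) p) (metric_sym (v n) q) h3 ler_norml; lra.
Qed.

End ultralimits.

Section parallel_lines.
Context {R : realType} {T : metricType R}.
Hypotheses (geo : geodesic_space T) (cn : @cn_ineq R T).
Hypothesis proper : forall (o : T) r, compact (cball o r).
Variables (s : R -> T) (hs : geodesic_line s).
Implicit Types (t u D r : R).

Definition parallel_at D (c : R -> T) :=
  geodesic_line c /\ forall t, pr hs (c t) = t /\ ht hs (c t) = D.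

Lemma parallel_mdist D c t : parallel_at D c -> mdist (s t) (c t) = D.
Proof. by move=> [_ /(_ t)[h1 h2]]; rewrite metric_sym -h2 /ht h1. Qed.

(** Reshetnyak's inequality bounds the sum of the two squared diagonals, and [ht_pythagoras] bounds
    the other one from below. *)
Lemma parallel_diag D c t u : parallel_at D c ->
  mdist (s t) (c u) ^+ 2 <= D ^+ 2 + (t - u) ^+ 2.
Proof.
move=> P; have dD := fun t => parallel_mdist t P.
case: P => [lc hc].
have := reshetnyak geo cn (s t) (s u) (c u) (c t).
have := ht_pythagoras hs geo cn (c t) u.
have [-> ->] := hc t; rewrite !dD (metric_sym (c t)) hs lc.
have -> : 2 * `|t - u| * `|u - t| = 2 * (t - u) ^+ 2.
  by rewrite (distrC u t) -mulrA -expr2 real_normK ?num_real.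
lra.
Qed.

(** The upper bound applies the CN inequality three times, starting from [parallel_diag]. The lower
    bound is Reshetnyak's inequality for m, n and points of the line, with [ht_pythagoras]. *)
Lemma flat_strip D c t u l k m n : 0 <= l <= 1 -> 0 <= k <= 1 ->
  parallel_at D c -> btw l (s t) m (c t) -> btw k (s u) n (c u) ->
  mdist m n ^+ 2 = (t - u) ^+ 2 + D ^+ 2 * (l - k) ^+ 2.
Proof.
move=> l01 k01 P hm hn; have dD := fun t => parallel_mdist t P.
have diag := fun t u => parallel_diag t u P.
have sq v w : `|v - w| ^+ 2 = (v - w) ^+ 2 :> R by rewrite real_normK ?num_real.
case: (P) => [lc hc].
have [pm em] : pr hs m = t /\ ht hs m = l * D.
  have [pt et] := hc t; have := @pr_perp _ _ _ hs geo cn l (c t) m l01.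
  by rewrite pt et; exact.
have [pn en] : pr hs n = u /\ ht hs n = k * D.
  have [pt et] := hc u; have := @pr_perp _ _ _ hs geo cn k (c u) n k01.
  by rewrite pt et; exact.
apply/eqP; rewrite eq_le; apply/andP; split.
  have h1 := cn (s u) l01 hm; have h2 := cn (c u) l01 hm.
  have h3 := cn m k01 hn.
  rewrite !dD (metric_sym (c t)) hs sq in h1.
  rewrite !dD lc sq in h2.
  rewrite dD (metric_sym n m) (metric_sym (s u) m) (metric_sym (c u) m) in h3.
  have d1 := diag u t; have d2 := diag t u.
  case/andP: l01 => l0 l1; case/andP: k01 => k0 k1.
  have l1' : 0 <= 1 - l by lra.
  have k1' : 0 <= 1 - k by lra.
  have := ler_wpM2l l0 d1; have := ler_wpM2l l1' d2 => g2 g1.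
  have i1 : mdist m (s u) ^+ 2 <= (t - u) ^+ 2 + l ^+ 2 * D ^+ 2 by lra.
  have i2 : mdist m (c u) ^+ 2 <= (t - u) ^+ 2 + (1 - l) ^+ 2 * D ^+ 2 by lra.
  have := ler_wpM2l k0 i2; have := ler_wpM2l k1' i1.
  lra.
have := reshetnyak geo cn m (s t) (s u) n.
have := ht_pythagoras hs geo cn m u; have := ht_pythagoras hs geo cn n t.
rewrite pm pn em en (metric_sym n (s t)) (metric_sym m (s t)).
by case: hm => -> _; case: hn => -> _; rewrite !dD hs sq; lra.
Qed.

Lemma parallel_half_plane : (forall D, 0 < D -> exists c, parallel_at D c) ->
  bounds_flat_half_plane s.
Proof.
move=> H.
have [U [UU Uoo]] := ultraFilterLemma (eventually_filter).
have [c hc] := choice (fun n : nat => H n.+1%:R (ltr0Sn _ n)).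
(* [f (n, p)] will be the point with coordinates p in a flat strip of width n + 1. The default 0
   keeps it bounded when p lies outside the strip; if p.2 >= 0 this happens for finitely many n
   only. *)
pose lam (n : nat) (p : @plane R) : R :=
  if 0 <= p.2 <= n.+1%:R then p.2 / n.+1%:R else 0.
have lam01 n p : 0 <= lam n p <= 1.
  rewrite /lam; case: ifP => [/andP[h1 h2]|_]; last by rewrite lexx ler01.
  by rewrite divr_ge0//= ler_pdivrMr// mul1r.
have [f hf] := choice (fun np : nat * @plane R =>
  geodesic_btw geo (s np.2.1) (c np.1 np.2.1) (lam01 np.1 np.2)).
have big (p : @plane R) : 0 <= p.2 -> U [set n | lam n p * n.+1%:R = p.2].
  move=> p0; apply: Uoo; exists (Num.truncn p.2) => // n /= hn.
  have pn : p.2 <= n.+1%:R.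
    by apply: ltW; apply: lt_le_trans (truncnS_gt _) _; rewrite ler_nat.
  by rewrite /lam p0 pn/= divfK// pnatr_eq0.
have df n (p : @plane R) : mdist (s p.1) (f (n, p)) = lam n p * n.+1%:R.
  by have [-> _] := hf (n, p); rewrite (parallel_mdist _ (hc n)).
have PU : ProperFilter U by exact: ultra_proper.
have L (p : @plane R) : exists q, ulim U (fun n => f (n, p)) q.
  apply: (ulim_ex UU proper (o := s p.1) (r := `|p.2|)).
  apply: (@filterS _ U _ setT) filterT => n _ /=; rewrite df /lam.
  case: ifP => [/andP[h _]|_]; last by rewrite mul0r.
  by rewrite divfK ?pnatr_eq0// ger0_norm.
have [F hF] := choice L; exists F => [p q p0 q0|t].
  apply: (ulim_mdist UU (hF p) (hF q)).
  apply: (@filterS _ U _ _ _ _ (filterI (big p p0) (big q q0))).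
  move=> n [/= hp hq]; rewrite hdist_plane.
  rewrite -[LHS]ger0_norm ?mdist_ge0// -sqrtr_sqr; congr Num.sqrt.
  rewrite (flat_strip (lam01 n p) (lam01 n q) (hc n) (hf (n, p)) (hf (n, q))).
  rewrite -hp -hq; ring.
apply/esym/mdist_positivity.
apply: (@ulim_mdist _ _ U UU (fun=> s t) _ _ _ _ _ (hF (t, 0))).
  by move=> e e0; apply: (@filterS _ U _ setT) filterT => n _ /=; rewrite mdistxx.
apply: (@filterS _ U _ _ _ _ (big (t, 0) (lexx _))) => n /= e.
by rewrite (df n (t, 0)) e.
Qed.

Lemma pr_shift (phi : T -> T) r :
  (forall x y, mdist (phi x) (phi y) = mdist x y) ->
  (forall t, phi (s t) = s (t + r)) ->
  forall y, pr hs (phi y) = pr hs y + r /\ ht hs (phi y) = ht hs y.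
Proof.
move=> iso sh y.
have e t : mdist (phi y) (s t) = mdist y (s (t - r)).
  by rewrite -{1}(subrK r t) -sh iso.
have h u : mdist (phi y) (s (pr hs y + r)) <= mdist (phi y) (s u).
  by rewrite !e addrK; exact: ht_le.
split; first exact: pr_min.
by rewrite (ht_min hs geo cn h) e addrK.
Qed.

(* Otherwise geodesics from points at height [D] towards far points of the line
   stay almost at height [D] for a long time, and their translates back to a
   fundamental domain converge to a parallel line at distance [D]. *)
Lemma no_parallel_gap l D :
  (forall u, exists r phi, [/\ forall x y, mdist (phi x) (phi y) = mdist x y,
    forall t, phi (s t) = s (t + r) & 0 <= u + r <= l]) ->
  0 < D -> ~ (exists c, parallel_at D c) ->
  exists2 e, 0 < e & forall y, ht hs y = D ->
    forall t, pr hs y <= t -> t - pr hs y + e <= mdist y (s t).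
Proof.
move=> shift D0 nP; apply: contrapT => neg; apply: nP.
(* Excess [del n] times lengths of order n must still tend to 0, since this product bounds the
   squared deviation from height D. *)
pose del (n : nat) : R := (n.+1%:R ^+ 2)^-1.
have del0 n : 0 < del n by rewrite invr_gt0 exprn_gt0.
have ex n : exists yTc : T * R * (R -> T), let: (y, T, c) := yTc in
    [/\ ht hs y = D, 2 * n.+1%:R <= T - pr hs y,
      geodesic_segment c y (s T) & mdist y (s T) < T - pr hs y + del n].
  apply: contrapT => h; apply: neg; exists (del n) => // y hy t pt.
  rewrite leNgt; apply/negP => lt.
  (* By the triangle inequality the excess over the projected length does not grow as the end point
     moves on, so the end point may be taken far away. *)
  pose T' := Num.max t (pr hs y + 2 * n.+1%:R).
  have tT : t <= T' by rewrite le_max lexx.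
  have pT : pr hs y + 2 * n.+1%:R <= T' by rewrite le_max lexx orbT.
  have [c hc] := geo y (s T').
  apply: h; exists (y, T', c); split => //; first lra.
  have := metric_triangle y (s t) (s T'); rewrite hs ler0_norm; lra.
have [f hf] := choice ex.
pose y n := (f n).1.1; pose T' n := (f n).1.2; pose c n := (f n).2.
have {}hf n : [/\ ht hs (y n) = D, 2 * n.+1%:R <= T' n - pr hs (y n),
  geodesic_segment (c n) (y n) (s (T' n)) &
  mdist (y n) (s (T' n)) < T' n - pr hs (y n) + del n].
  by have := hf n; rewrite /y /T' /c; case: (f n) => [[]].
have [r hr] := choice (fun n => shift (pr hs (y n) + n%:R)).
have [phi hphi] := choice hr.
(* [phi n] shifts the parameter [pr hs (y n) + n] to [a n], inside the fundamental domain;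
   subtracting [a n] in [tau] makes [tau n t] project almost to t. *)
pose a n := pr hs (y n) + n%:R + r n.
pose tau n t := phi n (c n (n%:R + t - a n)).
have a0 n : 0 <= a n <= l by have [] := hphi n.
have win n t : `|t| + l <= n%:R -> 0 <= n%:R + t - a n <= 2 * n.+1%:R.
  have := a0 n; have := ler_norm t; have := ler_norm (- t).
  by rewrite normrN -natr1; lra.
have len n : T' n - pr hs (y n) <= mdist (y n) (s (T' n)).
  have := pr_lip hs geo cn (y n) (s (T' n)).
  have -> : pr hs (s (T' n)) = T' n.
    by apply: pr_unique => //; rewrite mdistxx ht_ge0.
  by have := ler_norm (T' n - pr hs (y n)); rewrite distrC; lra.
have est n t : `|t| + l <= n%:R -> `|pr hs (tau n t) - t| <= del n /\
    (ht hs (tau n t) - D) ^+ 2 <= 4 / n.+1%:R.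
  move=> /win hw; have [iso sh _] := hphi n; have [hy hT [c0 c1 cd] hd] := hf n.
  rewrite /tau; set w := n%:R + t - a n in hw *.
  have [-> ->] := pr_shift iso sh (c n w).
  have L0 := len n; have ew : 0 <= w <= mdist (y n) (s (T' n)) by lra.
  have d1 : mdist (y n) (c n w) = w.
    by rewrite -{1}c0 cd ?ler0_norm; lra.
  have d2 : mdist (c n w) (s (T' n)) = mdist (y n) (s (T' n)) - w.
    by rewrite -{1}c1 cd ?ler0_norm; lra.
  have x1 := pr_lip hs geo cn (y n) (c n w); rewrite d1 ler_norml in x1.
  have x2 := pr_lip hs geo cn (c n w) (s (T' n)); rewrite d2 in x2.
  have prT : pr hs (s (T' n)) = T' n.
    by apply: pr_unique => //; rewrite mdistxx ht_ge0.
  rewrite prT ler_norml in x2.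
  set x := pr hs (c n w) - pr hs (y n).
  have xw : 0 <= w - x <= del n by rewrite /x; lra.
  split; first by rewrite ler_norml /x /w /a in xw *; lra.
  (* The squared diagonals are at least D^2 + x^2 and ht^2 + x^2, so (ht - D)^2 <= w^2 - x^2: a
     small excess of length forces almost constant height. *)
  have := reshetnyak geo cn (y n) (s (pr hs (y n))) (s (pr hs (c n w))) (c n w).
  have := ht_pythagoras hs geo cn (y n) (pr hs (c n w)).
  have := ht_pythagoras hs geo cn (c n w) (pr hs (y n)).
  rewrite d1 hs real_normK ?num_real// (metric_sym (s _) (c n w)) -/(ht hs _).
  rewrite (metric_sym (s _) (c n w)) -/(ht hs _) hy => q1 q2 q3.
  have q4 : (ht hs (c n w) - D) ^+ 2 <= (w - x) * (w + x) by rewrite /x; lra.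
  apply: (le_trans q4).
  have -> : 4 / n.+1%:R = del n * (2 * (2 * n.+1%:R)).
    rewrite /del; field; rewrite ?pnatr_eq0//.
  rewrite /x in xw *; apply: ler_pM; lra.
have [U [UU Uoo]] := ultraFilterLemma (eventually_filter).
have PU : ProperFilter U by exact: ultra_proper.
have ev (v : R) : U [set n | v <= n%:R].
  apply: Uoo; exists (Num.truncn v).+1 => // n /= hn.
  by apply: ltW; apply: lt_le_trans (truncnS_gt _) _; rewrite ler_nat.
have ht1 n t : `|t| + l <= n%:R -> `|ht hs (tau n t) - D| ^+ 2 <= 4 / n.+1%:R.
  by move=> /est[_]; rewrite real_normK ?num_real.
have dl n : del n <= n.+1%:R^-1.
  rewrite /del lef_pV2 ?posrE ?exprn_gt0// expr2 ler_peMl// ler1n//.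
have L t : exists q, ulim U (tau^~ t) q.
  apply: (ulim_ex UU proper (o := s t) (r := D + 3)).
  apply: (@filterS _ U _ _ _ _ (ev (`|t| + l))) => n /= hn.
  have [h1 h2] := est n t hn; have {}h2 := ht1 n t hn.
  have := mdist_le_ht_pr hs (s t) (tau n t).
  have -> : pr hs (s t) = t by apply: pr_unique => //; rewrite mdistxx ht_ge0.
  have -> : ht hs (s t) = 0.
    by apply/eqP; rewrite eq_le ht_ge0 andbT -(mdistxx (s t)); exact: ht_le.
  have h3 : `|ht hs (tau n t) - D| <= 2.
    rewrite -(@ler_pXn2r _ 2) ?nnegrE//; apply: (le_trans h2).
    rewrite ler_pdivrMr// -natr1; have := ler0n R n; lra.
  have h4 : n.+1%:R^-1 <= 1 :> R by rewrite invf_le1 ?ltr0n// ler1n.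
  have h5 : del n <= 1 := le_trans (dl n) h4.
  rewrite distrC in h1; have := ler_norm (ht hs (tau n t) - D); lra.
have [tt htt] := choice L; exists tt; split => [t u|t].
  apply: (ulim_mdist UU (htt t) (htt u)).
  apply: (@filterS _ U _ _ _ _ (filterI (ev (`|t| + l)) (ev (`|u| + l)))).
  move=> n [/= /win ht1' /win ht2]; have [iso _ _] := hphi n.
  have [_ hT [_ _ cd] _] := hf n; have L0 := len n.
  rewrite /tau iso cd; [congr (`|_|); ring|lra..].
split.
  apply: (ulim_lip UU (pr_lip hs geo cn) (htt t)) => e e0.
  apply: (@filterS _ U _ _ _ _ (filterI (ev (`|t| + l)) (ev e^-1))).
  move=> n [/= hn en]; have [h _] := est n t hn; apply: (le_trans h).
  apply: (le_trans (dl n)); rewrite -[leRHS]invrK lef_pV2 ?posrE ?invr_gt0//.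
  by rewrite -natr1; lra.
apply: (ulim_lip UU (ht_lip hs) (htt t)) => e e0.
apply: (@filterS _ U _ _ _ _ (filterI (ev (`|t| + l)) (ev (4 / e ^+ 2)))).
move=> n [/= hn en]; have h := ht1 n t hn.
rewrite -(@ler_pXn2r _ 2) ?nnegrE// ?(ltW e0)//; apply: (le_trans h).
have e20 : 0 < e ^+ 2 by rewrite exprn_gt0.
rewrite ler_pdivrMr// -ler_pdivrMl// mulrC.
by rewrite -natr1; lra.
Qed.

End parallel_lines.

(** * Contracting axes *)

Section line_gap.
Context {R : realType} {T : metricType R}.
Hypotheses (geo : geodesic_space T) (cn : @cn_ineq R T).
Hypothesis proper : forall (o : T) r, compact (cball o r).
Variables (s : R -> T) (hs : geodesic_line s).

Lemma pr_line t : pr hs (s t) = t.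
Proof. by apply: pr_unique => //; rewrite mdistxx ht_ge0. Qed.

Lemma reverse_line : geodesic_line (fun t => s (- t)).
Proof. by move=> t u; rewrite hs opprK addrC distrC. Qed.

Lemma pr_reverse y : pr reverse_line y = - pr hs y /\
  ht reverse_line y = ht hs y.
Proof.
have h u : mdist y (s (- - pr hs y)) <= mdist y (s (- u)).
  by rewrite opprK; exact: ht_le.
split; first exact: pr_min.
by rewrite (ht_min reverse_line geo cn h) opprK.
Qed.

(** Parameters below the projection are handled by running the line backwards. *)
Lemma no_parallel_gap2 l D :
  (forall u, exists r phi, [/\ forall x y, mdist (phi x) (phi y) = mdist x y,
    forall t, phi (s t) = s (t + r) & 0 <= u + r <= l]) ->
  0 < D -> ~ (exists c, parallel_at hs D c) ->
  exists2 e, 0 < e & forall y, ht hs y = D ->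
    forall t, `|t - pr hs y| + e <= mdist y (s t).
Proof.
move=> shift D0 nP.
have [e1 e10 h1] := no_parallel_gap geo cn proper shift D0 nP.
have shift' u : exists r phi, [/\ forall x y, mdist (phi x) (phi y) = mdist x y,
    forall t, phi (s (- t)) = s (- (t + r)) & 0 <= u + r <= l].
  have [r [phi [iso sh hr]]] := shift (l - u).
  exists (- r), phi; split => //; last lra.
  by move=> t; rewrite sh opprD opprK.
have nP' : ~ (exists c, parallel_at reverse_line D c).
  move=> [c [lc hc]]; apply: nP; exists (fun t => c (- t)); split.
    by move=> t u; rewrite lc opprK addrC distrC.
  move=> t; have [h2 h3] := hc (- t); have [h4 h5] := pr_reverse (c (- t)).
  by rewrite -h5 h3; split => //; apply: oppr_inj; rewrite -h4.
have [e2 e20 h2] := no_parallel_gap geo cn proper shift' D0 nP'.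
exists (Num.min e1 e2); first by rewrite lt_min e10.
move=> y hy t; have m1 : Num.min e1 e2 <= e1 by rewrite ge_min lexx.
have m2 : Num.min e1 e2 <= e2 by rewrite ge_min lexx orbT.
have [tp|tp] := leP (pr hs y) t.
  by have := h1 y hy t tp; rewrite ger0_norm; lra.
have [p1 p2] := pr_reverse y.
have tp' : - pr hs y <= - t by lra.
have := h2 y; rewrite p1 p2 => /(_ hy _ tp'); rewrite !opprK ler0_norm; lra.
Qed.

(* Reshetnyak's inequality turns the gap into [mdist y z >= L + e / 2] for [y], [z]
   at height [D] with projections at distance [L >= L0]; convexity along the
   perpendiculars then gives linear growth in the height. *)
Lemma gap_divergence D e : 0 < D -> 0 < e ->
  (forall y, ht hs y = D -> forall t, `|t - pr hs y| + e <= mdist y (s t)) ->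
  exists L0 k, [/\ 0 < L0, 0 < k <= 1 & forall y z r, D <= r ->
    r <= ht hs y -> r <= ht hs z -> L0 <= `|pr hs y - pr hs z| ->
    `|pr hs y - pr hs z| + k * r <= mdist y z].
Proof.
move=> D0 e0 gap; exists (D ^+ 2 / e + e), (Num.min 1 (e / (2 * D))).
have D20 : 0 < D ^+ 2 / e by rewrite divr_gt0// exprn_gt0.
have eD : 0 < e / (2 * D) by rewrite divr_gt0// mulr_gt0.
split; [by rewrite addr_gt0| by rewrite lt_min ltr01 eD ge_min lexx|].
have E1 y z : ht hs y = D -> ht hs z = D ->
    D ^+ 2 / e + e <= `|pr hs y - pr hs z| ->
    `|pr hs y - pr hs z| + e / 2 <= mdist y z.
  move=> hy hz; have := reshetnyak geo cn y (s (pr hs y)) (s (pr hs z)) z.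
  have := gap y hy (pr hs z); have := gap z hz (pr hs y).
  rewrite hs (metric_sym (s (pr hs z)) z) -/(ht hs y) -/(ht hs z) hy hz.
  rewrite (distrC (pr hs z)) (metric_sym (s (pr hs y)) z).
  set L := `|_ - _|; have L0 : 0 <= L by exact: normr_ge0.
  move=> g1 g2 q hL.
  have hL' : D ^+ 2 + e ^+ 2 <= L * e.
    have := ler_wpM2r (ltW e0) hL; rewrite mulrDl divfK ?gt_eqF//; lra.
  have g1' : (L + e) ^+ 2 <= mdist z (s (pr hs y)) ^+ 2.
    by rewrite ler_pXn2r ?nnegrE ?mdist_ge0//; lra.
  have g2' : (L + e) ^+ 2 <= mdist y (s (pr hs z)) ^+ 2.
    by rewrite ler_pXn2r ?nnegrE ?mdist_ge0//; lra.
  have e2 := sqr_ge0 e; have := sqr_ge0 D => d2.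
  rewrite -(@ler_pXn2r _ 2) ?nnegrE ?mdist_ge0//; lra.
move=> y z r Dr ry rz.
have r0 : 0 < r by lra.
have cut q w : 0 < q -> q <= ht hs w ->
    exists w', btw (q / ht hs w) (s (pr hs w)) w' w /\ 0 <= q / ht hs w <= 1 /\
      pr hs w' = pr hs w /\ ht hs w' = q.
  move=> q0 qw; have w0 : 0 < ht hs w by lra.
  have l01 : 0 <= q / ht hs w <= 1.
    by rewrite divr_ge0 ?ler_pdivrMr ?mul1r// ltW.
  have [w' hw'] := geodesic_btw geo (s (pr hs w)) w l01.
  have [h1 h2] := pr_perp geo cn l01 hw'.
  by exists w'; rewrite h1 h2 divfK ?gt_eqF.
have [y' [by' [ly [py hy]]]] := cut r y r0 ry.
have [z' [bz' [lz [pz hz]]]] := cut r z r0 rz.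
(* Cutting the perpendiculars at height r does not increase the distance. From height r down to D,
   convexity multiplies its excess over L by at most D / r. *)
have t1 := truncate_lip geo cn (ltW r0) ry rz
  (ex_intro2 _ _ (r / ht hs y) ly by') hy (ex_intro2 _ _ (r / ht hs z) lz bz') hz.
have l01 : 0 <= D / r <= 1.
  by rewrite divr_ge0 ?ler_pdivrMr ?mul1r// ltW.
have [y2 by2] := geodesic_btw geo (s (pr hs y')) y' l01.
have [z2 bz2] := geodesic_btw geo (s (pr hs z')) z' l01.
have [py2 hy2] := pr_perp geo cn l01 by2.
have [pz2 hz2] := pr_perp geo cn l01 bz2.
have := btw_convex geo cn l01 by2 bz2; have := E1 y2 z2.
rewrite hy2 hz2 hy hz divfK ?gt_eqF// py2 pz2 py pz hs.
move=> /(_ erefl erefl); set L := `|_ - _| => E cv hL; have {}E := E hL.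
have {E cv} E : e / 2 <= D / r * (mdist y' z' - L) by lra.
have : e / (2 * D) * r <= mdist y' z' - L.
  have rD : 0 <= r / D by rewrite divr_ge0 ?ltW.
  have := ler_wpM2l rD E.
  have -> : r / D * (e / 2) = e / (2 * D) * r by field; rewrite gt_eqF.
  by have -> : r / D * (D / r * (mdist y' z' - L)) = mdist y' z' - L
    by field; rewrite !gt_eqF.
have : Num.min 1 (e / (2 * D)) * r <= e / (2 * D) * r.
  by rewrite ler_pM2r// ge_min lexx orbT.
lra.
Qed.

End line_gap.

Definition geodesic_on (R : realType) (T : metricType R) (c : R -> T) a b :=
  forall t u, a <= t <= b -> a <= u <= b -> mdist (c t) (c u) = `|t - u|.

(* Long geodesics, as seen from the line, come close to the line near both
   ends of their projection. *)
Definition contracting_line (R : realType) (T : metricType R) (s : R -> T)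
    (hs : geodesic_line s) :=
  exists A D, forall c a b, a <= b -> geodesic_on c a b ->
  2 * A < `|pr hs (c a) - pr hs (c b)| ->
  exists t u, [/\ a <= t, t <= u, u <= b, ht hs (c t) <= D & ht hs (c u) <= D]
    /\ `|pr hs (c a) - pr hs (c t)| <= A /\ `|pr hs (c b) - pr hs (c u)| <= A.

(** * From divergence of perpendiculars to contraction *)

Section contraction.
Context {R : realType} {T : metricType R}.
Hypotheses (geo : geodesic_space T) (cn : @cn_ineq R T).
Variables (s : R -> T) (hs : geodesic_line s) (D L0 k : R).
Hypotheses (D0 : 0 < D) (L00 : 0 < L0) (k01 : 0 < k <= 1).
Hypothesis diverge : forall y z r, D <= r ->
  r <= ht hs y -> r <= ht hs z -> L0 <= `|pr hs y - pr hs z| ->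
  `|pr hs y - pr hs z| + k * r <= mdist y z.

Implicit Types (c : R -> T).

Local Notation pr := (pr hs).
Local Notation ht := (ht hs).

Lemma geodesic_on_sub c a b a' b' : a <= a' -> b' <= b ->
  geodesic_on c a b -> geodesic_on c a' b'.
Proof. by move=> h1 h2 g t u ht hu; apply: g; lra. Qed.

Lemma geodesic_on_rev c a b : geodesic_on c a b ->
  geodesic_on (fun t => c (- t)) (- b) (- a).
Proof.
by move=> g t u h1 h2; rewrite g ?opprK; [rewrite addrC distrC|lra..].
Qed.

Lemma geodesic_on_btw c a b t : geodesic_on c a b -> a < b -> a <= t <= b ->
  0 <= (t - a) / (b - a) <= 1 /\ btw ((t - a) / (b - a)) (c a) (c t) (c b).
Proof.
move=> g ab tab; have ba : 0 < b - a by lra.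
split; first by rewrite divr_ge0 ?ler_pdivrMr ?mul1r; lra.
have h : (t - a) / (b - a) * (b - a) = t - a by rewrite divfK ?gt_eqF.
split; rewrite !g ?lexx ?andbT; try lra; rewrite !ler0_norm; lra.
Qed.

Lemma pr_lip_on c a b : geodesic_on c a b -> lip_on (fun t => pr (c t)) a b.
Proof. by move=> g t u h1 h2; rewrite -(g t u h1 h2); exact: (pr_lip hs geo cn). Qed.

Lemma ht_lip_on c a b : geodesic_on c a b -> lip_on (fun t => ht (c t)) a b.
Proof. by move=> g t u h1 h2; rewrite -(g t u h1 h2); exact: (ht_lip hs). Qed.

(* Cutting the geodesic into pieces whose projections have length [L0]. *)
Lemma long_projection n c a b r : a <= b -> geodesic_on c a b -> D <= r ->
  (forall t, a <= t <= b -> r <= ht (c t)) ->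
  n%:R * L0 <= `|pr (c a) - pr (c b)| -> n%:R * (k * r) <= b - a.
Proof.
move=> + + Dr; elim: n a => [|n IH] a ab g hr.
  by rewrite mul0r => _; lra.
have l1 : lip_on (fun t => `|pr (c t) - pr (c a)|) a b.
  move=> t u h1 h2; apply: le_trans (pr_lip_on g h1 h2).
  apply: le_trans (ler_dist_dist _ _) _.
  by rewrite opprB addrA subrK.
rewrite -natr1 mulrDl mul1r => hn.
have nL : 0 <= n%:R * L0 by rewrite mulr_ge0// ltW.
have [|t tab /= ht1] := @lip_on_IVT R _ a b L0 ab l1.
  rewrite subrr normr0 min_l// max_r// distrC (ltW L00)/=.
  lra.
have := IH t _ (geodesic_on_sub _ _ g) _ _.
case/andP: tab => at1 tb.
move=> /(_ tb at1 (lexx _)) IHt.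
have {}IHt : n%:R * (k * r) <= b - t.
  apply: IHt => [u hu|]; first by apply: hr; lra.
  have := ler_distD (pr (c t)) (pr (c a)) (pr (c b)).
  by rewrite (distrC (pr (c a)) (pr (c t))); lra.
have ha : a <= a <= b by rewrite lexx ab.
have ht2 : a <= t <= b by rewrite at1.
have := diverge Dr (hr _ ht2) (hr _ ha); rewrite ht1 lexx g// => /(_ isT).
rewrite ger0_norm ?subr_ge0// => h1; have L_gt0 := L00; lra.
Qed.

(** For r >= D1 both k * r and k^2 * r are at least 8 * L0 ([D1P]), which absorbs the terms in L
    below. The final estimate is L <= L0 + L / 2 + 12 * L0 / k^2, hence L <= A0 because k <= 1. *)
Let D1 := Num.max D (8 * L0 / k ^+ 2).
Let A0 := 26 * L0 / k ^+ 2.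

Let D1P r : D1 <= r -> [/\ D <= r, 0 < r, 8 * L0 <= k ^+ 2 * r &
  8 * L0 <= k * r].
Proof.
rewrite /D1 ge_max => /andP[h1]; case/andP: k01 => k0 k1.
rewrite ler_pdivrMr ?exprn_gt0// => h2; have r0 : 0 < r by apply: lt_le_trans h1.
split => //; first lra.
by apply: le_trans h2 _; rewrite mulrC ler_pM2r// expr2 ler_piMl// ltW.
Qed.

(** The length is at least k * r for each full L0 in L, and at most ht (c a) + L + r along the path
    through the feet. The term in L is absorbed by 8 * L0 <= k * r. *)
Lemma projection_bound c a b r : a <= b -> geodesic_on c a b -> D1 <= r ->
  (forall t, a <= t <= b -> r <= ht (c t)) -> ht (c b) = r ->
  `|pr (c a) - pr (c b)| * (k * r) <= 2 * L0 * (ht (c a) + 2 * r).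
Proof.
move=> ab g /D1P[Dr r0 _ kr] hr hb; case/andP: k01 => k0 k1; have L_gt0 := L00.
have := mdist_le_ht_pr hs (c a) (c b); rewrite g ?lexx ?ab// hb.
set L := `|pr _ - _|; have L_ge0 : 0 <= L by exact: normr_ge0.
rewrite ler0_norm; last lra.
have L_n0 : L / L0 < (Num.truncn (L / L0)).+1%:R by exact: truncnS_gt.
have nL : (Num.truncn (L / L0))%:R <= L / L0.
  by rewrite truncn_le divr_ge0// ltW.
set n := Num.truncn _ in L_n0 nL.
rewrite ler_pdivlMr// in nL.
rewrite ltr_pdivrMr// -natr1 in L_n0.
have := long_projection ab g Dr hr nL => h1 h2.
have kr0 : 0 < k * r by rewrite mulr_gt0.
have h3 : L * (k * r) <= (n%:R + 1) * L0 * (k * r).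
  by rewrite ler_pM2r// ltW.
have h4 : L0 * (n%:R * (k * r)) <= L0 * (ht (c a) + L + r).
  by rewrite ler_pM2l//; lra.
have h5 : 8 * L0 * L <= k * r * L by rewrite ler_wpM2r.
have h6 : L0 * (k * r) <= L0 * r by rewrite ler_pM2l// ler_piMl// ltW.
have h7 : 0 <= L0 * L by rewrite mulr_ge0// ltW.
have h8 : 0 <= L0 * ht (c a) by rewrite mulr_ge0 ?ht_ge0// ltW.
lra.
Qed.

(* Either the start is at height at most [H], comparable to the length [L] of
   the projection, and [projection_bound] applies. Or the geodesic crosses
   height [H] at a time when, by convexity, it is too close to the
   perpendicular through its start to have moved by [L0] along the line. *)
Lemma descending_projection c a b r : a <= b -> geodesic_on c a b -> D1 <= r ->
  (forall t, a <= t <= b -> r <= ht (c t)) -> ht (c b) = r ->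
  `|pr (c a) - pr (c b)| <= A0.
Proof.
move=> ab g Dr1 hr hb; have [Dr r0 k2r kr] := D1P Dr1; case/andP: k01 => k0 k1.
have L_gt0 := L00.
have k20 : 0 < k ^+ 2 by rewrite exprn_gt0.
have := mdist_le_ht_pr hs (c a) (c b).
set L := `|pr (c a) - _|; have L_ge0 : 0 <= L by exact: normr_ge0.
(* At height H / 2 divergence costs k * H / 2 > L + r, more than the distance from c b to the foot
   of c a. *)
pose H := 2 * (L + r) / k + 2 * r.
have kH : k * H = 2 * (L + r) + 2 * k * r by rewrite /H; field; rewrite gt_eqF.
have Hr : 2 * r <= H by rewrite lerDr divr_ge0 ?ltW// mulr_gt0//; lra.
have star t : a <= t <= b -> ht (c t) <= H ->
    `|pr (c t) - pr (c b)| <= L / 2 + 12 * L0 / k ^+ 2.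
  move=> tab tH; case/andP: (tab) => at1 tb.
  have hr' u : t <= u <= b -> r <= ht (c u) by move=> hu; apply: hr; lra.
  have := projection_bound tb (geodesic_on_sub at1 (lexx _) g) Dr1 hr' hb.
  set L' := `|_ - _| => h1.
  have h2 : k * (L' * (k * r)) <= k * (2 * L0 * (H + 2 * r)).
    rewrite ler_pM2l//; apply: (le_trans h1).
    by rewrite ler_pM2l ?mulr_gt0// lerD2r.
  have h3 : 8 * L0 * L <= k ^+ 2 * r * L by rewrite ler_wpM2r.
  have h4 : L0 * (k * r) <= L0 * r by rewrite ler_pM2l// ler_piMl// ltW.
  have h5 : L0 * (k * H) = L0 * (2 * (L + r) + 2 * k * r) by rewrite kH.
  have k2r0 : 0 < k ^+ 2 * r by rewrite mulr_gt0.
  rewrite -(ler_pM2r k2r0).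
  have -> : (L / 2 + 12 * L0 / k ^+ 2) * (k ^+ 2 * r) =
    k ^+ 2 * r * L / 2 + 12 * L0 * r by field; rewrite gt_eqF.
  lra.
have LA : forall d, d <= L0 -> L <= d + (L / 2 + 12 * L0 / k ^+ 2) -> L <= A0.
  move=> d dL; have : L0 <= L0 / k ^+ 2.
    rewrite ler_pdivlMr//; apply: ler_piMr; first exact: ltW.
    by rewrite expr_le1// ltW.
  rewrite /A0 -!mulrA; lra.
have [aH|aH] := leP (ht (c a)) H.
  move=> _; apply: (LA 0); first exact: ltW.
  by rewrite add0r; apply: star => //; rewrite lexx ab.
have [|t tab tH] := @lip_on_IVT R _ a b H ab (ht_lip_on g).
  rewrite hb min_r ?max_l; lra.
have ab' : a < b.
  rewrite lt_neqAle ab andbT; apply/eqP => e; move: hb; rewrite -e; lra.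
have [l01 bt] := geodesic_on_btw g ab' tab.
set l := _ / _ in l01 bt.
(* v lies on the perpendicular of c a at the same fraction as c t, so d(c t, v) <= L + r by
   convexity. *)
have [v hv] := geodesic_btw geo (c a) (s (pr (c a))) l01.
have l01' : 0 <= 1 - l <= 1 by lra.
have [pv hv'] := pr_perp geo cn l01' (btw_sym hv).
have := btw_convex1 cn l01 bt hv.
have cb : mdist (c b) (s (pr (c a))) <= L + r.
  have := metric_triangle (c b) (s (pr (c b))) (s (pr (c a))).
  by rewrite -/(ht (c b)) hb hs distrC -/L; lra.
have cv : l * mdist (c b) (s (pr (c a))) <= L + r.
  apply: le_trans cb; rewrite ler_piMl ?mdist_ge0//; lra.
move=> dv _; apply: (LA `|pr (c a) - pr (c t)|); last first.
  have := ler_distD (pr (c t)) (pr (c a)) (pr (c b)).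
  by have := star t tab; rewrite tH lexx => /(_ isT); rewrite -/L; lra.
apply: ltW; rewrite ltNge; apply/negP => far.
have kr0 : 0 < k * r by rewrite mulr_gt0.
(* Both cases contradict d(c t, v) <= L + r: either divergence at height H / 2 applies, or the
   heights of c t and v differ by more than H / 2. *)
have [hv2|hv2] := leP (H / 2) (ht v).
  have := @diverge (c t) v (H / 2); rewrite pv distrC => /(_ _ _ hv2 far).
  rewrite tH => h; have {h} : `|pr (c a) - pr (c t)| + k * (H / 2) <= mdist (c t) v.
    by apply: h; lra.
  have := normr_ge0 (pr (c a) - pr (c t)); lra.
have := ht_lip hs (c t) v; have := ler_norm (ht (c t) - ht v).
rewrite tH; have : k * (H / 2) <= H / 2 by rewrite ler_piMl//; lra.
lra.
Qed.

Lemma ascending_projection c a b r : a <= b -> geodesic_on c a b -> D1 <= r ->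
  (forall t, a <= t <= b -> r <= ht (c t)) -> ht (c a) = r ->
  `|pr (c a) - pr (c b)| <= A0.
Proof.
move=> ab g Dr hr ha.
have := @descending_projection (fun t => c (- t)) (- b) (- a) r _
  (geodesic_on_rev g) Dr.
rewrite !opprK distrC; apply => //; first by rewrite lerN2.
by move=> t h; apply: hr; lra.
Qed.

Lemma first_descent c a b : a <= b -> geodesic_on c a b ->
  (forall t, a <= t <= b -> ht (c b) <= ht (c t)) -> ht (c b) <= D1 ->
  exists2 t, a <= t <= b & ht (c t) <= D1 /\ `|pr (c a) - pr (c t)| <= A0.
Proof.
move=> ab g hmin hb.
have A00 : 0 <= A0 by rewrite divr_ge0 ?sqr_ge0// mulr_ge0// ltW.
have [ha|ha] := leP (ht (c a)) D1.
  by exists a; rewrite ?lexx ?ab// subrr normr0.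
have [|t tab tD] := @lip_on_IVT R _ a b D1 ab (ht_lip_on g).
  rewrite min_r ?max_l; lra.
exists t => //; split; first by rewrite tD.
case/andP: (tab) => at1 tb.
apply: (descending_projection at1 (geodesic_on_sub (lexx _) tb g) (lexx _)) => //.
(* Before t the geodesic stays above D1: a lower point at u, together with height at most D1 at b,
   would put c t below D1 by convexity. *)
move=> u /andP[au ut]; rewrite leNgt; apply/negP => uD.
have ut' : u < t.
  by rewrite lt_neqAle ut andbT; apply/eqP => e; move: uD; rewrite e tD ltxx.
have ub : u < b by lra.
have utb : u <= t <= b by rewrite ut.
have [l01 bt] := geodesic_on_btw (geodesic_on_sub au (lexx _) g) ub utb.
have := ht_convex hs geo cn l01 bt; rewrite tD.
set l := _ / _ in l01 bt *.
have [l1|l1] : l = 1 \/ l < 1.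
  by case/andP: l01 => _; rewrite le_eqVlt => /orP[/eqP|]; [left|right].
  have := hmin u; rewrite l1 au ltW// => /(_ isT); lra.
have := ler_wpM2l (_ : 0 <= l) hb; have := ltr_pM2l (_ : 0 < 1 - l).
move=> /(_ _) /(_ (ht (c u)) D1); rewrite uD subr_gt0 l1 => /(_ isT).
by case/andP: l01 => l0 _ => h1 /(_ l0); lra.
Qed.

(** Split at the lowest point. If it is above D1, the descending and the ascending half project to
    length at most A0 each, against the assumption; otherwise [first_descent] applies from both
    ends. *)
Lemma diverging_contracting : contracting_line hs.
Proof.
exists A0, D1 => c a b ab g far.
have [m mab hmin] := lip_on_EVT_min ab (ht_lip_on g).
case/andP: (mab) => am mb.
have g1 := geodesic_on_sub (lexx a) mb g; have g2 := geodesic_on_sub am (lexx b) g.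
have hm : ht (c m) <= D1.
  rewrite leNgt; apply/negP => mD.
  have h1 : `|pr (c a) - pr (c m)| <= A0.
    by apply: (descending_projection am g1 (ltW mD)) => // t h; apply: hmin; lra.
  have h2 : `|pr (c m) - pr (c b)| <= A0.
    by apply: (ascending_projection mb g2 (ltW mD)) => // t h; apply: hmin; lra.
  by have := ler_distD (pr (c m)) (pr (c a)) (pr (c b)); lra.
have [|t tam [tD tA]] := first_descent am g1 _ hm.
  by move=> t h; apply: hmin; lra.
have mb' : - b <= - m by rewrite lerN2.
have := first_descent mb' (geodesic_on_rev g2); rewrite !opprK.
have hmin' u : - b <= u <= - m -> ht (c m) <= ht (c (- u)).
  by move=> h; apply: hmin; lra.
move=> /(_ hmin' hm)[u ubm [uD uA]].
by exists t, (- u); do !split => //; lra.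
Qed.

End contraction.

(** * Geodesics and rays near a contracting line *)

Section contracting_line_theory.
Context {R : realType} {T : metricType R}.
Hypotheses (geo : geodesic_space T) (cn : @cn_ineq R T).
Variables (s : R -> T) (hs : geodesic_line s).
Hypothesis hc : contracting_line hs.

Lemma contracting_passes : exists A B, forall y z, A < `|pr hs y - pr hs z| ->
  exists2 m, mdist y m + mdist m z = mdist y z & mdist m (s (pr hs z)) <= B.
Proof.
have [A [D hv]] := hc; exists (2 * A), (D + A) => y z far.
have [c [c0 c1 cd]] := geo y z.
have yz := mdist_ge0 y z.
have [|t [u [[h1 h2 h3 _ h5] [_ h7]]]] := hv c 0 (mdist y z) yz cd.
  by rewrite c0 c1.
have u0 : 0 <= u <= mdist y z by lra.
exists (c u).
  have yz0 : 0 <= (0 : R) <= mdist y z by apply/andP.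
  have yz1 : 0 <= mdist y z <= mdist y z by apply/andP.
  have e1 : mdist y (c u) = u by rewrite -[in LHS]c0 cd// ler0_norm; lra.
  have e2 : mdist (c u) z = mdist y z - u.
    by rewrite -[in LHS]c1 cd// ler0_norm; lra.
  by rewrite e1 e2; lra.
rewrite c1 in h7.
have := metric_triangle (c u) (s (pr hs (c u))) (s (pr hs z)).
by rewrite -/(ht hs (c u)) hs distrC; lra.
Qed.

Definition line_ray (c : R -> T) (lc : geodesic_line c) : ray T :=
  Ray (fun t u _ _ => lc t u).

Lemma asymptotic_eventually (c c' : ray T) W C :
  (forall t, 0 <= t -> W < t -> mdist (c t) (c' t) <= C) -> asymptotic c c'.
Proof.
move=> h; apply/asboolP.
exists (Num.max C (2 * W + mdist (c 0) (c' 0))) => t t0.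
have [tW|tW] := leP t W; last by rewrite le_max h.
rewrite le_max; apply/orP; right.
have := metric_triangle (c t) (c 0) (c' t).
have := metric_triangle (c 0) (c' 0) (c' t).
by rewrite !ray_geodesic// sub0r subr0 normrN ger0_norm; lra.
Qed.

(** If the projection is unbounded, contraction of ever longer pieces keeps the ray at height at
    most D from time W0 on. Its projection then moves at unit speed up to a bounded error, hence in
    one direction. *)
Lemma ray_dichotomy (c : ray T) :
  [\/ exists M, forall t, 0 <= t -> `|pr hs (c t)| <= M,
      asymptotic c (line_ray hs) |
      asymptotic c (line_ray (reverse_line hs))].
Proof.
have [[M hM]|unb] := pselect (exists M, forall t, 0 <= t -> `|pr hs (c t)| <= M).
  by apply: Or31; exists M.
have {}unb M : exists t, 0 <= t /\ M < `|pr hs (c t)|.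
  apply: contrapT => h; apply: unb; exists M => t t0.
  by rewrite leNgt; apply/negP => lt; apply: h; exists t.
have [A [D hv]] := hc.
have gc a b : 0 <= a -> geodesic_on c a b.
  by move=> a0 t u h1 h2; rewrite ray_geodesic//; lra.
(* This bounds the time t1 at which contraction first brings the ray down to height D. *)
pose W0 := Num.max 0 (ht hs (c 0) + A + D).
have W00 : 0 <= W0 by rewrite le_max lexx.
have W01 : ht hs (c 0) + A + D <= W0 by rewrite le_max lexx orbT.
(* c v is taken with projection so far out that t2 >= t; between t1 and t2 the height is at most D
   by convexity. *)
have low t : W0 <= t -> ht hs (c t) <= D.
  move=> tW; have [v [v0 hvv]] := unb (`|pr hs (c 0)| + 2 * `|A| + A + t).
  have nA := normr_ge0 A; have lA := ler_norm A; have lA' := ler_norm (- A).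
  rewrite normrN in lA'.
  have far : 2 * `|A| + A + t < `|pr hs (c 0) - pr hs (c v)|.
    have := ler_distD 0 (pr hs (c v)) (pr hs (c 0)).
    have := ler_distD (pr hs (c 0)) (pr hs (c v)) 0; rewrite !subr0.
    by rewrite (distrC (pr hs (c v)) (pr hs (c 0))); lra.
  have [|t1 [t2 [[h1 h2 h3 h4 h5] [h6 h7]]]] := hv c 0 v v0 (gc _ _ (lexx 0)).
    by lra.
  have t1t : t1 <= t.
    have := mdist_le_ht_pr hs (c 0) (c t1).
    by rewrite ray_geodesic// sub0r normrN ger0_norm//; lra.
  have t2t : t <= t2.
    have := pr_lip hs geo cn (c 0) (c t2).
    rewrite ray_geodesic//; last lra.
    rewrite sub0r normrN (ger0_norm (_ : 0 <= t2)); last lra.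
    have := ler_distD (pr hs (c t2)) (pr hs (c 0)) (pr hs (c v)).
    by rewrite (distrC (pr hs (c t2))); lra.
  have [e|t12] : t1 = t2 \/ t1 < t2.
    by move: h2; rewrite le_eqVlt => /orP[/eqP|]; [left|right].
    by have -> : t = t1 by lra.
  have tt : t1 <= t <= t2 by rewrite t1t.
  have [l01 bt] := geodesic_on_btw (gc t1 t2 h1) t12 tt.
  have := ht_convex hs geo cn l01 bt; case/andP: l01.
  set l := _ / _ => l0 l1.
  have l1' : 0 <= 1 - l by lra.
  have := ler_wpM2l l0 h5; have := ler_wpM2l l1' h4; lra.
have D0 : 0 <= D by apply: le_trans (low W0 (lexx _)); exact: ht_ge0.
pose x t := pr hs (c t).
have xd t : W0 <= t -> t - W0 - 2 * D <= `|x t - x W0| <= t - W0.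
  move=> tW; have := mdist_le_ht_pr hs (c t) (c W0).
  have := pr_lip hs geo cn (c t) (c W0); have := low t tW.
  have := low W0 (lexx _); rewrite ray_geodesic//; last lra.
  have tW0 : 0 <= t - W0 by rewrite subr_ge0.
  by rewrite (ger0_norm tW0) -/(x t) -/(x W0); lra.
have [pos|npos] := pselect (forall t, W0 + 2 * D < t -> x W0 < x t).
  apply: Or32; apply: (@asymptotic_eventually _ _ (W0 + 2 * D)
    (D + 2 * D + `|x W0| + W0)) => t t0 tW /=.
  have tW' : W0 <= t by lra.
  have := xd t tW'; rewrite gtr0_norm ?subr_gt0 ?pos// => h.
  have := metric_triangle (c t) (s (x t)) (s t).
  rewrite hs -/(ht hs (c t)); have := low t tW'.
  have : `|x t - t| <= 2 * D + `|x W0| + W0.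
    by rewrite ler_norml; have := ler_norm (x W0); have := ler_norm (- x W0);
      rewrite normrN; lra.
  lra.
have neg t : W0 + 2 * D < t -> x t < x W0.
  move=> tW; rewrite ltNge le_eqVlt; apply/negP => /orP[/eqP e|lt].
    have tW' : W0 <= t by lra.
    by have := xd t tW'; rewrite e subrr normr0; lra.
  apply: npos => u uW; rewrite ltNge; apply/negP => le.
  (* A change of side would give a time v > W0 + 2 * D with x v = x W0, against the lower bound in
     [xd]. *)
  have [a [b [ab [aW ab1 xab]]]] : exists a b, a <= b /\ [/\ W0 + 2 * D < a,
      geodesic_on c a b & Num.min (x a) (x b) <= x W0 <= Num.max (x a) (x b)].
    have [tu|ut] := leP t u.
      exists t, u; split => //; split => //; first by apply: gc; lra.
      by rewrite min_r ?max_l; lra.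
    exists u, t; split; first exact: ltW.
    split => //; first by apply: gc; lra.
    by rewrite min_l ?max_r; lra.
  have [v vab xv] := lip_on_IVT ab (pr_lip_on geo cn hs ab1) xab.
  have vW : W0 <= v by lra.
  by have := xd v vW; rewrite /x xv subrr normr0; lra.
apply: Or33; apply: (@asymptotic_eventually _ _ (W0 + 2 * D)
  (D + 2 * D + `|x W0| + W0)) => t t0 tW /=.
have tW' : W0 <= t by lra.
have := xd t tW'; rewrite ltr0_norm ?subr_lt0 ?neg// => h.
have := metric_triangle (c t) (s (x t)) (s (- t)).
rewrite hs -/(ht hs (c t)); have := low t tW'.
have : `|x t - - t| <= 2 * D + `|x W0| + W0.
  by rewrite ler_norml; have := ler_norm (x W0); have := ler_norm (- x W0);
    rewrite normrN; lra.
lra.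
Qed.

End contracting_line_theory.

Section rank_one_axis.
Context {R : realType} {T : metricType R}.

(** phi is a power of h if u < 0, and of its inverse otherwise. *)
Lemma axis_shift (h : selfisometry T) (s : R -> T) l : 0 < l ->
  (forall t, h (s t) = s (t + l)) -> forall u, exists r phi,
  [/\ forall x y, mdist (phi x) (phi y) = mdist x y,
    forall t, phi (s t) = s (t + r) & 0 <= u + r <= l].
Proof.
move=> l0 hl.
have it (f : selfisometry T) l' : (forall t, f (s t) = s (t + l')) -> forall n,
    (forall x y, mdist (iter n f x) (iter n f y) = mdist x y) /\
    (forall t, iter n f (s t) = s (t + n%:R * l')).
  move=> fl; elim=> [|n [IH1 IH2]].
    by split => // t; rewrite mul0r addr0.
  split=> [x y|t]; first by rewrite !iterS isometry_dist.
  by rewrite iterS IH2 fl -natr1 mulrDl mul1r addrA.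
have inv t : isometry_inv h (s t) = s (t + - l).
  by apply: (@isometry_inj _ _ h); rewrite /= isometry_inv_funK hl subrK.
move=> u; have [u0|u0] := leP 0 u.
  have [i1 i2] := it _ _ inv (Num.truncn (u / l)).
  exists ((Num.truncn (u / l))%:R * - l), (iter (Num.truncn (u / l)) (isometry_inv h)).
  split => //.
  have := truncnS_gt (u / l); have : (Num.truncn (u / l))%:R <= u / l.
    by rewrite truncn_le divr_ge0// ltW.
  by rewrite ltr_pdivrMr// ler_pdivlMr// -natr1; lra.
have [i1 i2] := it _ _ hl (Num.truncn (- u / l)).+1.
exists ((Num.truncn (- u / l)).+1%:R * l), (iter (Num.truncn (- u / l)).+1 h).
split => //.
have := truncnS_gt (- u / l); have : (Num.truncn (- u / l))%:R <= - u / l.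
  by rewrite truncn_le divr_ge0 ?oppr_ge0// ltW.
by rewrite ltr_pdivrMr// ler_pdivlMr// -natr1; lra.
Qed.

Lemma rank_one_contracting (h : selfisometry T) (s : R -> T)
    (hs : geodesic_line s) l : hadamard T -> locally_compact [set: T] ->
  0 < l -> (forall t, h (s t) = s (t + l)) -> ~ bounds_flat_half_plane s ->
  contracting_line hs.
Proof.
move=> [cT geo cat] lc l0 hl nb.
have cn := cat0_cn geo cat; have proper := hopf_rinow cT geo lc.
have [D [D0 nP]] : exists D, 0 < D /\ ~ exists c, parallel_at hs D c.
  apply: contrapT => nD; apply: nb.
  apply: (parallel_half_plane geo cn proper (hs := hs)) => D D0.
  by apply: contrapT => nc; apply: nD; exists D.
have [e e0 gap] := no_parallel_gap2 geo cn proper (axis_shift l0 hl) D0 nP.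
have [L0 [k [L00 k01 dv]]] := gap_divergence geo cn D0 e0 gap.
exact: (diverging_contracting geo cn D0 L00 k01 dv).
Qed.

End rank_one_axis.

(** * Dynamics on the boundary *)

Section boundary_theory.
Context {R : realType} {T : metricType R}.
Implicit Types (f g h : selfisometry T) (c : ray T) (xi : boundary T).

Lemma endpoint_eq c c' : endpoint c = endpoint c' <-> asymptotic c c'.
Proof.
have P := @eqmodP _ (@asymptotic_equiv R T) c c'.
by split => [e|as_]; [exact/P|exact/P].
Qed.

Lemma endpoint_repr xi : endpoint (repr xi) = xi.
Proof. exact: reprK. Qed.

Lemma asymptotic_repr c : asymptotic (repr (endpoint c)) c.
Proof. by apply/endpoint_eq; rewrite endpoint_repr. Qed.

Lemma boundary_act_endpoint g c :
  boundary_act g (endpoint c) = endpoint (ray_act g c).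
Proof.
apply/endpoint_eq; have /asboolP[C hC] := asymptotic_repr c.
by apply/asboolP; exists C => t t0; rewrite /= isometry_dist; exact: hC.
Qed.

Lemma boundary_actM g h xi :
  boundary_act (g * h)%g xi = boundary_act g (boundary_act h xi).
Proof.
rewrite -[boundary_act h xi]/(endpoint (ray_act h (repr xi))).
rewrite boundary_act_endpoint; apply/endpoint_eq.
by apply/asboolP; exists 0 => t t0; rewrite mdistxx.
Qed.

Lemma boundary_act1 xi : boundary_act (1%g : selfisometry T) xi = xi.
Proof.
rewrite -[RHS]endpoint_repr; apply/endpoint_eq.
by apply/asboolP; exists 0 => t t0; rewrite mdistxx.
Qed.

Lemma boundary_act_fix h xi n : boundary_act h xi = xi ->
  boundary_act (h ^+ n)%g xi = xi.
Proof.
move=> e; elim: n => [|n IH]; first exact: boundary_act1.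
by rewrite expgS boundary_actM IH.
Qed.

Definition axis_end (s : R -> T) (hs : geodesic_line s) xi :=
  xi = endpoint (line_ray hs) \/ xi = endpoint (line_ray (reverse_line hs)).

Lemma axis_end_fixed h s (hs : geodesic_line s) l xi :
  (forall t, h (s t) = s (t + l)) -> axis_end hs xi -> boundary_act h xi = xi.
Proof.
move=> hl [] ->; rewrite boundary_act_endpoint; apply/endpoint_eq;
  apply/asboolP; exists `|l| => t t0 /=; rewrite hl hs.
  by rewrite addrAC subrr add0r.
by rewrite opprK addrAC addNr add0r.
Qed.

End boundary_theory.

Section dynamics.
Context {R : realType} {T : metricType R}.
Hypotheses (geo : geodesic_space T) (cn : @cn_ineq R T).
Variables (g : selfisometry T) (s : R -> T) (hs : geodesic_line s) (l : R).
Hypotheses (l0 : 0 < l) (gl : forall t, g (s t) = s (t + l)).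
Hypothesis (hc : contracting_line hs).

Lemma expg_line n t : (g ^+ n)%g (s t) = s (t + n%:R * l).
Proof.
elim: n t => [|n IH] t; first by rewrite mul0r addr0.
by rewrite expgS /= IH gl -natr1 mulrDl mul1r addrA.
Qed.

Lemma pr_expg n y : pr hs ((g ^+ n)%g y) = pr hs y + n%:R * l.
Proof.
have [|//] := pr_shift geo cn hs _ (expg_line n) y.
by move=> x z; rewrite isometry_dist.
Qed.

Lemma not_axis_end_bounded xi : ~ axis_end hs xi ->
  exists2 M, 0 <= M & forall t, 0 <= t -> `|pr hs ((repr xi : ray T) t)| <= M.
Proof.
move=> nx; have [[M hM]|as1|as2] := ray_dichotomy geo cn hc (repr xi : ray T).
- exists M => //; exact: le_trans (hM 0 (lexx 0)).
- by exfalso; apply: nx; left; rewrite -(endpoint_repr xi); exact/endpoint_eq.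
- by exfalso; apply: nx; right; rewrite -(endpoint_repr xi); exact/endpoint_eq.
Qed.

(** Stated for the geodesics to all points of the ray rather than for one to its end point; both the
    Busemann estimate and the multiplicity bound use it at finite times. *)
Definition passes (o : T) B y (c : ray T) := forall t, 0 <= t ->
  exists2 m, mdist y m + mdist m (c t) = mdist y (c t) & mdist m o <= B.

(** The points i * N * l are spaced by more than 2 * (M + A), so p is close to at most one of
    them. *)
Lemma far_translates (M A : R) : exists N0, forall N, (N0 <= N)%N ->
  forall i j : nat, i != j -> forall p,
  M + A < `|p - (i * N)%:R * l| \/ M + A < `|p - (j * N)%:R * l|.
Proof.
have l_gt0 := l0.
exists (Num.truncn (2 * (M + A) / l)).+1 => N hN i j ij p.
have Nl : 2 * (M + A) < N%:R * l.
  rewrite -ltr_pdivrMr//; apply: lt_le_trans (truncnS_gt _) _.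
  by rewrite ler_nat.
have [h1|h1] := ltP (M + A) `|p - (i * N)%:R * l|; first by left.
have [h2|h2] := ltP (M + A) `|p - (j * N)%:R * l|; first by right.
exfalso; have := ler_distD p ((i * N)%:R * l) ((j * N)%:R * l).
rewrite (distrC _ p) -mulrBl normrM (gtr0_norm l_gt0).
have : N%:R <= `|(i * N)%:R - (j * N)%:R| :> R.
  rewrite !natrM -mulrBl normrM (ger0_norm (ler0n R N)) ler_peMl//.
  have [lt|lt|e] := ltngtP i j; last by rewrite e eqxx in ij.
    rewrite distrC -natrB ?(ltnW lt)// normr_nat ler1n subn_gt0//.
  by rewrite -natrB ?(ltnW lt)// normr_nat ler1n subn_gt0.
move=> h3; have := ler_wpM2r (ltW l_gt0) h3; lra.
Qed.

(** The translated ray projects into distance M of k * N * l, so for one of k = i, j it projects far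
    from y. By contraction, geodesics from y to it then pass near its projection. *)
Lemma expg_passes xi o : ~ axis_end hs xi -> exists N0, forall N, (N0 <= N)%N ->
  exists B, forall y (i j : nat), (i < 3)%N -> (j < 3)%N -> i != j ->
    passes o B y (ray_act (g ^+ (i * N))%g (repr xi)) \/
    passes o B y (ray_act (g ^+ (j * N))%g (repr xi)).
Proof.
move=> /not_axis_end_bounded[M M0 hM].
have [A [B hAB]] := contracting_passes geo hc.
have [N0 hN0] := far_translates M A; exists N0 => N /hN0 hN.
have l_gt0 := l0.
(* The added terms bound the distance from o to the foot of any point of the translated rays. *)
exists (B + (M + (3 * N)%:R * l + mdist (s 0) o)) => y i j i3 j3 ij.
have key k : (k < 3)%N -> M + A < `|pr hs y - (k * N)%:R * l| ->
    passes o (B + (M + (3 * N)%:R * l + mdist (s 0) o)) y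
      (ray_act (g ^+ (k * N))%g (repr xi)).
  move=> k3 far t t0; rewrite /=; set z := (g ^+ _)%g _.
  have ez : pr hs z = pr hs ((repr xi : ray T) t) + (k * N)%:R * l.
    by rewrite /z pr_expg.
  have hMt := hM t t0.
  have [|m h1 h2] := hAB y z.
    have := ler_distD (pr hs z) (pr hs y) ((k * N)%:R * l).
    rewrite {2}ez addrK; lra.
  exists m => //; have := metric_triangle m (s (pr hs z)) o.
  have := metric_triangle (s (pr hs z)) (s 0) o; rewrite hs subr0 ez.
  have := ler_normD (pr hs ((repr xi : ray T) t)) ((k * N)%:R * l).
  have kl : 0 <= (k * N)%:R * l by rewrite mulr_ge0// ltW.
  rewrite (ger0_norm kl).
  have : (k * N)%:R * l <= (3 * N)%:R * l.
    by rewrite ler_pM2r// ler_nat leq_mul2r ltnW ?orbT.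
  rewrite ez in h2; lra.
by have [/key|/key] := hN i j ij (pr hs y); [left|right]; auto.
Qed.

(* The translates of a ray with bounded projection have disjoint projections, so
   by contraction they diverge from each other. *)
Lemma expg_distinct xi : ~ axis_end hs xi -> exists N0, forall N, (N0 <= N)%N ->
  forall i j : nat, i != j ->
  boundary_act (g ^+ (i * N))%g xi <> boundary_act (g ^+ (j * N))%g xi.
Proof.
move=> /not_axis_end_bounded[M M0 hM].
have [A [B hAB]] := contracting_passes geo hc.
have [N0 hN0] := far_translates (M + M) A; exists N0 => N /hN0 hN i j ij.
move=> /endpoint_eq/asboolP[C hC].
have l_gt0 := l0.
have C0 := le_trans (mdist_ge0 _ _) (hC 0 (lexx 0)).
(* With equal end points, y and z would be within C, while the geodesic between them passes near the
   foot of z. This keeps z within K of the origin of its ray, impossible at time t > K. *)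
pose K := C + B + M + `|(j * N)%:R * l| +
  mdist (s 0) ((g ^+ (j * N))%g ((repr xi : ray T) 0)).
pose t := `|K| + 1; have t0 : 0 <= t by rewrite addr_ge0.
have tK : K < t by rewrite /t; have := ler_norm K; lra.
have := hC t t0; rewrite /=.
set y := (g ^+ (i * N))%g _; set z := (g ^+ (j * N))%g _ => hyz.
have ey : pr hs y = pr hs ((repr xi : ray T) t) + (i * N)%:R * l.
  by rewrite /y pr_expg.
have ez : pr hs z = pr hs ((repr xi : ray T) t) + (j * N)%:R * l.
  by rewrite /z pr_expg.
have hMt := hM t t0.
have far : A < `|pr hs y - pr hs z|.
  have -> : pr hs y - pr hs z = (i * N)%:R * l - (j * N)%:R * l.
    by rewrite ey ez; ring.
  have := normr_ge0 ((i * N)%:R * l - (j * N)%:R * l).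
  have [] := hN i j ij ((j * N)%:R * l); last by rewrite subrr normr0; lra.
  by rewrite distrC; lra.
have [m h1 h2] := hAB y z far.
have d1 := metric_triangle z m (s (pr hs z)).
have d2 := metric_triangle z (s (pr hs z)) (s 0).
have d3 := metric_triangle ((g ^+ (j * N))%g ((repr xi : ray T) 0)) (s 0) z.
move: d3; rewrite {1}/z isometry_dist ray_geodesic// sub0r normrN ger0_norm//.
rewrite (metric_sym _ (s 0)) (metric_sym (s 0) z).
move: d2; rewrite hs subr0.
have := mdist_ge0 y m; have := ler_normD (pr hs ((repr xi : ray T) t)) ((j * N)%:R * l).
rewrite -ez; rewrite (metric_sym z m) in d1; rewrite /K in tK; lra.
Qed.

End dynamics.

Section leaving_axis_ends.
Context {R : realType} {T : metricType R}.
Hypotheses (geo : geodesic_space T) (cn : @cn_ineq R T).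
Variables (g h : selfisometry T) (s u : R -> T) (hs : geodesic_line s)
  (hu : geodesic_line u) (l k : R).
Hypotheses (k0 : 0 < k) (gl : forall t, g (s t) = s (t + l))
  (hk : forall t, h (u t) = u (t + k)) (hc : contracting_line hu)
  (indep : independent g h).

(** An end point of the axis of h is fixed by h, so independence keeps it off the axis of g.
    Otherwise the translates are distinct, and each end of the axis of g is met at most once. *)
Lemma leave_axis_ends xi : exists N0, forall N, (N0 <= N)%N ->
  exists p q : nat, forall i, i != p -> i != q ->
  ~ axis_end hs (boundary_act (h ^+ (i * N))%g xi).
Proof.
have [ux|ux] := pselect (axis_end hu xi).
  exists 0%N => N _; exists 0%N, 0%N => i _ _.
  have hx := axis_end_fixed hk ux; rewrite boundary_act_fix// => sx.
  suff : [set: boundary T] xi /\ (set0 : set (boundary T)) xi by case.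
  by split => //; rewrite -indep; split => //=; exact: axis_end_fixed gl sx.
have [N0 hN0] := expg_distinct geo cn k0 hk hc ux; exists N0 => N /hN0 hN.
have one e : exists p : nat, forall i, i != p ->
    boundary_act (h ^+ (i * N))%g xi <> e.
  have [[p hp]|np] := pselect (exists p, boundary_act (h ^+ (p * N))%g xi = e).
    by exists p => i ip; rewrite -hp; exact: hN.
  by exists 0%N => i _ e'; apply: np; exists i.
have [p hp] := one (endpoint (line_ray hs)).
have [q hq] := one (endpoint (line_ray (reverse_line hs))).
by exists p, q => i ip iq [] e; [exact: (hp i)|exact: (hq i)].
Qed.

End leaving_axis_ends.

(** * Discrete groups *)

Lemma leq_size_fibers (S I : eqType) (f : S -> I) (s : seq S) (r : seq I) K :
  (forall x, x \in s -> f x \in r) ->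
  (forall i, i \in r -> (count (fun x => f x == i) s <= K)%N) ->
  (size s <= size r * K)%N.
Proof.
elim: r s => [|i r IH] s sr fK.
  by case: s sr {fK} => // x s /(_ x (mem_head _ _)).
rewrite mulSn -(count_predC (fun x => f x == i) s) leq_add ?fK ?mem_head//.
rewrite -size_filter; apply: IH => [x|j jr].
  by rewrite mem_filter /= => /andP[/negbTE fx /sr]; rewrite inE fx.
rewrite count_filter; apply: leq_trans (fK j _); last by rewrite inE jr orbT.
by apply: sub_count => x /= /andP[].
Qed.

Section proper_isometries.
Context {R : realType} {T : metricType R}.
Hypothesis proper : forall (o : T) r, compact (cball o r).

Lemma finite_net o r e : 0 < e -> exists F : seq T, forall x, mdist o x <= r ->
  exists2 z, z \in F & mdist x z < e.
Proof.
move=> e0; apply: contrapT => noF.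
pose B (F : seq T) := [set x | mdist o x <= r /\ forall z, z \in F -> e <= mdist x z].
have PB : ProperFilter (filter_from [set: seq T] B).
  apply: filter_from_proper => [|F _].
    apply: filter_from_filter; first by exists [::].
    move=> F F' _ _; exists (F ++ F') => // x [xo xF].
    by split; split => // z zF; apply: xF; rewrite mem_cat zF ?orbT.
  apply: contrapT => /forallNP nx; apply: noF; exists F => x ox.
  apply: contrapT => nz; apply: (nx x); split => // z zF.
  by rewrite leNgt; apply/negP => h; apply: nz; exists z.
have [U [UU BU]] := ultraFilterLemma PB.
have PU : ProperFilter U by exact: ultra_proper.
have := @proper o r; rewrite compact_ultra => /(_ U UU).
case=> [|p [_ Up]]; first by apply: BU; exists [::] => // x [].
have FU := @filter_filter _ _ PU.
have Up1 : U [set y | mdist p y < e] by exact: (@cvg_mdist_lt _ _ U FU _ Up _ e0).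
have Up2 : U (B [:: p]) by apply: BU; exists [:: p].
have [x [/= h1 [_ /(_ p (mem_head _ _))]]] := filter_ex (filterI Up1 Up2).
by rewrite metric_sym leNgt h1.
Qed.

(** Uniform closeness to the identity on balls defines a filter [G] that converges in the
    compact-open topology, so some [G n] lies in the given neighbourhood. *)
Lemma nbhs_isometry_one o (A : set (selfisometry T)) :
  nbhs (isometry_one T) A -> exists e r, 0 < e /\
  forall f : selfisometry T, (forall x, mdist o x <= r -> mdist x (f x) < e) -> A f.
Proof.
move=> [_ [[B oB <-] /= B1 BA]].
pose G (n : nat) := [set f : {compact-open, T -> T} |
  forall x, mdist o x <= n%:R -> mdist x (f x) < n.+1%:R^-1].
have FG : Filter (filter_from [set: nat] G).
  apply: filter_from_filter; first by exists 0%N.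
  move=> i j _ _; exists (maxn i j) => // f fG; split=> x ox.
    apply: lt_le_trans (fG x _) _.
      by apply: le_trans ox _; rewrite ler_nat leq_maxl.
    by rewrite lef_pV2 ?posrE// ler_nat ltnS leq_maxl.
  apply: lt_le_trans (fG x _) _.
    by apply: le_trans ox _; rewrite ler_nat leq_maxr.
  by rewrite lef_pV2 ?posrE// ler_nat ltnS leq_maxr.
have : filter_from [set: nat] G --> (isometry_fun (isometry_one T) : {compact-open, T -> T}).
  apply/compact_open_cvgP => K O cK oO KO.
  move: cK; rewrite compact_near_coveringP => /(_ nat \oo
    (fun n x => mdist o x <= n%:R /\ forall y, mdist x y < n.+1%:R^-1 -> O y)) cov.
  have FF : Filter (\oo : set_system nat) by typeclasses eauto.
  have [|n _ hn] := cov FF.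
    move=> x Kx; have Ox : nbhs x O.
      by apply: open_nbhs_nbhs; split => //; apply: KO; exists x.
    have [d /= d0 dO] := iffLR (nbhs_ballP x O) Ox.
    have d20 : 0 < d / 2 by lra.
    exists ([set x' | mdist x x' < d / 2],
      [set n | (Num.truncn (mdist o x + d / 2 + (d / 2)^-1) < n)%N]).
      split; first exact: nbhs_mdist.
      by exists (Num.truncn (mdist o x + d / 2 + (d / 2)^-1)).+1.
    move=> [x' n] [/= hx' hn].
    have nb : mdist o x + d / 2 + (d / 2)^-1 < n%:R.
      by apply: lt_le_trans (truncnS_gt _) _; rewrite ler_nat.
    have i0 : 0 < (d / 2)^-1 by rewrite invr_gt0.
    have ox0 := mdist_ge0 o x; have := metric_triangle o x x' => tri.
    split; first lra.
    move=> y hy; apply: dO; rewrite ballEmdist /=.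
    have : n.+1%:R^-1 <= d / 2.
      rewrite -[leRHS]invrK lef_pV2 ?posrE//.
      move: nb i0; set q := (d / 2)^-1; set v := n.+1%:R.
      have -> : v = n%:R + 1 by rewrite /v natr1.
      lra.
    move=> nd; have {}hy := lt_le_trans hy nd.
    by have := metric_triangle x x' y; lra.
  exists n => // f fG y [x Kx <-].
  have [ox xO] := hn n (leqnn n) x Kx.
  by apply: xO; exact: fG.
move=> cvg1; have /cvg1 : nbhs (isometry_fun (isometry_one T) : {compact-open, T -> T}) B.
  by apply: open_nbhs_nbhs.
move=> [n _ GB]; exists n.+1%:R^-1, n%:R; split; first by rewrite invr_gt0.
by move=> f hf; apply: BA => /=; apply: GB.
Qed.

(* An isometry of bounded displacement is determined, up to a small
   neighbourhood of the identity, by its approximate values on a finite net. *)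
Lemma isometry_code (o : T) (C : R) (A : set (selfisometry T)) :
  nbhs (isometry_one T) A -> exists (I : finType) (code : selfisometry T -> I),
  forall f f' : selfisometry T, mdist o (f o) <= C -> mdist o (f' o) <= C -> code f = code f' ->
  A (f^-1 * f')%g.
Proof.
move=> /(@nbhs_isometry_one o)[e [r [e0 hA]]].
have e30 : 0 < e / 3 by lra.
have e60 : 0 < e / 6 by lra.
have [F hF] := @finite_net o r _ e30.
(* f moves o by at most C, so it maps F into the ball of radius C + M, covered by the net N. Equal
   codes make f and f' differ by less than e / 3 + e / 6 + e / 6 + e / 3 on the ball of radius r. *)
pose M := \sum_(z <- F) mdist o z.
have zM z : z \in F -> mdist o z <= M.
  by move=> zF; rewrite /M (big_rem z)//= lerDl sumr_ge0// => i _; exact: mdist_ge0.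
have [N hN] := @finite_net o (C + M) _ e60.
pose I : finType := {ffun 'I_(size F) -> 'I_(size N).+1}.
have ex (f : selfisometry T) : exists c : I, mdist o (f o) <= C ->
    forall i : 'I_(size F), mdist (f (nth o F i)) (nth o N (c i)) < e / 6.
  have [fC|fC] := leP (mdist o (f o)) C; last by exists [ffun=> ord0].
  have ex i : exists j : 'I_(size N).+1, mdist (f (nth o F i)) (nth o N j) < e / 6
      \/ (size F <= i)%N.
    have [iF|iF] := leqP (size F) i; first by exists ord0; right.
    have [|z zN hz] := hN (f (nth o F i)).
      have := metric_triangle o (f o) (f (nth o F i)); rewrite isometry_dist.
      by have := zM _ (mem_nth o iF); lra.
    exists (inord (index z N)); left.
    by rewrite inordK ?nth_index// ltnS index_size.
  have [c hc] := choice ex; exists [ffun i : 'I_(size F) => c i] => _ i.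
  by rewrite ffunE; case: (hc i) => //; rewrite leqNgt ltn_ord.
have [code hcode] := choice ex; exists I, code => f f' fC fC' ff'.
apply: hA => x ox; have [z zF xz] := hF x ox.
have ff'E : f ((f^-1 * f')%g x) = f' x.
  by rewrite -[LHS]/((f * (f^-1 * f'))%g x) mulgA mulgV mul1g.
rewrite -(isometry_dist f) ff'E.
have zi : (index z F < size F)%N by rewrite index_mem.
have := hcode f fC (Ordinal zi); have := hcode f' fC' (Ordinal zi).
rewrite ff' /= nth_index//; set w := nth _ _ _ => h1 h2.
have := metric_triangle (f x) (f z) (f' x).
have := metric_triangle (f z) w (f' x).
have := metric_triangle w (f' z) (f' x).
by rewrite !isometry_dist (metric_sym w (f' z)) (metric_sym z x); lra.
Qed.

End proper_isometries.

Section discrete_groups.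
Context {R : realType} {T1 T2 : metricType R}.
Hypothesis proper1 : forall (o : T1) r, compact (cball o r).
Hypothesis proper2 : forall (o : T2) r, compact (cball o r).
Local Notation X := (hprod T1 T2).
Local Notation G := (selfisometry T1 * selfisometry T2)%type.
Variables (Gamma : set G) (dG : discrete_group Gamma).

Lemma hprod_ge1 (x y : X) : mdist x.1 y.1 <= mdist x y.
Proof.
rewrite -(@ler_pXn2r _ 2) ?nnegrE ?mdist_ge0// hdist_sqr lerDl; exact: sqr_ge0.
Qed.

Lemma hprod_ge2 (x y : X) : mdist x.2 y.2 <= mdist x y.
Proof.
rewrite -(@ler_pXn2r _ 2) ?nnegrE ?mdist_ge0// hdist_sqr lerDr; exact: sqr_ge0.
Qed.

Lemma hprod_le (x y : X) : mdist x y <= mdist x.1 y.1 + mdist x.2 y.2.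
Proof.
rewrite -(@ler_pXn2r _ 2) ?nnegrE ?addr_ge0 ?mdist_ge0// hdist_sqr.
have := mulr_ge0 (mdist_ge0 x.1 y.1) (mdist_ge0 x.2 y.2); lra.
Qed.

Lemma group1 : Gamma 1%g.
Proof. by have [[/set_mem]] := dG. Qed.

Lemma groupDiv g h : Gamma g -> Gamma h -> Gamma (g * h^-1)%g.
Proof.
by move=> /mem_set gG /mem_set hG; have [[_ h0] _] := dG; apply/set_mem/h0.
Qed.

Lemma groupInv g : Gamma g -> Gamma g^-1%g.
Proof. by move=> gG; rewrite -[g^-1%g]mul1g; apply: groupDiv => //; exact: group1. Qed.

Lemma groupMul g h : Gamma g -> Gamma h -> Gamma (g * h)%g.
Proof. by move=> gG hG; rewrite -[h]invgK; apply: groupDiv => //; exact: groupInv. Qed.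

Lemma groupExp g n : Gamma g -> Gamma (g ^+ n)%g.
Proof.
move=> gG; elim: n => [|n IH]; first exact: group1.
by rewrite expgS; exact: groupMul.
Qed.

(** Two elements with equal codes have their quotient in a neighbourhood of 1 that meets Gamma in 1
    only, so the finite set of codes bounds the count. *)
Lemma discrete_count (o : X) (C : R) : exists K : nat, forall s : seq G, uniq s ->
  (forall g, g \in s -> Gamma g /\ mdist o (prod_isometry g o) <= C) ->
  (size s <= K)%N.
Proof.
have [_ /(_ _ group1)] := dG; case=> _ [V [[A1 A2] /= [n1 n2] AV] VG].
have [I1 [c1 h1]] := isometry_code proper1 o.1 C n1.
have [I2 [c2 h2]] := isometry_code proper2 o.2 C n2.
exists #|((I1 * I2)%type : finType)| => s us hs.
have inj : {in s &, injective (fun g : G => (c1 g.1, c2 g.2))}.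
  move=> g g' gs gs' [e1 e2]; have [gG go] := hs g gs; have [gG' go'] := hs g' gs'.
  have a1 : A1 (g.1^-1 * g'.1)%g.
    apply: h1 => //; [exact: le_trans (hprod_ge1 o _) go|].
    exact: le_trans (hprod_ge1 o _) go'.
  have a2 : A2 (g.2^-1 * g'.2)%g.
    apply: h2 => //; [exact: le_trans (hprod_ge2 o _) go|].
    exact: le_trans (hprod_ge2 o _) go'.
  have : [set 1%g] (g^-1 * g')%g.
    rewrite -VG; split; last by apply: groupMul => //; exact: groupInv.
    by apply: AV.
  by move=> /= e; rewrite -[g']mul1g -(mulgV g) -mulgA e mulg1.
rewrite -(size_map (fun g : G => (c1 g.1, c2 g.2))) cardE.
by apply: uniq_leq_size => [|x _]; rewrite ?map_inj_in_uniq// mem_enum.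
Qed.

End discrete_groups.

(** * Busemann functions and products *)

Section busemann_bounds.
Context {R : realType} {T : metricType R}.
Implicit Types (eta : boundary T) (x y : T).

(** The function is nonincreasing and bounded below. Convergence makes the [lim] in [busemann] a
    genuine limit, so that it can be estimated. *)
Lemma cvg_mdist_ray (c : ray T) x : cvg ((mdist x (c t) - t) @[t --> +oo]).
Proof.
pose f t := mdist x (c t) - t.
have dec t u : 0 <= t -> t <= u -> f u <= f t.
  move=> t0 tu; have := metric_triangle x (c t) (c u).
  by rewrite ray_geodesic ?ler0_norm /f; lra.
pose S := [set f t | t in [set t | 0 <= t]].
have hS : has_inf S.
  split; first by exists (f 0), 0 => //=.
  exists (- mdist x (c 0)) => _ [t /= t0 <-].
  have := metric_triangle (c 0) x (c t).
  by rewrite ray_geodesic// (metric_sym _ x) ler0_norm /f; lra.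
apply/cvg_ex; exists (inf S); apply/cvgrPdist_lt => e e0.
have [_ [t /= t0 <-] tS] := inf_adherent e0 hS.
exists t; split; first exact: num_real.
move=> u tu; have ft : f u <= f t by apply: dec => //; exact: ltW.
have fu : inf S <= f u.
  by apply: ge_inf; [case: hS|exists u => //=; lra].
rewrite -/(f u) ler0_norm; lra.
Qed.

Lemma cvg_busemann eta x y :
  cvg ((mdist x ((repr eta : ray T) t) - mdist y ((repr eta : ray T) t))
         @[t --> +oo]).
Proof.
have -> : (fun t => mdist x ((repr eta : ray T) t) - mdist y ((repr eta : ray T) t))
  = (fun t => mdist x ((repr eta : ray T) t) - t)
    - (fun t => mdist y ((repr eta : ray T) t) - t).
  by apply/funext => t; rewrite /= -[RHS]/(_ - _ - (_ - _)); ring.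
exact: is_cvgB (@cvg_mdist_ray (repr eta) x) (@cvg_mdist_ray (repr eta) y).
Qed.

Lemma busemann_le eta x y K : (forall t, 0 <= t ->
  mdist x ((repr eta : ray T) t) - mdist y ((repr eta : ray T) t) <= K) ->
  busemann eta x y <= K.
Proof.
move=> h; apply: limr_le; first exact: cvg_busemann.
by near=> t; apply: h; near: t; exact: nbhs_pinfty_ge.
Unshelve. all: by end_near. Qed.

Lemma busemann_ge eta x y K : (forall t, 0 <= t ->
  K <= mdist x ((repr eta : ray T) t) - mdist y ((repr eta : ray T) t)) ->
  K <= busemann eta x y.
Proof.
move=> h; apply: limr_ge; first exact: cvg_busemann.
by near=> t; apply: h; near: t; exact: nbhs_pinfty_ge.
Unshelve. all: by end_near. Qed.

(** For y = a^-1 o the point f^-1 y is (a f)^-1 o, so this is the exponent by which a f changes an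
    atom. The lower bound is the triangle inequality; only the upper one uses the passing point. *)
Lemma busemann_passes (f : selfisometry T) eta o B :
  0 <= B -> forall y, passes o B y (ray_act f (repr eta)) ->
  `|busemann eta o (f^-1%g y) + mdist o y| <= 2 * B + mdist o (f o).
Proof.
move=> B0 y hp; rewrite ler_norml.
have e t : mdist (f^-1%g y) ((repr eta : ray T) t) =
    mdist y (f ((repr eta : ray T) t)).
  rewrite -(isometry_dist f); congr mdist.
  by rewrite -[LHS]/((f * f^-1)%g y) mulgV.
have fo0 := mdist_ge0 o (f o).
apply/andP; split.
  suff : - (2 * B + mdist o (f o)) - mdist o y <=
    busemann eta o (f^-1%g y) by lra.
  apply: busemann_ge => t t0; rewrite e.
  have := metric_triangle y o (f ((repr eta : ray T) t)).
  have := metric_triangle o (f o) (f ((repr eta : ray T) t)).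
  by rewrite isometry_dist (metric_sym y o); lra.
suff : busemann eta o (f^-1%g y) <= 2 * B + mdist o (f o) - mdist o y by lra.
apply: busemann_le => t t0; rewrite e.
have [m /= <- mo] := hp t t0.
have := metric_triangle (f o) o (f ((repr eta : ray T) t)).
have := metric_triangle o m (f ((repr eta : ray T) t)).
have := metric_triangle o m y.
rewrite isometry_dist (metric_sym (f o) o) (metric_sym o m) (metric_sym m y).
lra.
Qed.

Lemma busemann_near_ray eta o y C t : 0 <= t ->
  mdist y ((repr eta : ray T) t) <= C ->
  `|busemann eta o y - mdist o y| <=
    2 * C + 2 * mdist o ((repr eta : ray T) 0).
Proof.
set c := (repr eta : ray T); move=> t0 yc.
have C0 := le_trans (mdist_ge0 _ _) yc; have o0 := mdist_ge0 o (c 0).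
have y1 := metric_triangle o y (c t).
have y2 := metric_triangle o (c t) y; rewrite (metric_sym (c t)) in y2.
have o1 := metric_triangle o (c 0) (c t).
have o2 := metric_triangle (c 0) o (c t); rewrite (metric_sym (c 0)) in o2.
rewrite !ray_geodesic// sub0r normrN ger0_norm// in o1 o2.
(* The term with [Num.max] accounts for u < t and vanishes in the limit. *)
have h u : 0 <= u -> - (2 * C + 2 * mdist o (c 0)) + mdist o y <=
    mdist o (c u) - mdist y (c u) + 2 * Num.max 0 (t - u) /\
    mdist o (c u) - mdist y (c u) <= mdist o y.
  move=> u0; have := metric_triangle y (c t) (c u).
  have := metric_triangle o y (c u); have := metric_triangle (c 0) o (c u).
  rewrite !ray_geodesic// sub0r normrN ger0_norm// (metric_sym (c 0)).
  have [tu|ut] := leP t u.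
    by rewrite ler0_norm ?subr_le0// max_l; lra.
  by rewrite gtr0_norm ?subr_gt0// max_r; lra.
rewrite ler_norml; apply/andP; split; last first.
  suff : busemann eta o y <= mdist o y by lra.
  by apply: busemann_le => u /h[].
suff : - (2 * C + 2 * mdist o (c 0)) + mdist o y <= busemann eta o y by lra.
apply: limr_ge; first exact: cvg_busemann.
near=> u; have tu : t <= u by near: u; apply: nbhs_pinfty_ge; exact: num_real.
have [|+ _] := h u; first lra.
by rewrite max_l ?subr_le0// mulr0 addr0.
Unshelve. all: by end_near. Qed.

End busemann_bounds.

Section boundary_coordinates.
Context {R : realType} {T1 T2 : metricType R}.
Local Notation X := (hprod T1 T2).
Local Notation G := (selfisometry T1 * selfisometry T2)%type.
Implicit Types (xi : boundary X) (g : G).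

Lemma cos_sin_gt0 (th : R) : 0 < th < pi / 2 -> 0 < cos th /\ 0 < sin th.
Proof.
move=> /andP[t0 t1]; have pi0 := pi_gt0 R; split.
  by apply: cos_gt0_pihalf; apply/andP; split => //; lra.
by apply: sin_gt0_pi; apply/andP; split => //; lra.
Qed.

Lemma bd_coord_act xi eta1 eta2 th g : bd_coord xi eta1 eta2 th ->
  bd_coord (boundary_act (prod_isometry g) xi)
    (boundary_act g.1 eta1) (boundary_act g.2 eta2) th.
Proof.
move=> [c [c1 [c2 [<- <- <- hc]]]].
exists (ray_act (prod_isometry g) c), (ray_act g.1 c1), (ray_act g.2 c2).
split; rewrite ?boundary_act_endpoint// => t t0 /=.
by rewrite hc.
Qed.

Lemma bounded_slope (T : metricType R) (c c' : ray T) (a b C : R) :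
  0 <= a -> 0 <= b ->
  (forall t, 0 <= t -> mdist (c (t * a)) (c' (t * b)) <= C) -> a = b.
Proof.
move=> a0 b0 h; apply/eqP; rewrite -subr_eq0; apply/negPn/negP => ab.
pose K := C + mdist (c 0) (c' 0).
have C0 : 0 <= C by apply: le_trans (h 0 (lexx 0)); exact: mdist_ge0.
have K0 : 0 <= K by rewrite addr_ge0// mdist_ge0.
have n0 : 0 < `|a - b| by rewrite normr_gt0.
pose t := (K + 1) / `|a - b|.
have t0 : 0 <= t by rewrite divr_ge0// addr_ge0.
have tE : t * `|a - b| = K + 1 by rewrite divfK// gt_eqF.
have := h t t0.
have ta : 0 <= t * a by rewrite mulr_ge0.
have tb : 0 <= t * b by rewrite mulr_ge0.
have d1 : mdist (c 0) (c (t * a)) = t * a.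
  by rewrite ray_geodesic// sub0r normrN ger0_norm.
have d2 : mdist (c' 0) (c' (t * b)) = t * b.
  by rewrite ray_geodesic// sub0r normrN ger0_norm.
have := metric_triangle (c 0) (c' 0) (c (t * a)).
have := metric_triangle (c' 0) (c' (t * b)) (c (t * a)).
have := metric_triangle (c' 0) (c 0) (c' (t * b)).
have := metric_triangle (c 0) (c (t * a)) (c' (t * b)).
rewrite d1 d2 (metric_sym (c' (t * b)) (c (t * a))) (metric_sym (c' 0) (c 0)).
have : `|t * a - t * b| = K + 1 by rewrite -mulrBr normrM ger0_norm.
have [ab'|ab'] := leP 0 (t * a - t * b).
  by rewrite ger0_norm// /K; lra.
by rewrite ltr0_norm// /K; lra.
Qed.

Lemma bd_coord_unique xi eta1 eta2 th eta1' eta2' th' :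
  0 < th < pi / 2 -> 0 < th' < pi / 2 ->
  bd_coord xi eta1 eta2 th -> bd_coord xi eta1' eta2' th' ->
  eta1 = eta1' /\ eta2 = eta2'.
Proof.
move=> /cos_sin_gt0[c0 s0] /cos_sin_gt0[c0' s0'].
move=> [c [c1 [c2 [<- <- <- hc]]]] [c' [c1' [c2' [e <- <- hc']]]].
have /asboolP[C hC] : asymptotic c c' by apply/endpoint_eq.
have h1 t : 0 <= t -> mdist (c1 (t * cos th)) (c1' (t * cos th')) <= C.
  move=> t0; apply: le_trans (hC t t0); rewrite hc// hc'//.
  exact: (hprod_ge1 (_, _) (_, _)).
have h2 t : 0 <= t -> mdist (c2 (t * sin th)) (c2' (t * sin th')) <= C.
  move=> t0; apply: le_trans (hC t t0); rewrite hc// hc'//.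
  exact: (hprod_ge2 (_, _) (_, _)).
have ec := bounded_slope (ltW c0) (ltW c0') h1.
have es := bounded_slope (ltW s0) (ltW s0') h2.
split; apply/endpoint_eq/asboolP; exists C => t t0.
  have := h1 (t / cos th); rewrite -ec divfK ?gt_eqF//; apply.
  by rewrite divr_ge0// ltW.
have := h2 (t / sin th); rewrite -es divfK ?gt_eqF//; apply.
by rewrite divr_ge0// ltW.
Qed.

Lemma bd_coord_not0 xi eta1 eta2 th eta1' :
  0 < th < pi / 2 -> bd_coord xi eta1 eta2 th -> ~ bd_coord0 xi eta1'.
Proof.
move=> /cos_sin_gt0[c0 s0].
move=> [c [c1 [c2 [<- _ _ hc]]]] [c' [c1' [x2 [e _ hc']]]].
have /asboolP[C hC] : asymptotic c c' by apply/endpoint_eq.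
suff e0 : sin th = 0 by rewrite e0 ltxx in s0.
(* The constant factor x2 is replaced by the ray c2 run at speed 0. *)
apply: (@bounded_slope _ c2 c2 _ _ (C + mdist x2 (c2 0))) => [|//|t t0].
  exact: ltW.
rewrite mulr0; apply: le_trans (metric_triangle _ x2 _) _.
rewrite lerD2r; apply: le_trans (hC t t0); rewrite hc// hc'//.
exact: (hprod_ge2 (_, _) (_, _)).
Qed.

Lemma bd_coord_not_pihalf xi eta1 eta2 th eta2' :
  0 < th < pi / 2 -> bd_coord xi eta1 eta2 th -> ~ bd_coord_pihalf xi eta2'.
Proof.
move=> /cos_sin_gt0[c0 s0].
move=> [c [c1 [c2 [<- _ _ hc]]]] [c' [x1 [c2' [e _ hc']]]].
have /asboolP[C hC] : asymptotic c c' by apply/endpoint_eq.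
suff e0 : cos th = 0 by rewrite e0 ltxx in c0.
apply: (@bounded_slope _ c1 c1 _ _ (C + mdist x1 (c1 0))) => [|//|t t0].
  exact: ltW.
rewrite mulr0; apply: le_trans (metric_triangle _ x1 _) _.
rewrite lerD2r; apply: le_trans (hC t t0); rewrite hc// hc'//.
exact: (hprod_ge1 (_, _) (_, _)).
Qed.

(* The equality case of the triangle inequality in the plane. *)
Lemma hprod_between (x m y : X) : mdist x m + mdist m y = mdist x y ->
  [/\ mdist x.1 m.1 * mdist x y = mdist x m * mdist x.1 y.1,
      mdist x.2 m.2 * mdist x y = mdist x m * mdist x.2 y.2,
      mdist x.1 y.1 = mdist x.1 m.1 + mdist m.1 y.1 &
      mdist x.2 y.2 = mdist x.2 m.2 + mdist m.2 y.2].
Proof.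
move=> e; have e2 : mdist m y = mdist x y - mdist x m by lra.
have r0 := mdist_ge0 x m; have rD : mdist x m <= mdist x y.
  by have := mdist_ge0 m y; lra.
have := hdist_sqr x m; have := hdist_sqr m y; have := hdist_sqr x y.
rewrite e2; move: (mdist x m) r0 rD {e e2} => r r0 rD.
have t1 := metric_triangle x.1 m.1 y.1.
have t2 := metric_triangle x.2 m.2 y.2.
have a10 := mdist_ge0 x.1 m.1; have a20 := mdist_ge0 x.2 m.2.
have b10 := mdist_ge0 m.1 y.1; have b20 := mdist_ge0 m.2 y.2.
have c10 := mdist_ge0 x.1 y.1; have c20 := mdist_ge0 x.2 y.2.
move: t1 t2 a10 a20 b10 b20 c10 c20.
set a1 := mdist x.1 m.1; set a2 := mdist x.2 m.2.
set b1 := mdist m.1 y.1; set b2 := mdist m.2 y.2.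
set s1 := mdist x.1 y.1; set s2 := mdist x.2 y.2; set D := mdist x y in rD *.
move=> t1 t2 a10 a20 b10 b20 c10 c20 hD hb ha.
have q1 : s1 ^+ 2 <= (a1 + b1) ^+ 2 by rewrite ler_pXn2r ?nnegrE ?addr_ge0.
have q2 : s2 ^+ 2 <= (a2 + b2) ^+ 2 by rewrite ler_pXn2r ?nnegrE ?addr_ge0.
have i1 : r * (D - r) <= a1 * b1 + a2 * b2 by lra.
(* The vectors (a1, a2) and (b1, b2) have lengths r and D - r; equality forces them to be
   proportional. *)
have sq : ((D - r) * a1 - r * b1) ^+ 2 + ((D - r) * a2 - r * b2) ^+ 2 =
   2 * (r * (D - r)) * (r * (D - r) - (a1 * b1 + a2 * b2)).
  transitivity ((D - r) ^+ 2 * (a1 ^+ 2 + a2 ^+ 2) + r ^+ 2 * (b1 ^+ 2 + b2 ^+ 2)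
    - 2 * (r * (D - r)) * (a1 * b1 + a2 * b2)); first by ring.
  by rewrite -ha -hb; ring.
have rDr : 0 <= r * (D - r) by rewrite mulr_ge0// subr_ge0.
have neg : 2 * (r * (D - r)) * (r * (D - r) - (a1 * b1 + a2 * b2)) <= 0.
  by apply: mulr_ge0_le0; [exact: mulr_ge0|rewrite subr_le0].
have z1 : (D - r) * a1 - r * b1 = 0.
  apply/eqP; rewrite -sqrf_eq0 eq_le sqr_ge0 andbT.
  by have := sqr_ge0 ((D - r) * a2 - r * b2); lra.
have z2 : (D - r) * a2 - r * b2 = 0.
  apply/eqP; rewrite -sqrf_eq0 eq_le sqr_ge0 andbT.
  by have := sqr_ge0 ((D - r) * a1 - r * b1); lra.
have i2 : a1 * b1 + a2 * b2 <= r * (D - r).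
  have := sqr_ge0 (a1 * b2 - a2 * b1) => L.
  rewrite -(@ler_pXn2r _ 2) ?nnegrE ?addr_ge0 ?mulr_ge0//; last lra.
  by rewrite exprMn ha hb; lra.
have p1 : s1 ^+ 2 = (a1 + b1) ^+ 2 by lra.
have p2 : s2 ^+ 2 = (a2 + b2) ^+ 2 by lra.
have f1 : s1 = a1 + b1 by apply/eqP; rewrite -(@eqrXn2 _ 2)// ?addr_ge0// p1.
have f2 : s2 = a2 + b2 by apply/eqP; rewrite -(@eqrXn2 _ 2)// ?addr_ge0// p2.
by split => //; rewrite ?f1 ?f2; lra.
Qed.

Lemma hprod_btw l (x m y : X) : btw l x m y ->
  btw l x.1 m.1 y.1 /\ btw l x.2 m.2 y.2.
Proof.
move=> [h1 h2]; have e : mdist x m + mdist m y = mdist x y by rewrite h1 h2; ring.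
have [D0|D0] := eqVneq (mdist x y) 0.
  rewrite D0 !mulr0 in h1 h2.
  rewrite -(mdist_positivity _ _ h2) -(mdist_positivity _ _ h1).
  by split; split; rewrite !mdistxx mulr0.
have [f1 f2 g1 g2] := hprod_between e; rewrite h1 in f1 f2.
have k1 : mdist x.1 m.1 = l * mdist x.1 y.1 by apply: (mulIf D0); rewrite f1; ring.
have k2 : mdist x.2 m.2 = l * mdist x.2 y.2 by apply: (mulIf D0); rewrite f2; ring.
by split; split => //; lra.
Qed.

(** This makes rays of the product with common origin and end point equal, hence points of its
    boundary closed and Borel. *)
Lemma hprod_cn : @cn_ineq R T1 -> @cn_ineq R T2 -> @cn_ineq R X.
Proof.
move=> cn1 cn2 l x m y z l01 /hprod_btw[b1 b2].
rewrite !hdist_sqr; have := cn1 l _ _ _ z.1 l01 b1.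
by have := cn2 l _ _ _ z.2 l01 b2; lra.
Qed.

Lemma hprod_geodesic_slope (c : R -> X) (x y : X) r :
  geodesic_segment c x y -> 0 <= r <= mdist x y ->
  mdist x.1 (c r).1 * mdist x y = r * mdist x.1 y.1 /\
  mdist x.2 (c r).2 * mdist x y = r * mdist x.2 y.2.
Proof.
move=> [c0 c1 cd] hr.
have d0 : 0 <= (0 : R) <= mdist x y by rewrite lexx/= mdist_ge0.
have dD : 0 <= mdist x y <= mdist x y by rewrite lexx mdist_ge0.
have e1 : mdist x (c r) = r by rewrite -[in LHS]c0 cd// sub0r normrN ger0_norm; lra.
have e2 : mdist (c r) y = mdist x y - r.
  by rewrite -[in LHS]c1 cd// ler0_norm; lra.
rewrite -[X in X * mdist x.1 y.1]e1 -[X in X * mdist x.2 y.2]e1.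
have [|//] := @hprod_between x (c r) y; rewrite e1 e2; lra.
Qed.

End boundary_coordinates.

(** * Multiplicity of orbit points *)

Section orbit_near_segment.
Context {R : realType} {T : metricType R}.
Hypotheses (geo : geodesic_space T) (cn : @cn_ineq R T).

(** All rays f (c) end at xi, so far out one geodesic from o stands for all of them. Each f o is
    near the geodesic to its own ray at a time at most n + B, hence near an integer time of the
    common one. *)
Lemma near_segment (o : T) (B n : R) (s : seq (selfisometry T))
    (phi : selfisometry T) (zeta xi : boundary T) :
  (forall f, f \in s -> [/\ mdist o (f o) <= n,
     boundary_act f (boundary_act phi zeta) = xi &
     passes o B (f^-1%g o) (ray_act phi (repr zeta))]) ->
  exists q : nat -> T, forall f, f \in s ->
    exists2 j, (j < (Num.truncn (n + B + 1)).+1)%N &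
      mdist (f o) (q j) <= B + 2.
Proof.
case: s => [|f0 s0 hs]; first by exists (fun=> o).
set s := f0 :: s0 in hs *; pose c : ray T := ray_act phi (repr zeta).
pose w (f : selfisometry T) t := f (c t).
have [n0 e0 p0] := hs f0 (mem_head _ _).
have nB : 0 <= n by apply: le_trans n0; exact: mdist_ge0.
have B0 : 0 <= B.
  by have [m _ mB] := p0 0 (lexx 0); apply: le_trans mB; exact: mdist_ge0.
have exC (f : selfisometry T) : exists C, f \in s ->
    forall t, 0 <= t -> mdist (w f t) (w f0 t) <= C.
  have [fs|] := boolP (f \in s); last by exists 0.
  have [_ ef _] := hs f fs.
  have /endpoint_eq/asboolP[C hC] :
      endpoint (ray_act f c) = endpoint (ray_act f0 c).
    by rewrite -!boundary_act_endpoint !endpoint_repr ef.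
  by exists C => _; exact: hC.
have [Cf hCf] := choice exC.
pose C := \sum_(f <- s) `|Cf f|.
have C0 : 0 <= C by rewrite sumr_ge0.
have hC f t : f \in s -> 0 <= t -> mdist (w f t) (w f0 t) <= C.
  move=> fs t0; apply: le_trans (hCf f fs t t0) _; apply: le_trans (ler_norm _) _.
  by rewrite /C (big_rem f)//= lerDl sumr_ge0.
pose E := mdist o (c 0).
(* So large that at the fraction l of the way, where f o is passed, the geodesics to [w f t] and
   [w f0 t] are at most l * C <= 1 apart. Rounding to an integer time costs another 1. *)
pose t := n + E + (n + B) * C + (n + B) + 1.
have E0 : 0 <= E by exact: mdist_ge0.
have nBC : 0 <= (n + B) * C by rewrite mulr_ge0// addr_ge0.
have t0 : 0 <= t by rewrite /t; lra.
have [cs [cs0 cs1 csd]] := geo o (w f0 t).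
exists (fun j => cs j%:R) => f fs.
have [fn ef pf] := hs f fs; have [m hm mB] := pf t t0.
pose m' := f m; have e1 : mdist o m' = mdist (f^-1%g o) m.
  rewrite -(isometry_dist f (f^-1%g o)); congr mdist.
  by rewrite -[RHS]/((f * f^-1)%g o) mulgV.
have e2 : mdist m' (w f t) = mdist m (c t) by rewrite isometry_dist.
have e3 : mdist o (w f t) = mdist (f^-1%g o) (c t).
  rewrite -(isometry_dist f (f^-1%g o)); congr mdist.
  by rewrite -[RHS]/((f * f^-1)%g o) mulgV.
rewrite -/c -e1 -e2 -e3 in hm.
have m'o : mdist m' (f o) <= B by rewrite isometry_dist.
have om' : mdist o m' <= n + B.
  have := metric_triangle o (f o) m'; rewrite (metric_sym (f o)); lra.
have L : (n + B) * C + (n + B) + 1 <= mdist o (w f t).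
  have := metric_triangle (f (c 0)) o (w f t).
  rewrite isometry_dist ray_geodesic// sub0r normrN ger0_norm//.
  have := metric_triangle o (f o) (f (c 0)); rewrite isometry_dist -/E.
  by rewrite (metric_sym (f (c 0)) o) /t; lra.
have L0 : 0 < mdist o (w f t) by lra.
pose l := mdist o m' / mdist o (w f t).
have lE : l * mdist o (w f t) = mdist o m' by rewrite divfK// gt_eqF.
have om0 := mdist_ge0 o m'.
have l01 : 0 <= l <= 1 by rewrite divr_ge0 ?mdist_ge0//= ler_pdivrMr// mul1r; lra.
have bm : btw l o m' (w f t) by split; rewrite ?mulrBl ?mul1r lE//; lra.
have ow0 := mdist_ge0 o (w f0 t).
have [l0 l1] := andP l01.
have lw0 : 0 <= l * mdist o (w f0 t) by rewrite mulr_ge0.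
have lw1 : l * mdist o (w f0 t) <= mdist o (w f0 t) by rewrite ler_piMl.
pose m2 := cs (l * mdist o (w f0 t)).
have d00 : 0 <= (0 : R) <= mdist o (w f0 t) by rewrite lexx.
have d11 : 0 <= mdist o (w f0 t) <= mdist o (w f0 t) by rewrite lexx andbT.
have dl : 0 <= l * mdist o (w f0 t) <= mdist o (w f0 t) by rewrite lw0.
have om2 : mdist o m2 = l * mdist o (w f0 t).
  by rewrite -[in LHS]cs0 csd// sub0r normrN ger0_norm.
have bm2 : btw l o m2 (w f0 t).
  split => //; rewrite -[in LHS]cs1 csd// ler0_norm; lra.
have mm2 : mdist m' m2 <= 1.
  apply: le_trans (btw_convex1 cn l01 bm bm2) _.
  have lL : l * ((n + B) * C + (n + B) + 1) <= n + B.
    by apply: le_trans om'; rewrite -lE ler_wpM2l.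
  have hCt := ler_wpM2l l0 (hC f t fs t0); apply: (le_trans hCt).
  have [nB0|nB0] : n + B = 0 \/ 0 < n + B.
    have : 0 <= n + B by rewrite addr_ge0.
    by rewrite le_eqVlt => /orP[/eqP|]; [left|right].
    have o0 : mdist o m' = 0 by lra.
    by rewrite /l o0 !mul0r.
  rewrite -(ler_pM2l nB0) mulr1; have := mulr_ge0 l0 (ltW nB0); lra.
have u1 : l * mdist o (w f0 t) <= n + B + 1.
  have := metric_triangle o m' m2; lra.
exists (Num.truncn (l * mdist o (w f0 t))).
  by rewrite ltnS; exact: le_truncn.
have j1 : (Num.truncn (l * mdist o (w f0 t)))%:R <= l * mdist o (w f0 t).
  by rewrite truncn_le.
have j2 := truncnS_gt (l * mdist o (w f0 t)); rewrite -natr1 in j2.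
have dj : 0 <= ((Num.truncn (l * mdist o (w f0 t)))%:R : R) <= mdist o (w f0 t).
  by rewrite ler0n/=; lra.
have := metric_triangle (f o) m' (cs (Num.truncn (l * mdist o (w f0 t)))%:R).
have := metric_triangle m' m2 (cs (Num.truncn (l * mdist o (w f0 t)))%:R).
rewrite csd// ger0_norm ?subr_ge0// (metric_sym (f o) m'); lra.
Qed.

End orbit_near_segment.

Section orbit_multiplicity.
Context {R : realType} {T1 T2 : metricType R}.
Hypotheses (geo1 : geodesic_space T1) (cn1 : @cn_ineq R T1).
Hypotheses (geo2 : geodesic_space T2) (cn2 : @cn_ineq R T2).
Hypothesis proper1 : forall (o : T1) r, compact (cball o r).
Hypothesis proper2 : forall (o : T2) r, compact (cball o r).
Local Notation X := (hprod T1 T2).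
Local Notation G := (selfisometry T1 * selfisometry T2)%type.
Variables (Gamma : set G) (dG : discrete_group Gamma).

Lemma prod_isometryM (g h : G) (x : X) :
  prod_isometry (g * h)%g x = prod_isometry g (prod_isometry h x).
Proof. by []. Qed.

Lemma prod_isometryV (g : G) (x : X) :
  prod_isometry g (prod_isometry g^-1%g x) = x.
Proof. by rewrite -prod_isometryM mulgV; case: x. Qed.

Lemma orbit_count_ball (o : X) (C : R) : exists K : nat, forall (s : seq G) (p : X),
  uniq s ->
  (forall g, g \in s -> Gamma g /\ mdist (prod_isometry g o) p <= C) ->
  (size s <= K)%N.
Proof.
have [K hK] := discrete_count proper1 proper2 dG o (2 * C); exists K => s p us hs.
case: s us hs => [//|g0 s'] us hs; set s := g0 :: s' in us hs *.
have [G0 h0] := hs g0 (mem_head _ _).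
rewrite -(size_map (fun g : G => g0^-1 * g)%g); apply: hK.
  by rewrite map_inj_uniq//; exact: mulgI.
move=> _ /mapP[g gs ->]; have [Gg hg] := hs g gs; split.
  by apply: groupMul => //; exact: groupInv.
rewrite -(isometry_dist (prod_isometry g0)) prod_isometryM prod_isometryV.
have := metric_triangle (prod_isometry g0 o) p (prod_isometry g o).
by rewrite (metric_sym p); lra.
Qed.

(** [near_segment] in both factors places the orbit points near N^2 points of the product, and
    discreteness bounds the number near each. *)
Lemma orbit_multiplicity (o : X) (B : R) : exists K : nat,
  forall (n : R) (s : seq G) (phi : G) (zeta1 xi1 : boundary T1)
    (zeta2 xi2 : boundary T2),
  uniq s ->
  (forall g, g \in s -> Gamma g /\ [/\ mdist o (prod_isometry g o) <= n,
     boundary_act g.1 (boundary_act phi.1 zeta1) = xi1,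
     boundary_act g.2 (boundary_act phi.2 zeta2) = xi2,
     passes o.1 B (g.1^-1%g o.1) (ray_act phi.1 (repr zeta1)) &
     passes o.2 B (g.2^-1%g o.2) (ray_act phi.2 (repr zeta2))]) ->
  (size s <= (Num.truncn (n + B + 1)).+1 ^ 2 * K)%N.
Proof.
have [K hK] := orbit_count_ball o (2 * (B + 2)); exists K.
move=> n s phi zeta1 xi1 zeta2 xi2 us hs.
have [|q1 hq1] := @near_segment _ _ geo1 cn1 o.1 B n (map fst s) phi.1 zeta1 xi1.
  move=> _ /mapP[g /hs[_ [gn e1 _ p1 _]] ->]; split => //.
  exact: le_trans (hprod_ge1 o _) gn.
have [|q2 hq2] := @near_segment _ _ geo2 cn2 o.2 B n (map snd s) phi.2 zeta2 xi2.
  move=> _ /mapP[g /hs[_ [gn _ e2 _ p2]] ->]; split => //.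
  exact: le_trans (hprod_ge2 o _) gn.
set N := (Num.truncn (n + B + 1)).+1 in hq1 hq2 *.
have ex (g : G) : exists j : 'I_N * 'I_N, g \in s ->
    mdist (prod_isometry g o) ((q1 j.1, q2 j.2) : X) <= 2 * (B + 2).
  have [gs|] := boolP (g \in s); last by exists (ord0, ord0).
  have [j1 j1N h1] := hq1 g.1 (map_f _ gs); have [j2 j2N h2] := hq2 g.2 (map_f _ gs).
  exists (Ordinal j1N, Ordinal j2N) => _.
  by apply: le_trans (hprod_le _ _) _; rewrite /=; lra.
have [j hj] := choice ex.
have -> : (N ^ 2 = size (enum {: 'I_N * 'I_N}))%N.
  by rewrite -cardE card_prod card_ord.
apply: (@leq_size_fibers _ _ j) => [g _|i _]; first by rewrite mem_enum.
rewrite -size_filter; apply: (hK _ (q1 i.1, q2 i.2)); first exact: filter_uniq.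
move=> g; rewrite mem_filter => /andP[/eqP ji gs]; have [Gg _] := hs g gs.
by split => //; have := hj g gs; rewrite ji.
Qed.

End orbit_multiplicity.

(** * Atoms *)

Section cone_topology.
Context {R : realType} {T : metricType R}.

Lemma cone_nbhd_open (c : ray T) r e : 0 < r -> 0 < e ->
  open (cone_nbhd c r e : set (bordification T)).
Proof.
move=> r0 e0; exists [set cone_nbhd c r e]; last by rewrite bigcup_set1.
by move=> _ ->; apply: (@finI_from1 _ _ _ id); right; exists c, r, e.
Qed.

Lemma cone_nbhd_endpoint (c : ray T) r e : 0 < e ->
  cone_nbhd c r e (inr (endpoint c)).
Proof. by move=> e0; exists c; rewrite mdistxx. Qed.

Hypotheses (geo : geodesic_space T) (cn : @cn_ineq R T).

Lemma ray_unique (c c' : ray T) : c 0 = c' 0 -> asymptotic c c' ->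
  forall r, 0 <= r -> c r = c' r.
Proof.
move=> e0 /asboolP[C hC] r r0; apply/mdist_positivity/eqP.
rewrite eq_le mdist_ge0 andbT.
apply/ler_addgt0Pr => e e_gt0; rewrite add0r.
have C0 := le_trans (mdist_ge0 _ _) (hC 0 (lexx 0)).
pose t := Num.max (r + 1) (r * C / e).
have t1 : r + 1 <= t by rewrite le_max lexx.
have t2 : r * C / e <= t by rewrite le_max lexx orbT.
have t0 : 0 < t by lra.
have l01 : 0 <= r / t <= 1 by rewrite divr_ge0 ?(ltW t0)//= ler_pdivrMr// mul1r; lra.
have rt : r / t * t = r by rewrite divfK ?gt_eqF.
have b (a : ray T) : btw (r / t) (a 0) (a r) (a t).
  split; rewrite !ray_geodesic//; try lra.
    by rewrite !sub0r !normrN !ger0_norm ?rt//; lra.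
  by rewrite sub0r normrN (ger0_norm (ltW t0)) ler0_norm; lra.
have b' := b c'; rewrite -e0 in b'.
apply: le_trans (btw_convex1 cn l01 (b c) b') _.
apply: (@le_trans _ _ (r / t * C)).
  by apply: ler_wpM2l; [case/andP: l01|apply: hC; lra].
by rewrite mulrAC ler_pdivrMr// [e * t]mulrC -ler_pdivrMr.
Qed.

Lemma boundary_set1_closed (eta : boundary T) : open (~` [set eta]).
Proof.
rewrite openE => xi /= xe.
have nb (V : set (bordification T)) : open V -> V (inr xi) -> ~ V (inr eta) ->
    nbhs xi (~` [set eta]).
  move=> oV Vx Ve; rewrite nbhsE.
  exists (inr @^-1` V); first by split => //; exists V.
  by move=> z /= Vz ze; apply: Ve; rewrite -ze.
have [c cx] : exists c : ray T, endpoint c = xi by exists (repr xi); rewrite endpoint_repr.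
have [[g [ge g0]]|ng] := pselect (exists g : ray T, endpoint g = eta /\ g 0 = c 0).
  have [r [r0 cg]] : exists r, 0 <= r /\ c r <> g r.
    apply: contrapT => h; apply: xe; rewrite -cx -ge; apply/endpoint_eq/asboolP.
    exists 0 => t t0; suff -> : c t = g t by rewrite mdistxx.
    by apply: contrapT => ne; apply: h; exists t.
  have d0 : 0 < mdist (g r) (c r) by rewrite mdist_gt0; apply/eqP => e; exact: cg.
  have r_gt0 : 0 < r.
    by rewrite lt_neqAle r0 andbT; apply/eqP => e; apply: cg; rewrite -e g0.
  apply: (nb _ (cone_nbhd_open c r_gt0 d0)).
    by rewrite -cx; exact: cone_nbhd_endpoint.
  move=> [g' [g'e g'0 lt]].
  have : g' r = g r.
    apply: ray_unique r0; first by rewrite g'0.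
    by apply/endpoint_eq; rewrite g'e.
  by move=> e; rewrite e ltxx in lt.
(* If no ray from c 0 ends at eta, no cone neighbourhood along c contains eta, so the constants 1
   are arbitrary. *)
apply: (nb _ (cone_nbhd_open c (@ltr01 R) (@ltr01 R))).
  by rewrite -cx; exact: cone_nbhd_endpoint.
by move=> [g [ge g0 _]]; apply: ng; exists g.
Qed.

Lemma measurable_boundary_set1 (xi0 eta : boundary T) :
  measurable ([set eta] : set (borel_boundary xi0)).
Proof.
rewrite -[X in measurable X]setCK; apply: measurableC.
by apply: sub_sigma_algebra; exact: boundary_set1_closed.
Qed.

End cone_topology.

Section atoms.
Context {R : realType} {T1 T2 : metricType R}.
Hypotheses (geo1 : geodesic_space T1) (cn1 : @cn_ineq R T1).
Hypotheses (geo2 : geodesic_space T2) (cn2 : @cn_ineq R T2).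
Local Notation X := (hprod T1 T2).
Local Notation G := (selfisometry T1 * selfisometry T2)%type.
Variables (Gamma : set G) (o : X) (b : R * R) (theta : R) (xi0 : boundary X).
Variable mu : X -> {finite_measure set (borel_boundary xi0) -> \bar R}.
Hypothesis dmu : invariant_density Gamma o b theta mu.
Hypothesis mset1 : forall xi, measurable ([set xi] : set (borel_boundary xi0)).

Definition atom_mass (x : X) (xi : boundary X) : R := fine (mu x [set xi]).

Lemma atom_massE x xi : mu x [set xi] = (atom_mass x xi)%:E.
Proof. by rewrite fineK// fin_num_measure. Qed.

Lemma atom_mass_ge0 x xi : 0 <= atom_mass x xi.
Proof. by rewrite fine_ge0// measure_ge0. Qed.

Lemma boundary_act_preimage1 (g : selfisometry X) (zeta : boundary X) :
  boundary_act g @^-1` [set boundary_act g zeta] = [set zeta].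
Proof.
apply/seteqP; split => [xi /= e|xi -> //].
have := congr1 (boundary_act g^-1%g) e.
by rewrite -!boundary_actM mulVg !boundary_act1.
Qed.

Lemma atom_coord eta : 0 < atom_mass o eta -> exists eta1 eta2,
  msupport (mu o) eta /\ bd_coord eta eta1 eta2 theta.
Proof.
move=> a0; have supp : msupport (mu o) eta.
  move=> U oU Ue; have mU : measurable (U : set (borel_boundary xi0)).
    exact: sub_sigma_algebra.
  apply: lt_le_trans (_ : (mu o [set eta] <= mu o U)%E).
    by rewrite atom_massE lte_fin.
  by apply: le_measure; rewrite ?inE// => _ ->.
have [_ /(_ o)[[_ h] _ _]] := dmu.
by have [_ [eta1 [eta2 he]]] := h _ supp; exists eta1, eta2.
Qed.

Lemma atom_density x eta eta1 eta2 : 0 < atom_mass o eta ->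
  bd_coord eta eta1 eta2 theta ->
  atom_mass x eta = expR (b.1 * busemann eta1 o.1 x.1 +
                          b.2 * busemann eta2 o.2 x.2) * atom_mass o eta.
Proof.
move=> a0 he; have [_ [_ [supp _]]] := atom_coord a0.
have [_ /(_ x)[_ _ [f [_ _ RN] fE]]] := dmu.
apply/EFin_inj; rewrite -atom_massE EFinM -atom_massE RN// -(fE _ _ _ supp he).
rewrite -(integral_cst (mu o) (mset1 eta)).
by apply: eq_integral => xi /set_mem ->.
Qed.

(** Invariance at the point g^-1 o moves the base point instead of the atom. *)
Lemma atom_transport (g : G) eta eta1 eta2 : Gamma g^-1%g -> Gamma g ->
  0 < atom_mass o eta -> bd_coord eta eta1 eta2 theta ->
  atom_mass o (boundary_act (prod_isometry g) eta) =
    expR (b.1 * busemann eta1 o.1 (g.1^-1%g o.1) +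
          b.2 * busemann eta2 o.2 (g.2^-1%g o.2)) * atom_mass o eta.
Proof.
move=> Gg' Gg a0 he; rewrite -(atom_density (prod_isometry g^-1%g o) a0 he).
have [_ /(_ (prod_isometry g^-1%g o))[_ inv _]] := dmu.
rewrite /atom_mass; congr fine.
rewrite -(boundary_act_preimage1 (prod_isometry g) eta) inv//; last exact: mset1.
have e y E : y = o -> mu o E = mu y E by move=> ->.
by apply: e; exact: prod_isometryV.
Qed.

Lemma atom_count (r : seq (boundary X)) (w : R) : uniq r ->
  (forall xi, xi \in r -> w <= atom_mass o xi) ->
  (size r)%:R * w <= fine (mu o setT).
Proof.
move=> ur hw; rewrite -lee_fin fineK ?fin_num_measure//.
have step : measurable ([set` r] : set (borel_boundary xi0)) /\
    (((size r)%:R * w)%:E <= mu o [set` r])%E.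
  elim: r ur hw => [_ _|xi r IH /= /andP[xr ur] hw].
    by rewrite mul0r set_nil measure0.
  have [|mr hr] := IH ur; first by move=> z zr; apply: hw; rewrite inE zr orbT.
  have -> : [set` xi :: r] = [set xi] `|` [set` r].
    apply/seteqP; split => z /=; rewrite inE.
      by case/orP => [/eqP|]; [left|right].
    by case=> [->|->]; rewrite ?eqxx ?orbT.
  split; first exact: measurableU.
  rewrite measureU//; last first.
    by apply/seteqP; split => z //= [-> zr]; rewrite zr in xr.
  rewrite -natr1 mulrDl mul1r addrC EFinD leeD//.
  apply: (@le_trans _ _ (atom_mass o xi)%:E); last by rewrite -atom_massE.
  by rewrite lee_fin; apply: hw; exact: mem_head.
case: step => mr /le_trans; apply.
by apply: le_measure; rewrite ?inE.
Qed.

End atoms.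

(** * Growth of orbits *)

Lemma counting_le (R : realType) (T : choiceType) (A : set T) (K : R) : 0 <= K ->
  (forall s : seq T, uniq s -> (forall x, x \in s -> A x) -> (size s)%:R <= K) ->
  (counting A <= K%:E :> \bar R)%E.
Proof.
move=> K0 h; rewrite /counting; case: asboolP => [fA|iA].
  rewrite lee_fin; apply: h => [|x]; first exact: finmap.fset_uniq.
  by rewrite in_fset_set// => /set_mem.
have [B BA hB] := infinite_set_fset (Num.truncn K).+1 iA.
have : (size (finmap.enum_fset B))%:R <= K.
  by apply: h => [|x xB]; [exact: finmap.fset_uniq|exact: BA].
rewrite leNgt => /negP; case; apply: lt_le_trans (truncnS_gt _) _.
by rewrite ler_nat.
Qed.

Lemma growth_exponent_gt0 (R : realType) (T1 T2 : metricType R) Gamma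
    (o : hprod T1 T2) theta : (0 < growth_exponent Gamma o theta)%E ->
  exists2 del : R, 0 < del & forall e0, 0 < e0 -> exists e, 0 < e < e0 /\
    forall n0, exists2 n, (n0 <= n)%N &
      ((expR (del * n%:R))%:E < orbit_count Gamma o theta e n)%E.
Proof.
rewrite /growth_exponent limf_einfE => /ereal_sup_gt[_ [V V0 <-]].
set I := ereal_inf _ => I0.
have [del [del0 delI]] : exists del : R, 0 < del /\ (del%:E < I)%E.
  case: I I0 => [r| |//]; last by move=> _; exists 1; split => //; rewrite ltry.
  by rewrite lte_fin => r0; exists (r / 2); rewrite lte_fin; split; lra.
exists del => // e0 e00.
have [e [/= Ve]] : exists e, V e /\ 0 < e < e0.
  have := filter_ex (filterI V0 (filterI (@nbhs_right_gt R 0) (nbhs_right_lt e00))).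
  by case=> e [/= Ve [h1 h2]]; exists e; rewrite h1.
move=> he; exists e; split => // n0.
have : (del%:E < limn_esup (fun n =>
    ((n%:R^-1)%:E * lne (orbit_count Gamma o theta e n))%E))%E.
  by apply: lt_le_trans delI _; apply: ereal_inf_lbound; exists e.
rewrite /limn_esup limf_esupE => lt.
(* The tail starts at n0.+1, so that n > 0 and the factor 1 / n can be cleared. *)
have : (del%:E < ereal_sup ((fun n =>
    ((n%:R^-1)%:E * lne (orbit_count Gamma o theta e n))%E) @`
    [set n | (n0.+1 <= n)%N]))%E.
  apply: lt_le_trans lt _; apply: ereal_inf_lbound.
  by exists [set n | (n0.+1 <= n)%N] => //; exists n0.+1.
move=> /ereal_sup_gt[_ [n /= nn0 <-]] hn; exists n; first exact: ltnW.
have n_gt0 : 0 < n%:R :> R by rewrite ltr0n (leq_trans _ nn0).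
move: hn; rewrite lte_pdivlMl// -EFinM mulrC.
case: (orbit_count _ _ _ _ _) => [c|_|] /=; [|by rewrite ltry|by rewrite ltNge leNye].
case: (leP c 0) => // c0; rewrite lte_fin => hc.
by rewrite lte_fin -[ltRHS]lnK ?posrE// ltr_expR.
Qed.

(** exp (del n) >= (1 + del n / 4)^4 is of order n^4, against the quadratic left-hand side. *)
Lemma expR_gt_square (R : realType) (del C B : R) : 0 < del -> 0 <= C -> 0 <= B ->
  exists n0, forall n, (n0 <= n)%N ->
    C * ((Num.truncn (n%:R + B + 1)).+1 ^ 2)%:R <= expR (del * n%:R).
Proof.
move=> del0 C0 B0; pose c := Num.min 1 (del / 4).
have d40 : 0 < del / 4 by lra.
have c0 : 0 < c by rewrite lt_min ltr01.
have c1 : c <= 1 by rewrite ge_min lexx.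
have cd : c <= del / 4 by rewrite ge_min lexx orbT.
pose D := C * (B + 2) ^+ 2 / c ^+ 4.
have c40 : 0 < c ^+ 4 by rewrite exprn_gt0.
exists (Num.truncn D).+1 => n hn.
have nD : D <= n%:R.
  by apply: ltW; apply: lt_le_trans (truncnS_gt _) _; rewrite ler_nat.
have n0 : 0 <= n%:R :> R by exact: ler0n.
have t1 : (Num.truncn (n%:R + B + 1)).+1%:R <= (B + 2) * (n%:R + 1).
  have : (Num.truncn (n%:R + B + 1))%:R <= n%:R + B + 1.
    by rewrite truncn_le !addr_ge0.
  by rewrite -[_.+1%:R]natr1; have := mulr_ge0 B0 n0; lra.
rewrite natrX.
apply: (@le_trans _ _ (C * ((B + 2) * (n%:R + 1)) ^+ 2)).
  by apply: ler_wpM2l => //; rewrite ler_pXn2r ?nnegrE// mulr_ge0// addr_ge0.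
apply: (@le_trans _ _ (c ^+ 4 * (n%:R + 1) ^+ 4)).
  have : C * (B + 2) ^+ 2 <= c ^+ 4 * n%:R by rewrite [leRHS]mulrC -ler_pdivrMr.
  have sq : 0 <= (n%:R + 1) ^+ 2 :> R by exact: sqr_ge0.
  move=> /(ler_wpM2r sq) h; rewrite exprMn mulrA; apply: (le_trans h).
  rewrite -mulrA ler_pM2l//.
  have -> : (n%:R + 1) ^+ 4 = (n%:R + 1) ^+ 2 * (n%:R + 1) ^+ 2 :> R by ring.
  by rewrite ler_wpM2r//; have := sqr_ge0 (n%:R : R); lra.
rewrite -exprMn.
have -> : del * n%:R = 4%:R * (del / 4 * n%:R) by field.
rewrite expRM_natl ler_pXn2r ?nnegrE ?expR_ge0//; last first.
  by rewrite mulr_ge0 ?addr_ge0// ltW.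
apply: le_trans (expR_ge1Dx _); have := ler_wpM2r n0 cd; lra.
Qed.

Section displacement.
Context {R : realType} {T1 T2 : metricType R}.
Local Notation X := (hprod T1 T2).

Lemma displacement_polar (o : X) (g : selfisometry T1 * selfisometry T2) :
  let d := mdist o (prod_isometry g o) in let phi := displacement_slope o g in
  mdist o.1 (g.1 o.1) = d * cos phi /\ mdist o.2 (g.2 o.2) = d * sin phi.
Proof.
rewrite /displacement_slope.
have e := hdist_sqr o (prod_isometry g o); rewrite /= in e.
have d0 := mdist_ge0 o (prod_isometry g o).
move: e d0; set D := mdist o _; set d1 := mdist o.1 _; set d2 := mdist o.2 _.
have d20 : 0 <= d2 by exact: mdist_ge0.
have d10 : 0 <= d1 by exact: mdist_ge0.
move=> e D0 /=; case: eqVneq => [d1E|d1n].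
  rewrite cos_pihalf sin_pihalf mulr0 mulr1; split => //.
  by apply/eqP; rewrite -(@eqrXn2 _ 2)//= e d1E expr0n add0r.
have d1_gt0 : 0 < d1 by rewrite lt_neqAle eq_sym d1n.
have q : Num.sqrt (1 + (d2 / d1) ^+ 2) = D / d1.
  rewrite -[RHS]ger0_norm ?divr_ge0// -sqrtr_sqr; congr Num.sqrt.
  by rewrite !expr_div_n e; field.
have D_gt0 : 0 < D.
  have d1s : 0 < d1 ^+ 2 by rewrite exprn_gt0.
  rewrite lt_neqAle D0 andbT; apply/eqP => D00; move: e.
  by rewrite -D00 expr0n /=; have := sqr_ge0 d2; lra.
have ct : cos (atan (d2 / d1)) = d1 / D by rewrite cos_atan q invf_div.
have st : sin (atan (d2 / d1)) = d2 / D.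
  have c0 : cos (atan (d2 / d1)) != 0.
    by rewrite ct mulf_neq0// ?invr_eq0 gt_eqF.
  have := atanK (d2 / d1); rewrite /tan => /(congr1 ( *%R^~ (cos (atan (d2 / d1))))).
  by rewrite divfK// => ->; rewrite ct; field; rewrite !gt_eqF.
by rewrite ct st ![D * _]mulrC !divfK// gt_eqF.
Qed.

Lemma slope_form_le (b : R * R) theta kap : 0 < kap ->
  exists2 e, 0 < e & forall phi, `|phi - theta| < e ->
  b.1 * cos phi + b.2 * sin phi <=
    b.1 * cos theta + b.2 * sin theta + (`|b.1| + `|b.2|) * kap.
Proof.
move=> k0.
have [e1 /= e10 h1] := iffLR (nbhs_ballP _ _)
  (cvgr_dist_le _ _ (@continuous_cos R theta) _ k0).
have [e2 /= e20 h2] := iffLR (nbhs_ballP _ _)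
  (cvgr_dist_le _ _ (@continuous_sin R theta) _ k0).
exists (Num.min e1 e2) => [|phi]; first by rewrite lt_min e10.
rewrite lt_min distrC => /andP[/h1 /= c1 /h2 /= s1].
have bd (x y : R) : `|y| <= kap -> - (x * y) <= `|x| * kap.
  move=> yk; apply: le_trans (ler_norm _) _; rewrite normrN normrM.
  by rewrite ler_wpM2l.
have := bd b.1 _ c1; have := bd b.2 _ s1; lra.
Qed.

End displacement.

(** * Positivity of beta *)

Section critical_exponent.
Context {R : realType} {T1 T2 : metricType R}.
Hypotheses (geo1 : geodesic_space T1) (cn1 : @cn_ineq R T1).
Hypotheses (geo2 : geodesic_space T2) (cn2 : @cn_ineq R T2).
Hypothesis proper1 : forall (o : T1) r, compact (cball o r).
Hypothesis proper2 : forall (o : T2) r, compact (cball o r).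
Local Notation X := (hprod T1 T2).
Local Notation G := (selfisometry T1 * selfisometry T2)%type.
Variables (Gamma : set G) (dG : discrete_group Gamma).
Variables (o : X) (b : R * R) (theta : R) (xi0 : boundary X).
Hypothesis htheta : 0 < theta < pi / 2.
Variable mu : X -> {finite_measure set (borel_boundary xi0) -> \bar R}.
Hypothesis dmu : invariant_density Gamma o b theta mu.
Local Notation atom_mass := (atom_mass mu).

Let mset1 xi : measurable ([set xi] : set (borel_boundary xi0)).
Proof. by apply: measurable_boundary_set1; exact: hprod_cn. Qed.

Lemma passes_le (T : metricType R) (p : T) B B' y (c : ray T) :
  B <= B' -> passes p B y c -> passes p B' y c.
Proof.
move=> BB h t t0; have [m e mB] := h t t0.
by exists m => //; exact: le_trans BB.
Qed.

(* Of the three candidates [g ^+ 0], [g ^+ N], [g ^+ (2 * N)], each factor rules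
   out at most one. *)
Lemma choose_passing (g : G) (s1 : R -> T1) (s2 : R -> T2)
    (hs1 : geodesic_line s1) (hs2 : geodesic_line s2) (l1 l2 : R)
    (zeta1 : boundary T1) (zeta2 : boundary T2) :
  0 < l1 -> (forall t, g.1 (s1 t) = s1 (t + l1)) -> contracting_line hs1 ->
  0 < l2 -> (forall t, g.2 (s2 t) = s2 (t + l2)) -> contracting_line hs2 ->
  ~ axis_end hs1 zeta1 -> ~ axis_end hs2 zeta2 ->
  exists (N : nat) (B : R), 0 <= B /\ forall y : X, exists i : 'I_3,
    passes o.1 B y.1 (ray_act (g.1 ^+ (i * N))%g (repr zeta1)) /\
    passes o.2 B y.2 (ray_act (g.2 ^+ (i * N))%g (repr zeta2)).
Proof.
move=> l10 gl1 c1 l20 gl2 c2 nz1 nz2.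
have [N1 h1] := expg_passes geo1 cn1 l10 gl1 c1 o.1 nz1.
have [N2 h2] := expg_passes geo2 cn2 l20 gl2 c2 o.2 nz2.
have [B1 {}h1] := h1 (maxn N1 N2) (leq_maxl _ _).
have [B2 {}h2] := h2 (maxn N1 N2) (leq_maxr _ _).
exists (maxn N1 N2), (Num.max 0 (Num.max B1 B2)).
split; first by rewrite le_max lexx.
move=> y; set B := Num.max 0 _; set N := maxn N1 N2 in h1 h2 *.
have B1B : B1 <= B by rewrite /B !le_max lexx !orbT.
have B2B : B2 <= B by rewrite /B !le_max lexx !orbT.
pose P1 (i : nat) := passes o.1 B y.1 (ray_act (g.1 ^+ (i * N))%g (repr zeta1)).
pose P2 (i : nat) := passes o.2 B y.2 (ray_act (g.2 ^+ (i * N))%g (repr zeta2)).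
have p1 i j : (i < 3)%N -> (j < 3)%N -> i != j -> P1 i \/ P1 j.
  move=> i3 j3 ij; have [h|h] := h1 y.1 i j i3 j3 ij.
    by left; exact: passes_le h.
  by right; exact: passes_le h.
have p2 i j : (i < 3)%N -> (j < 3)%N -> i != j -> P2 i \/ P2 j.
  move=> i3 j3 ij; have [h|h] := h2 y.2 i j i3 j3 ij.
    by left; exact: passes_le h.
  by right; exact: passes_le h.
have : (P1 0%N /\ P2 0%N) \/ (P1 1%N /\ P2 1%N) \/ (P1 2%N /\ P2 2%N).
  have := p1 0%N 1%N isT isT isT; have := p1 0%N 2%N isT isT isT.
  have := p1 1%N 2%N isT isT isT; have := p2 0%N 1%N isT isT isT.
  have := p2 0%N 2%N isT isT isT; have := p2 1%N 2%N isT isT isT.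
  tauto.
by case=> [|[]] h; [exists (@Ordinal 3 0 isT)|exists (@Ordinal 3 1 isT)|
  exists (@Ordinal 3 2 isT)].
Qed.

Lemma expg_prod (g : G) n : (g ^+ n)%g = ((g.1 ^+ n)%g, (g.2 ^+ n)%g).
Proof.
elim: n => [//|n IH]; by rewrite !expgS IH.
Qed.

(* The atoms [psi a zeta], for [a] in the annulus counted by [orbit_count], have
   mass at least [exp (- (b1 * d1 + b2 * d2) - c0)], and polynomially many [a]
   give the same atom. *)
Lemma radial_form_gt0 (g : G) (s1 : R -> T1) (s2 : R -> T2)
    (hs1 : geodesic_line s1) (hs2 : geodesic_line s2) (l1 l2 : R)
    (zeta : boundary X) (zeta1 : boundary T1) (zeta2 : boundary T2) :
  Gamma g ->
  0 < l1 -> (forall t, g.1 (s1 t) = s1 (t + l1)) -> contracting_line hs1 ->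
  0 < l2 -> (forall t, g.2 (s2 t) = s2 (t + l2)) -> contracting_line hs2 ->
  bd_coord zeta zeta1 zeta2 theta -> 0 < atom_mass o zeta ->
  ~ axis_end hs1 zeta1 -> ~ axis_end hs2 zeta2 ->
  (0 < growth_exponent Gamma o theta)%E ->
  0 < b.1 * cos theta + b.2 * sin theta.
Proof.
move=> Gg l10 gl1 c1 l20 gl2 c2 hz az nz1 nz2 hgr.
rewrite ltNge; apply/negP => beta0.
have [del del0 hdel] := growth_exponent_gt0 hgr.
have [N [B [B0 hB]]] := choose_passing l10 gl1 c1 l20 gl2 c2 nz1 nz2.
have [K hK] := orbit_multiplicity geo1 cn1 geo2 cn2 proper1 proper2 dG o B.
pose bb := `|b.1| + `|b.2|; have bb0 : 0 <= bb by rewrite addr_ge0.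
(* The slope error is then at most del / 2; the summand 1 keeps the denominator positive when b =
   0. *)
pose kap := del / (2 * (bb + 1)).
have bb1 : 0 < 2 * (bb + 1) by lra.
have kap0 : 0 < kap by rewrite divr_gt0.
have bbk : bb * kap <= del / 2.
  have -> : del / 2 = (bb + 1) * kap by rewrite /kap; field; lra.
  by rewrite ler_pM2r//; lra.
have [e0 e00 hslope] := slope_form_le b theta kap0.
have [e [/andP[e_gt0 ee0] hcount]] := hdel e0 e00.
pose p i : G := (g ^+ (i * N))%g.
pose F1 := \sum_(i < 3) mdist o.1 ((p i).1 o.1).
pose F2 := \sum_(i < 3) mdist o.2 ((p i).2 o.2).
have F1i (i : 'I_3) : mdist o.1 ((p i).1 o.1) <= F1.
  by rewrite /F1 (bigD1 i)//= lerDl sumr_ge0// => j _; exact: mdist_ge0.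
have F2i (i : 'I_3) : mdist o.2 ((p i).2 o.2) <= F2.
  by rewrite /F2 (bigD1 i)//= lerDl sumr_ge0// => j _; exact: mdist_ge0.
pose c0 := `|b.1| * (2 * B + F1) + `|b.2| * (2 * B + F2).
have [idx hidx] := choice (fun a : G => hB (a.1^-1%g o.1, a.2^-1%g o.2)).
have {}hidx (a : G) :
    passes o.1 B (a.1^-1%g o.1) (ray_act (p (idx a)).1 (repr zeta1)) /\
    passes o.2 B (a.2^-1%g o.2) (ray_act (p (idx a)).2 (repr zeta2)).
  by have := hidx a; rewrite /p expg_prod.
pose psi (a : G) : G := (a * p (idx a))%g.
have Gpsi a : Gamma a -> Gamma (psi a).
  by move=> Ga; apply: groupMul => //; exact: groupExp.
have inv_dist (T : metricType R) (f : selfisometry T) (x : T) :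
    mdist x (f^-1%g x) = mdist x (f x).
  rewrite -(isometry_dist f) -[f (f^-1%g x)]/((f * f^-1)%g x) mulgV.
  by rewrite metric_sym.
have mass a n : Gamma a -> mdist o (prod_isometry a o) <= n ->
    `|displacement_slope o a - theta| < e ->
    expR (- (del / 2 * n) - c0) * atom_mass o zeta <=
      atom_mass o (boundary_act (prod_isometry (psi a)) zeta).
  move=> Ga an asl.
  rewrite (atom_transport dmu mset1 (groupInv dG (Gpsi a Ga)) (Gpsi a Ga) az hz).
  rewrite ler_pM2r// ler_expR.
  have [q1 q2] := hidx a.
  have u1 := busemann_passes B0 q1; have u2 := busemann_passes B0 q2.
  rewrite inv_dist in u1; rewrite inv_dist in u2.
  have -> : (psi a).1^-1%g o.1 = ((p (idx a)).1^-1)%g ((a.1^-1)%g o.1).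
    by rewrite -[(psi a).1]/(a.1 * (p (idx a)).1)%g invgM.
  have -> : (psi a).2^-1%g o.2 = ((p (idx a)).2^-1)%g ((a.2^-1)%g o.2).
    by rewrite -[(psi a).2]/(a.2 * (p (idx a)).2)%g invgM.
  set v1 := busemann _ _ _ in u1 *; set v2 := busemann _ _ _ in u2 *.
  have [d1 d2] := displacement_polar o a.
  have sl := hslope _ (lt_trans asl ee0).
  rewrite d1 in u1; rewrite d2 in u2.
  have d0 := mdist_ge0 o (prod_isometry a o).
  set d := mdist o (prod_isometry a o) in an u1 u2 d0 *.
  set ph := displacement_slope o a in u1 u2 sl *.
  have w1 : - (`|b.1| * (2 * B + F1)) <= b.1 * (v1 + d * cos ph).
    rewrite lerNl; apply: le_trans (ler_norm _) _; rewrite normrN normrM.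
    by rewrite ler_wpM2l//; apply: le_trans u1 _; rewrite lerD2l.
  have w2 : - (`|b.2| * (2 * B + F2)) <= b.2 * (v2 + d * sin ph).
    rewrite lerNl; apply: le_trans (ler_norm _) _; rewrite normrN normrM.
    by rewrite ler_wpM2l//; apply: le_trans u2 _; rewrite lerD2l.
  (* The assumption beta <= 0 enters here: only the variation of the form near theta remains. *)
  have w3 : b.1 * cos ph + b.2 * sin ph <= del / 2 by rewrite -/bb in sl; lra.
  have w4 := ler_wpM2l d0 w3.
  have w5 : d * (del / 2) <= n * (del / 2) by rewrite ler_pM2r//; lra.
  by rewrite /c0; lra.
pose M := fine (mu o setT).
have M0 : 0 <= M by rewrite fine_ge0// measure_ge0.
(* Three candidate powers, the constant of the multiplicity, and the bound on the number of atoms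
   without its exponential factor. *)
pose C := 3 * K%:R * (M * expR c0 / atom_mass o zeta).
have C0 : 0 <= C.
  apply: mulr_ge0; first by rewrite mulr_ge0.
  by apply: divr_ge0; [rewrite mulr_ge0 ?expR_ge0|exact: ltW].
have del20 : 0 < del / 2 by lra.
have [n0 hn0] := expR_gt_square del20 C0 B0.
have [n nn0] := hcount n0.
apply/negP; rewrite -leNgt.
apply: counting_le; first exact: expR_ge0.
move=> s us hs.
have n_ge0 : 0 <= n%:R :> R by [].
pose w0 := expR (- (del / 2 * n%:R) - c0) * atom_mass o zeta.
(* The candidate index is recorded with the atom because [orbit_multiplicity] needs the same power
   of g throughout a fibre. *)
pose f (a : G) := (idx a, boundary_act (prod_isometry (psi a)) zeta).
pose r := undup [seq (f a).2 | a <- s].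
pose k := ((Num.truncn (n%:R + B + 1)).+1 ^ 2 * K)%N.
have sk : (size s <= 3 * size r * k)%N.
  have -> : (3 * size r)%N = size [seq (i, x) | i <- enum 'I_3, x <- r].
    by rewrite size_allpairs size_enum_ord.
  apply: (@leq_size_fibers _ _ f) => [a sa|[i xi] _].
    apply/allpairsP; exists (f a) => /=; rewrite mem_enum mem_undup.
    by split => //; apply/mapP; exists a.
  rewrite -size_filter; set s' := [seq a <- s | f a == (i, xi)].
  case E : s' => [//|a0 s0]; rewrite -E.
  have in_s' a : a \in s' -> [/\ a \in s, idx a = i & (f a).2 = xi].
    rewrite mem_filter => /andP[/eqP fa sa].
    by split => //; [exact: (congr1 fst fa)|exact: (congr1 snd fa)].
  have [_ i0 x0] : [/\ a0 \in s, idx a0 = i & (f a0).2 = xi].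
    by apply: in_s'; rewrite E mem_head.
  have k0 := bd_coord_act (psi a0) hz; rewrite [boundary_act _ zeta]x0 in k0.
  apply: (hK n%:R s' (p i) zeta1 (boundary_act (psi a0).1 zeta1) zeta2
    (boundary_act (psi a0).2 zeta2) (filter_uniq _ us)) => a /in_s'[sa ia xa].
  have [Ga /andP[_ an] _] := hs a sa; split => //.
  have ka := bd_coord_act (psi a) hz; rewrite [boundary_act _ zeta]xa in ka.
  have [ex1 ex2] := bd_coord_unique htheta htheta ka k0.
  have [q1 q2] := hidx a; rewrite ia in q1 q2.
  split => //.
    by rewrite -boundary_actM -ex1 -[(psi a).1]/(a.1 * (p (idx a)).1)%g ia.
  by rewrite -boundary_actM -ex2 -[(psi a).2]/(a.2 * (p (idx a)).2)%g ia.
have rM : (size r)%:R * w0 <= M.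
  apply: (atom_count mset1); first exact: undup_uniq.
  move=> xi; rewrite mem_undup => /mapP[a sa ->].
  by have [Ga /andP[_ an] asl] := hs a sa; exact: mass.
have w00 : 0 < w0 by rewrite mulr_gt0// expR_gt0.
apply: (@le_trans _ _ ((3 * size r * k)%N%:R)); first by rewrite ler_nat.
(* One half bounds the number of atoms, the other the polynomial multiplicity. *)
have -> : del * n%:R = del / 2 * n%:R + del / 2 * n%:R by lra.
rewrite expRD.
have r1 : (size r)%:R <= M / w0 by rewrite ler_pdivlMr.
have w0E : M / w0 = M * expR c0 / atom_mass o zeta * expR (del / 2 * n%:R).
  rewrite /w0 -opprD expRN expRD; field.
  by rewrite !gt_eqF ?expR_gt0.
apply: (@le_trans _ _ (C * ((Num.truncn (n%:R + B + 1)).+1 ^ 2)%:R *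
    expR (del / 2 * n%:R))); last first.
  by rewrite ler_pM2r ?expR_gt0//; exact: hn0.
rewrite /k /C; rewrite w0E in r1.
move: ((Num.truncn _).+1 ^ 2)%N => q; rewrite !natrM.
have qK : 0 <= 3 * K%:R * q%:R :> R by rewrite !mulr_ge0.
by have := ler_wpM2l qK r1; lra.
Qed.

End critical_exponent.

(** * Radial limit points *)

Section radial_points.
Context {R : realType} {T1 T2 : metricType R}.
Hypotheses (cn1 : @cn_ineq R T1) (cn2 : @cn_ineq R T2).
Local Notation X := (hprod T1 T2).
Local Notation G := (selfisometry T1 * selfisometry T2)%type.
Variables (Gamma : set G) (dG : discrete_group Gamma).
Variables (o : X) (b : R * R) (theta : R) (xi0 : boundary X).
Hypothesis htheta : 0 < theta < pi / 2.
Variable mu : X -> {finite_measure set (borel_boundary xi0) -> \bar R}.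
Hypothesis dmu : invariant_density Gamma o b theta mu.
Local Notation atom_mass := (atom_mass mu).

Lemma bounded_dist_ray_repr (T : metricType R) (u : nat -> T) (eta : boundary T) :
  bounded_dist_ray u eta -> exists C, forall n, exists2 t, 0 <= t &
    mdist (u n) ((repr eta : ray T) t) <= C.
Proof.
move=> [c [ce [C hC]]].
have /asboolP[D hD] : asymptotic c (repr eta).
  by apply/endpoint_eq; rewrite endpoint_repr.
exists (C + D) => n; have [t t0 ht] := hC n; exists t => //.
by apply: le_trans (metric_triangle _ (c t) _) _; rewrite lerD// hD.
Qed.

(** No limit along the radial sequence is needed: a single element that enters the cone
    neighbourhood with parameter r already makes the translated atom heavier than the whole
    measure. *)
Lemma radial_atom_null (eta : boundary X) : 0 < b.1 * cos theta + b.2 * sin theta ->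
  radial_limit_set Gamma o eta -> ~ 0 < atom_mass o eta.
Proof.
set beta := _ + _ => beta0 [g [Gg cvg_g rad]] a0.
have mset1 xi : measurable ([set xi] : set (borel_boundary xi0)).
  by apply: measurable_boundary_set1; exact: hprod_cn.
have [eta1 [eta2 [_ he]]] := atom_coord dmu mset1 a0.
have [bd1 bd2] : bounded_dist_ray (fun n => (g n).1 o.1) eta1 /\
    bounded_dist_ray (fun n => (g n).2 o.2) eta2.
  case: rad => [[th' [e1 [e2 [hth' he' h1 h2]]]]|[e1 [h1 _]]|[e2 [h2 _]]].
  - by have [-> ->] := bd_coord_unique htheta hth' he he'.
  - by case: (bd_coord_not0 htheta he h1).
  - by case: (bd_coord_not_pihalf htheta he h2).
have [C1 hC1] := bounded_dist_ray_repr bd1.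
have [C2 hC2] := bounded_dist_ray_repr bd2.
pose M := fine (mu o setT).
have bound n : expR (b.1 * busemann eta1 o.1 ((g n).1 o.1) +
    b.2 * busemann eta2 o.2 ((g n).2 o.2)) * atom_mass o eta <= M.
  have Gn' := groupInv dG (Gg n).
  have := atom_transport dmu mset1 (groupInv dG Gn') Gn' a0 he.
  rewrite -[(_^-1%g).1]/((g n).1^-1)%g -[(_^-1%g).2]/((g n).2^-1)%g !invgK => <-.
  have := @atom_count _ _ _ o xi0 mu mset1 [:: boundary_act (prod_isometry (g n)^-1%g) eta]
    (atom_mass o (boundary_act (prod_isometry (g n)^-1%g) eta)) isT.
  by rewrite mul1r; apply=> xi; rewrite inE => /eqP ->.
have [c [c1 [c2 [ce _ _ cE]]]] := he.
pose D1 := 2 * C1 + 2 * mdist o.1 ((repr eta1 : ray T1) 0) + mdist o.1 (c 0).1.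
pose D2 := 2 * C2 + 2 * mdist o.2 ((repr eta2 : ray T2) 0) + mdist o.2 (c 0).2.
pose K := `|b.1| * D1 + `|b.2| * D2.
pose bb := `|b.1| + `|b.2|; have bb0 : 0 <= bb by rewrite addr_ge0.
(* r serves twice: an error D / r in each factor costs at most half of D * beta, and as D > r the
   other half exceeds the constants. *)
pose r := 1 + 2 * bb / beta + 2 * (`|K| + `|M / atom_mass o eta|) / beta.
have q1 : 0 <= 2 * bb / beta by rewrite divr_ge0 ?(ltW beta0)// mulr_ge0.
have q2 : 0 <= 2 * (`|K| + `|M / atom_mass o eta|) / beta.
  by rewrite divr_ge0 ?(ltW beta0)// mulr_ge0// addr_ge0.
have r1 : 1 <= r by rewrite /r; lra.
have r0 : 0 < r by lra.
have rb1 : 2 * bb <= r * beta.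
  by rewrite -ler_pdivrMr// /r; lra.
have rb2 : beta + 2 * (`|K| + `|M / atom_mass o eta|) <= r * beta.
  have -> : beta + 2 * (`|K| + `|M / atom_mass o eta|) =
    (1 + 2 * (`|K| + `|M / atom_mass o eta|) / beta) * beta by field; rewrite gt_eqF.
  by rewrite ler_pM2r// /r; lra.
have nb : nbhs (inr eta : bordification X) (cone_nbhd c r 1).
  apply: open_nbhs_nbhs; split; first exact: cone_nbhd_open.
  by rewrite -ce; exact: cone_nbhd_endpoint.
have [n _ /(_ n (leqnn n)) /= [rD [gs [gsg gsr]]]] := cvg_g _ nb.
set y := prod_isometry (g n) o in rD gsg.
set D := mdist (c 0) y in rD.
have rD' : 0 <= r <= D by rewrite !ltW.
have [s1 s2] := hprod_geodesic_slope gsg rD'.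
have ct0 := cE 0 (lexx 0); have ctr := cE r (ltW r0).
have [cos0 sin0] := cos_sin_gt0 htheta.
have e1 : mdist (c 0).1 (c r).1 = r * cos theta.
  have rt : 0 <= r * cos theta by rewrite mulr_ge0// ltW.
  by rewrite ct0 ctr /= mul0r ray_geodesic// sub0r normrN ger0_norm.
have e2 : mdist (c 0).2 (c r).2 = r * sin theta.
  have rt : 0 <= r * sin theta by rewrite mulr_ge0// ltW.
  by rewrite ct0 ctr /= mul0r ray_geodesic// sub0r normrN ger0_norm.
have close (T : metricType R) (p x x' : T) (u : R) : mdist x x' <= 1 ->
    mdist p x' = u -> `|mdist p x - u| <= 1.
  move=> h <-; have := metric_triangle p x x'; have := metric_triangle p x' x.
  by rewrite (metric_sym x' x) ler_norml; lra.
have f1 := close _ _ _ _ _ (le_trans (hprod_ge1 _ _) (ltW gsr)) e1.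
have f2 := close _ _ _ _ _ (le_trans (hprod_ge2 _ _) (ltW gsr)) e2.
have [t1 t10 ht1] := hC1 n; have [t2 t20 ht2] := hC2 n.
have u1 := busemann_near_ray o.1 t10 ht1.
have u2 := busemann_near_ray o.2 t20 ht2.
have := bound n.
set v1 := busemann _ _ _ in u1 *; set v2 := busemann _ _ _ in u2 *.
have D0 : 0 < D by lra.
(* Along the geodesic to y the factor distances grow proportionally, so the error 1 at time r
   becomes at most D / r at time D. *)
have g1 : `|mdist (c 0).1 y.1 - D * cos theta| * r <= D.
  rewrite -[X in _ * X](gtr0_norm r0) -normrM.
  have -> : (mdist (c 0).1 y.1 - D * cos theta) * r =
    D * (mdist (c 0).1 (gs r).1 - r * cos theta).
    by rewrite -/D in s1; lra.
  by rewrite normrM (gtr0_norm D0) ler_piMr// ltW.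
have g2 : `|mdist (c 0).2 y.2 - D * sin theta| * r <= D.
  rewrite -[X in _ * X](gtr0_norm r0) -normrM.
  have -> : (mdist (c 0).2 y.2 - D * sin theta) * r =
    D * (mdist (c 0).2 (gs r).2 - r * sin theta).
    by rewrite -/D in s2; lra.
  by rewrite normrM (gtr0_norm D0) ler_piMr// ltW.
have near (T : metricType R) (p q x : T) : `|mdist p x - mdist q x| <= mdist p q.
  have := metric_triangle p q x; have := metric_triangle q p x.
  by rewrite (metric_sym q p) ler_norml; lra.
have w1 : `|v1 - mdist (c 0).1 y.1| <= D1.
  have := near _ o.1 (c 0).1 y.1.
  by have := ler_distD (mdist o.1 y.1) v1 (mdist (c 0).1 y.1); rewrite /D1; lra.
have w2 : `|v2 - mdist (c 0).2 y.2| <= D2.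
  have := near _ o.2 (c 0).2 y.2.
  by have := ler_distD (mdist o.2 y.2) v2 (mdist (c 0).2 y.2); rewrite /D2; lra.
have low (x z w : R) : `|z| <= w -> - (`|x| * w) <= x * z.
  move=> zw; rewrite lerNl; apply: le_trans (ler_norm _) _.
  by rewrite normrN normrM ler_wpM2l.
have x1 := low b.1 _ _ w1; have x2 := low b.2 _ _ w2.
rewrite -ler_pdivlMr// in g1; rewrite -ler_pdivlMr// in g2.
have y1 := low b.1 _ _ g1; have y2 := low b.2 _ _ g2.
have z : D * beta / 2 - K <= b.1 * v1 + b.2 * v2.
  have : bb * (D / r) <= D * beta / 2.
    rewrite mulrA ler_pdivrMr//.
    have := ler_wpM2r (ltW D0) rb1; lra.
  rewrite /K /bb /beta; lra.
have z2 : `|M / atom_mass o eta| < 1 + (b.1 * v1 + b.2 * v2).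
  have : r * beta <= D * beta by rewrite ler_pM2r// ltW.
  by have := ler_norm K; lra.
have := expR_ge1Dx (b.1 * v1 + b.2 * v2).
rewrite -ler_pdivlMr// => z3 z4; have := ler_norm (M / atom_mass o eta); lra.
Qed.

End radial_points.

(** Each factor forbids two powers of h, one for each end of the axis of g. *)
Lemma pick_avoiding4 (p q p' q' : nat) : exists2 i : nat, (i < 5)%N &
  [/\ i != p, i != q, i != p' & i != q'].
Proof.
apply: contrapT => h.
have : (size (iota 0 5) <= size [:: p; q; p'; q'])%N.
  apply: uniq_leq_size (iota_uniq _ _) _ => i; rewrite mem_iota add0n /= => i5.
  apply: contrapT => /negP; rewrite !inE !negb_or => /and4P[h1 h2 h3 h4].
  by apply: h; exists i.
by rewrite size_iota.
Qed.

Theorem theoremE (R : realType) (X1 X2 : metricType R)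
    (hX1 : hadamard X1) (hX2 : hadamard X2)
    (lcX1 : locally_compact [set: X1]) (lcX2 : locally_compact [set: X2])
    (Gamma : set (selfisometry X1 * selfisometry X2)) (hGamma : discrete_group Gamma)
    (g h : selfisometry X1 * selfisometry X2) (hg : Gamma g) (hh : Gamma h)
    (rk_g1 : rank_one g.1) (rk_h1 : rank_one h.1)
    (indep1 : independent g.1 h.1)
    (rk_g2 : rank_one g.2) (rk_h2 : rank_one h.2)
    (indep2 : independent g.2 h.2)
    (o : hprod X1 X2)
    (theta : R) (htheta : 0 < theta < pi / 2)
    (hdelta : (0 < growth_exponent Gamma o theta)%E)
    (b : R * R) (xi0 : boundary (hprod X1 X2))
    (mu : hprod X1 X2 -> {finite_measure set (borel_boundary xi0) -> \bar R})
    (hmu : invariant_density Gamma o b theta mu)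
    (eta : boundary (hprod X1 X2)) :
  radial_limit_set Gamma o eta -> mu o [set eta] = 0%E.
Proof.
move=> rad; have [cX1 geo1 cat1] := hX1; have [cX2 geo2 cat2] := hX2.
have cn1 := cat0_cn geo1 cat1; have cn2 := cat0_cn geo2 cat2.
have proper1 := hopf_rinow cX1 geo1 lcX1.
have proper2 := hopf_rinow cX2 geo2 lcX2.
have mset1 xi : measurable ([set xi] : set (borel_boundary xi0)).
  by apply: measurable_boundary_set1; exact: hprod_cn.
suff e0 : atom_mass mu o eta = 0 by rewrite (atom_massE mu mset1) e0.
apply/eqP; rewrite eq_le atom_mass_ge0 andbT leNgt.
apply/negP => a0; apply: (radial_atom_null cn1 cn2 hGamma htheta hmu _ rad a0).
have [s1 [ls1 [l1 l10 gl1]] ns1] := rk_g1.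
have [s2 [ls2 [l2 l20 gl2]] ns2] := rk_g2.
have [u1 [lu1 [k1 k10 hk1]] nu1] := rk_h1.
have [u2 [lu2 [k2 k20 hk2]] nu2] := rk_h2.
have cs1 := rank_one_contracting ls1 hX1 lcX1 l10 gl1 ns1.
have cs2 := rank_one_contracting ls2 hX2 lcX2 l20 gl2 ns2.
have cu1 := rank_one_contracting lu1 hX1 lcX1 k10 hk1 nu1.
have cu2 := rank_one_contracting lu2 hX2 lcX2 k20 hk2 nu2.
have [eta1 [eta2 [_ he]]] := atom_coord hmu mset1 a0.
have [N1 hN1] := leave_axis_ends geo1 cn1 ls1 k10 gl1 hk1 cu1 indep1 eta1.
have [N2 hN2] := leave_axis_ends geo2 cn2 ls2 k20 gl2 hk2 cu2 indep2 eta2.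
have [p [q hpq]] := hN1 (maxn N1 N2) (leq_maxl _ _).
have [p' [q' hpq']] := hN2 (maxn N1 N2) (leq_maxr _ _).
have [i _ [ip iq ip' iq']] := pick_avoiding4 p q p' q'.
pose f := (h ^+ (i * maxn N1 N2))%g.
have Gf : Gamma f by exact: groupExp.
have f1 : f.1 = (h.1 ^+ (i * maxn N1 N2))%g by rewrite /f expg_prod.
have f2 : f.2 = (h.2 ^+ (i * maxn N1 N2))%g by rewrite /f expg_prod.
apply: (radial_form_gt0 geo1 cn1 geo2 cn2 proper1 proper2 hGamma htheta hmu hg
  l10 gl1 cs1 l20 gl2 cs2 (bd_coord_act f he)) => //.
- rewrite (atom_transport hmu mset1 (groupInv hGamma Gf) Gf a0 he).
  by rewrite mulr_gt0// expR_gt0.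
- by rewrite f1; exact: hpq.
- by rewrite f2; exact: hpq'.
Qed.
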